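(* Let $X$ be an (infinite) discrete space, and let $G$ be any one of the groups: ${\rm U}(\ell^2(X))$ in the strong operator topology; ${\rm S}(X)$ with the topology of pointwise convergence; or, if $X$ is an ultrahomogeneous chain, $(\mathrm{Aut}\,X,\tau_\partial)$. (1) Every remainder of $G$ is Lindelöf and $\sigma$-compact, and $G$ is Čech-complete, if and only if $X$ is countable. (2) Every remainder of $G$ is pseudocompact and Baire, and $G$ is not Čech-complete, if and only if $X$ is uncountable. Let $X$ be an ultrahomogeneous LOTS. (1') Every remainder of $(\mathrm{Aut}\,X,\tau_p)$ is Lindelöf and $\sigma$-compact, and $(\mathrm{Aut}\,X,\tau_p)$ is Čech-complete, if and only if $X$ is continuously dense and separable. (2') Every remainder of $(\mathrm{Aut}\,X,\tau_p)$ is Lindelöf and Baire, and $(\mathrm{Aut}\,X,\tau_p)$ is not Čech-complete, if and only if $X$ is separable and not continuously dense. (3') Every remainder of $(\mathrm{Aut}\,X,\tau_p)$ is pseudocompact and Baire, and $(\mathrm{Aut}\,X,\tau_p)$ is not Čech-complete, if and only if $X$ is not separable.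
   Context: A remainder of a topological group $G$ is a subspace $bG\setminus G$, where $bG$ is any Hausdorff compactification of the space $G$. ${\rm U}(\ell^2(X))$ is the unitary group of the Hilbert space $\ell^2(X)$; ${\rm S}(X)$ is the group of all permutations of $X$. A chain is an infinite linearly ordered set; it is ultrahomogeneous if for every $n$ and all $x_1<\dots<x_n$, $y_1<\dots<y_n$ there is an order automorphism $g$ with $g(x_i)=y_i$. $\mathrm{Aut}\,X$ is the group of order automorphisms. $\tau_\partial$ is the topology of pointwise convergence on $\mathrm{Aut}\,X$ when $X$ is discrete (permutation topology). An ultrahomogeneous LOTS is an ultrahomogeneous chain with the order topology; $\tau_p$ is then the topology of pointwise convergence on $\mathrm{Aut}\,X$ with respect to the order topology of $X$. Continuously dense means that the linear order is dense and continuous, i.e. has no jumps and no proper gaps (Dedekind complete). Separable refers to the order topology. *)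

(* Defs.v *)
From HB Require Import structures.
From mathcomp Require Import all_boot all_order all_algebra.
From mathcomp Require Import finmap complex.
From mathcomp Require Import all_classical all_reals all_analysis borel_hierarchy.
From mathcomp Require Import ring lra.
From mathcomp.analysis.showcase Require summability.
Import Order.TTheory GRing.Theory Num.Theory.
Import numFieldNormedType.Exports.

Set Implicit Arguments.
Unset Strict Implicit.
Unset Printing Implicit Defensive.

Local Open Scope classical_set_scope.
Local Open Scope ring_scope.
Local Open Scope complex_scope.

Section square_summable.
Variables (R : realType) (X : choiceType).
Implicit Types (f g : X -> R[i]) (A : {fset X}).

Definition sqmod (z : R[i]) : R := complex.Re z ^+ 2 + complex.Im z ^+ 2.

Definition sqsum f : \bar R := (\esum_(x in [set: X]) (sqmod (f x))%:E)%E.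

Definition l2_pred : {pred (X -> R[i])} := [pred f | sqsum f < +oo]%E.

Lemma sqmod_ge0 z : 0 <= sqmod z.
Proof. by rewrite addr_ge0// sqr_ge0. Qed.

Lemma sqmodM z w : sqmod (z * w) = sqmod z * sqmod w.
Proof. by case: z w => [a b] [c d]; rewrite /sqmod /=; ring. Qed.

Lemma sqmod_eq0 z : sqmod z <= 0 -> z = 0.
Proof.
case: z => a b; rewrite /sqmod /= => h.
have a0 : a ^+ 2 <= 0 by apply: le_trans h; rewrite lerDl sqr_ge0.
have b0 : b ^+ 2 <= 0 by apply: le_trans h; rewrite lerDr sqr_ge0.
by congr Complex; apply/eqP; rewrite -sqrf_eq0 eq_le sqr_ge0 ?a0 ?b0.
Qed.

(* A weighted form of convexity, from which Minkowski's inequality follows by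
   taking for s and t the norms of the two summands *)
Lemma sqmodD_le (s t : R) z w : 0 < s -> 0 < t ->
  sqmod (z + w) <= (s + t) / s * sqmod z + (s + t) / t * sqmod w.
Proof.
move=> s0 t0.
have real_le (a c : R) :
    (a + c) ^+ 2 <= (s + t) / s * a ^+ 2 + (s + t) / t * c ^+ 2.
  rewrite -subr_ge0.
  have -> : (s + t) / s * a ^+ 2 + (s + t) / t * c ^+ 2 - (a + c) ^+ 2 =
            (t * a - s * c) ^+ 2 / (s * t).
    by field; rewrite !gt_eqF.
  by rewrite divr_ge0 ?sqr_ge0// ltW// mulr_gt0.
case: z w => [a b] [c d]; rewrite /sqmod /=.
by have := lerD (real_le a c) (real_le b d); lra.
Qed.

Lemma sqsum_leP f (M : R) :
  (sqsum f <= M%:E)%E <-> forall A, \sum_(x <- A) sqmod (f x) <= M.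
Proof.
split=> [fM A|fM].
  rewrite -lee_fin; apply: le_trans fM; apply: ereal_sup_ubound.
  exists [set` A]; first by split.
  by rewrite fsbig_finite//= set_fsetK sumEFin.
apply: ge_ereal_sup => _ [B [finB _]] <-.
by rewrite fsbig_finite//= sumEFin lee_fin.
Qed.

Lemma sqsum_ge0 f : (0 <= sqsum f)%E.
Proof. by apply: esum_ge0 => x _; rewrite lee_fin sqmod_ge0. Qed.

Lemma l2_predP f :
  reflect (exists M, forall A, \sum_(x <- A) sqmod (f x) <= M) (f \in l2_pred).
Proof.
apply: (iffP idP) => [|[M /sqsum_leP fM]]; rewrite inE /=.
  move=> foo; exists (fine (sqsum f)); apply/sqsum_leP.
  by rewrite fineK// ge0_fin_numE// sqsum_ge0.
by rewrite (le_lt_trans fM)// ltry.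
Qed.

Lemma l2_pred_submod : submod_closed l2_pred.
Proof.
split=> [|a f g /l2_predP[M fM] /l2_predP[N gN]]; apply/l2_predP.
  by exists 0 => A; rewrite big1// => x _; rewrite /sqmod /= expr0n /= addr0.
exists (2 * (sqmod a * M) + 2 * N) => A.
apply: le_trans (lerD (ler_wpM2l _ (ler_wpM2l (sqmod_ge0 a) (fM A)))
  (ler_wpM2l _ (gN A))) => //.
rewrite !mulr_sumr -big_split /=; apply: ler_sum => x _.
rewrite -sqmodM.
have := @sqmodD_le 1 1 (a * f x) (g x) ltr01 ltr01.
by rewrite divr1.
Qed.

HB.instance Definition _ :=
  GRing.isSubmodClosed.Build R[i] (X -> R[i]) l2_pred l2_pred_submod.

Record l2 := L2 { l2_fun :> X -> R[i]; _ : l2_fun \in l2_pred }.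

HB.instance Definition _ := [isSub for l2_fun].
HB.instance Definition _ := [Choice of l2 by <:].
HB.instance Definition _ := [SubChoice_isSubLmodule of l2 by <:].

Implicit Types u v : l2.

Definition l2_norm u : R := Num.sqrt (fine (sqsum u)).

Lemma l2_norm_ge0 u : 0 <= l2_norm u.
Proof. exact: sqrtr_ge0. Qed.

Lemma l2_norm_leP u (r : R) : 0 <= r ->
  l2_norm u <= r <-> forall A, \sum_(x <- A) sqmod (u x) <= r ^+ 2.
Proof.
move=> r0; have ufin : sqsum u \is a fin_num.
  by rewrite ge0_fin_numE ?sqsum_ge0//; case: u.
rewrite -sqsum_leP -(fineK ufin) lee_fin /l2_norm.
have {1}-> : r = Num.sqrt (r ^+ 2) by rewrite sqrtr_sqr ger0_norm.
by rewrite ler_sqrt// sqr_ge0.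
Qed.

Lemma l2_norm_sum u A : \sum_(x <- A) sqmod (u x) <= l2_norm u ^+ 2.
Proof. by move: A; apply/l2_norm_leP => //; exact: l2_norm_ge0. Qed.

Lemma l2_normD u v : l2_norm (u + v) <= l2_norm u + l2_norm v.
Proof.
apply/ler_addgt0Pr => e e0.
set s := l2_norm u + e / 2; set t := l2_norm v + e / 2.
have e2 : 0 < e / 2 by rewrite divr_gt0.
have s0 : 0 < s by rewrite ltr_wpDl// l2_norm_ge0.
have t0 : 0 < t by rewrite ltr_wpDl// l2_norm_ge0.
have -> : l2_norm u + l2_norm v + e = s + t by rewrite /s /t; field.
apply/l2_norm_leP => [|A]; first by rewrite ltW// addr_gt0.
have le_sqr w d : 0 < d -> \sum_(x <- A) sqmod ((w : l2) x) <=
    (l2_norm w + d) ^+ 2.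
  move=> d0; apply: le_trans (l2_norm_sum w A) _.
  by rewrite ler_sqr ?nnegrE ?addr_ge0 ?l2_norm_ge0 ?lerDl// ltW.
have st0 : 0 < s + t by rewrite addr_gt0.
have -> : (s + t) ^+ 2 = (s + t) / s * s ^+ 2 + (s + t) / t * t ^+ 2.
  by field; rewrite !gt_eqF.
apply: le_trans (lerD (ler_wpM2l _ (le_sqr u _ e2)) (ler_wpM2l _ (le_sqr v _ e2)));
  try by rewrite ltW// divr_gt0.
rewrite !mulr_sumr -big_split /=; apply: ler_sum => x _.
exact: sqmodD_le.
Qed.

Lemma sqmod_normc (z : R[i]) : complex.Re `|z| ^+ 2 = sqmod z.
Proof. by rewrite normc_def /= sqr_sqrtr// sqmod_ge0. Qed.

Lemma l2_normZ_le (a : R[i]) u : l2_norm (a *: u) <= complex.Re `|a| * l2_norm u.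
Proof.
have a0 : 0 <= complex.Re `|a| by rewrite normc_def sqrtr_ge0.
apply/l2_norm_leP => [|A]; first by rewrite mulr_ge0 ?l2_norm_ge0.
rewrite exprMn sqmod_normc.
apply: le_trans (ler_wpM2l (sqmod_ge0 a) (l2_norm_sum u A)).
by rewrite mulr_sumr; apply: ler_sum => x _; rewrite -sqmodM.
Qed.

Lemma l2_normZ (a : R[i]) u : l2_norm (a *: u) = complex.Re `|a| * l2_norm u.
Proof.
have [->|a0] := eqVneq a 0.
  apply/eqP; rewrite eq_le l2_normZ_le normr0 mul0r; exact: l2_norm_ge0.
apply/eqP; rewrite eq_le l2_normZ_le /=; set n := complex.Re `|a|.
have na : `|a| = n%:C by rewrite /n normc_def.
have n0 : 0 < n by rewrite -ltcR -na normr_gt0.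
have := l2_normZ_le a^-1 (a *: u).
by rewrite scalerA mulVf// scale1r normfV na -fmorphV /= ler_pdivlMl.
Qed.

Lemma l2_norm_eq0 u : l2_norm u = 0 -> u = 0.
Proof.
move=> u0; apply: val_inj; apply/funext => x /=.
apply: sqmod_eq0; have := l2_norm_sum u [fset x]%fset.
by rewrite u0 expr0n big_seq_fset1.
Qed.

Let normD (u v : l2) : (l2_norm (u + v))%:C <= (l2_norm u)%:C + (l2_norm v)%:C.
Proof. by rewrite -rmorphD lecR l2_normD. Qed.

Let normZ (a : R[i]) (u : l2) : (l2_norm (a *: u))%:C = `|a| * (l2_norm u)%:C.
Proof. by rewrite l2_normZ rmorphM /=; congr (_ * _); rewrite normc_def. Qed.

Let norm_eq0 (u : l2) : (l2_norm u)%:C = 0 -> u = 0.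
Proof. by move=> [/l2_norm_eq0]. Qed.

HB.instance Definition _ :=
  @Lmodule_isNormed.Build R[i] l2 (fun u => (l2_norm u)%:C) normD normZ norm_eq0.

(* summability.sum is the limit of the finite partial sums along the net of
   finite subsets of X ordered by inclusion *)
Definition l2_dot u v : R[i] :=
  @summability.sum X R[i] R[i]^o (fun x => u x * (v x)^*%C).


Lemma l2_dotuu u : l2_dot u u = (l2_norm u ^+ 2)%:C.
Proof.
have psE (A : {fset X}) :
    @summability.partial_sum X R[i]^o (fun x => u x * (u x)^*%C) A =
    (\sum_(x <- A) sqmod (u x))%:C.
  rewrite /summability.partial_sum rmorph_sum /= [RHS]big_seq_fsetE /=.
  apply: eq_bigr => x _; case: (u (fsval x)) => a b.
  by rewrite /sqmod /=; simpc; congr Complex; ring.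
have FF := @summability.totally_filter X.
apply: (@cvg_lim R[i]^o); first exact: norm_hausdorff.
apply/(@cvgrPdist_lt R[i] R[i]^o) => -[e e'] /=; rewrite ltcE /= => /andP[/eqP -> e0].
have [A uA] : exists A : {fset X}, l2_norm u ^+ 2 - e < \sum_(x <- A) sqmod (u x).
  apply: contrapT => /forallNP h.
  have : (sqsum u <= (l2_norm u ^+ 2 - e)%:E)%E.
    by apply/sqsum_leP => A; rewrite leNgt; exact/negP/h.
  have ufin : sqsum u \is a fin_num.
    by rewrite ge0_fin_numE ?sqsum_ge0//; case: u {psE h}.
  rewrite -(fineK ufin) lee_fin /l2_norm sqr_sqrtr ?fine_ge0 ?sqsum_ge0//.
  by rewrite lerDl oppr_ge0 leNgt e0.
exists A => // B /= AB; rewrite psE -rmorphB /= normc_def /= expr0n /= addr0.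
rewrite sqrtr_sqr ltcR ger0_norm ?subr_ge0 ?l2_norm_sum//.
rewrite ltrBlDl -ltrBlDr; apply: lt_le_trans uA _.
rewrite [leRHS](big_fsetID _ (mem A)) /=.
have -> : [fset x in B | x \in A]%fset = A.
  by apply/fsetP => x; rewrite !inE andbC; case: (boolP (x \in A)) => //= /(fsubsetP AB).
by rewrite lerDl sumr_ge0// => x _; exact: sqmod_ge0.
Qed.
Definition unitary (T : l2 -> l2) :=
  [/\ linear T, bijective T & forall u v, l2_dot (T u) (T v) = l2_dot u v].

End square_summable.

Section covering_and_category_properties.
Variable Y : topologicalType.

Definition lindelof : Prop := forall F : set (set Y),
  F `<=` open -> \bigcup_(U in F) U = [set: Y] ->
  exists F' : set (set Y),
    [/\ F' `<=` F, countable F' & \bigcup_(U in F') U = [set: Y]].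

Definition sigma_compact : Prop := exists2 K : nat -> set Y,
  (forall n, compact (K n)) & \bigcup_n K n = [set: Y].

Definition pseudocompact (R : realType) : Prop := forall f : Y -> R,
  continuous f -> exists M : R, forall y, `|f y| <= M.

Definition baire : Prop := forall U : nat -> set Y,
  (forall n, open (U n) /\ dense (U n)) -> dense (\bigcap_n U n).

Definition separable : Prop := exists2 D : set Y, countable D & dense D.

End covering_and_category_properties.

Section compactifications.
Variable G : topologicalType.

Definition embedding (bG : topologicalType) (i : G -> bG) : Prop :=
  [/\ injective i, continuous i &
      forall U : set G, open U ->
        exists2 V : set bG, open V & i @` U = V `&` range i].

Definition compactification (bG : topologicalType) (i : G -> bG) : Prop :=
  [/\ compact [set: bG], hausdorff_space bG, embedding i & dense (range i)].

(* set_type turns a subset into a type carrying the subspace topology *)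
Definition remainder (bG : topologicalType) (i : G -> bG) : topologicalType :=
  set_type (~` range i).

Definition every_remainder (P : topologicalType -> Prop) : Prop :=
  forall (bG : topologicalType) (i : G -> bG),
    compactification i -> P (remainder i).

(* A space with a Hausdorff compactification is Tychonoff, and being a G_delta
   does not depend on the chosen compactification *)
Definition cech_complete : Prop :=
  exists (bG : topologicalType) (i : G -> bG),
    compactification i /\ Gdelta (range i).

End compactifications.

Section ordered_sets.
Variables (d : Order.disp_t) (X : orderType d).

Definition order_automorphism (g : X -> X) : Prop :=
  bijective g /\ {mono g : x y / (x <= y)%O}.

(* the points x_1 < ... < x_n and y_1 < ... < y_n are listed in s and t *)
Definition ultrahomogeneous : Prop := forall s t : seq X,
  size s = size t -> sorted <%O s -> sorted <%O t ->
  exists2 g, order_automorphism g & map g s = t.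

Definition ultrahomogeneous_chain : Prop :=
  infinite_set [set: X] /\ ultrahomogeneous.

Definition is_cut (A B : set X) : Prop :=
  [/\ A !=set0, B !=set0, A `|` B = [set: X] &
      forall a b, A a -> B b -> (a < b)%O].

Definition has_greatest (A : set X) : Prop := exists2 a, A a & ubound A a.
Definition has_least (B : set X) : Prop := exists2 b, B b & lbound B b.

Definition jump (A B : set X) : Prop :=
  [/\ is_cut A B, has_greatest A & has_least B].

(* proper because both classes of a cut are nonempty *)
Definition proper_gap (A B : set X) : Prop :=
  [/\ is_cut A B, ~ has_greatest A & ~ has_least B].

Definition continuously_dense : Prop :=
  forall A B : set X, ~ jump A B /\ ~ proper_gap A B.

End ordered_sets.

Section groups.

(* the strong operator topology is the topology of pointwise convergence for
   the norm topology on l2 *)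
Definition unitary_group (R : realType) (X : choiceType) : topologicalType :=
  set_type (@unitary R X : set {ptws l2 R X -> l2 R X}).

Definition symmetric_group (X : choiceType) : topologicalType :=
  set_type (@bijective X X :
    set {ptws discrete_topology X -> discrete_topology X}).

Definition Aut_permutation (d : Order.disp_t) (X : orderType d) :
    topologicalType :=
  set_type (@order_automorphism d X :
    set {ptws discrete_topology X -> discrete_topology X}).

Definition Aut_pointwise (d : Order.disp_t) (X : orderType d) :
    topologicalType :=
  set_type (@order_automorphism d X :
    set {ptws order_topology X -> order_topology X}).

Inductive group_over_discrete (R : realType) :
    choiceType -> topologicalType -> Prop :=
| unitary_over (X : choiceType) :
    group_over_discrete R X (unitary_group R X)
| symmetric_over (X : choiceType) :
    group_over_discrete R X (symmetric_group X)
| Aut_over (d : Order.disp_t) (X : orderType d) :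
    ultrahomogeneous_chain X -> group_over_discrete R X (Aut_permutation X).

End groups.

(* Main.v *)
(* Let bG be a compactification of G and Y = bG \ G.

   Countable or complete case. G has a countable family of open covers such that
   every filter containing a member of each cover converges. Hence G is a
   G_delta in every compactification, and Y is sigma-compact.

   Large case. If Y is not pseudocompact, not Baire, or if G is a G_delta in bG,
   then there are a compact H in G and nonempty open sets O n of G such that each
   neighbourhood of H contains some O n. All O n together only constrain countably
   many points (vectors) of X, and moving a remaining point x inside O n
   contradicts compactness of the set of values h x, h in H.

   Separable chain with a gap. Aut X is second countable, so Y is Lindelof. An
   isomorphism from X minus a point x0 onto X, with x0 corresponding to the gap,
   stands for an element of the completion of Aut X outside Aut X; a
   Baire category argument shows that Aut X contains no dense G_delta of
   a nonempty open subset of bG, since this subset would meet its translate by that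
   isomorphism.

   The last two cases exclude each other because a remainder which is both
   Lindelof and pseudocompact is compact, so that G is open in bG. *)
From HB Require Import structures.
Require Import Defs.
From mathcomp Require Import all_boot all_order all_algebra.
From mathcomp Require Import finmap complex.
From mathcomp Require Import all_classical all_reals all_analysis borel_hierarchy.
From mathcomp Require Import ring lra.
From mathcomp.analysis.showcase Require summability.
Import Order.TTheory GRing.Theory Num.Theory.
Import numFieldNormedType.Exports.

Set Implicit Arguments.
Unset Strict Implicit.
Unset Printing Implicit Defensive.

Local Open Scope classical_set_scope.

(** * Remainders and shrinking open sets *)

(** For each class of sets or chains a full list of properties is proved; the classes are exhaustive
    and the lists mutually exclusive, so each list also characterizes its class.

    The failures in the large case share one source: closed subsets of bG that decrease to a subset
    of G and contain nonempty open sets. [shrinks_to_compact] records its trace on G and mentions no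
    compactification, so it is refuted once for each group.

    In the complete cases the obstacle is that a pointwise limit of bijections can lose
    surjectivity. The covers therefore also control inverses or, for chains, the density of the
    range.

    In the case of a gap, the isomorphism acts neither on G nor on bG, so an open subset of bG has
    no actual translate. What the isomorphism can move is a finite list of constraints a < h x < b.
    Two nested sequences of such lists, one the image of the other, are therefore built together,
    and both enter the same dense open sets. *)

(* Induction on compact sets: the complements of the sets with property P
   generate a filter on K without cluster point. *)
Lemma compact_property (T : topologicalType) (K : set T) (P : set T -> Prop) :
  compact K -> P set0 -> (forall A B, P A -> P B -> P (A `|` B)) ->
  (forall A B, A `<=` B -> P B -> P A) ->
  (forall x, K x -> exists2 U, nbhs x U & P U) -> P K.
Proof.
move=> cK P0 PU PS Px; apply: contrapT => nPK.
pose F : set_system T := [set A | P (K `\` A)].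
have FF : ProperFilter F.
  apply: Build_ProperFilter.
    by rewrite /F /= setD0.
  split; rewrite /F /=.
  - by rewrite setDT.
  - by move=> A B PA PB; rewrite /= setDE setCI setIUr; exact: PU.
  - by move=> A B AB; apply: PS; exact: (setDS AB).
have FK : F K by rewrite /F /= setDv.
have [x [Kx clx]] := cK F FF FK.
have [U xU pU] := Px _ Kx.
have FU : F (~` U) by rewrite /F /= setDE setCK; apply: PS pU; exact: subIsetr.
by have [y []] := clx _ _ FU xU.
Qed.

Lemma decreasing_subset (T : Type) (C : nat -> set T) :
  (forall n, C n.+1 `<=` C n) -> forall m n, (m <= n)%N -> C n `<=` C m.
Proof.
move=> dC m n /subnK <-; elim: (n - m)%N => // k ih.
by rewrite addSn; exact: subset_trans (dC _) ih.
Qed.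

Lemma compact_bigcap_sub (T : topologicalType) (C : nat -> set T) (V : set T) :
  compact [set: T] -> (forall n, closed (C n)) ->
  (forall n, C n.+1 `<=` C n) -> open V -> \bigcap_n C n `<=` V ->
  exists n, C n `<=` V.
Proof.
move=> cT clC dC oV CV.
have dC' := decreasing_subset dC.
pose P A := exists n, C n `&` A `<=` V.
suff : P setT by move=> [n]; rewrite setIT; exists n.
apply: compact_property => //.
- by exists 0%N; rewrite setI0.
- move=> A B [m mA] [n nB]; exists (maxn m n) => x [Cx [Ax|Bx]].
    by apply: mA; split => //; apply: dC' Cx; exact: leq_maxl.
  by apply: nB; split => //; apply: dC' Cx; exact: leq_maxr.
- by move=> A B AB [n nB]; exists n => x [Cx /AB Bx]; exact: nB.
- move=> x _; have [Vx|nVx] := pselect (V x).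
    exists V; first by apply: open_nbhs_nbhs; split.
    by exists 0%N => y -[].
  have [n nCx] : exists n, ~ C n x.
    by apply: contrapT => /forallNP h; apply: nVx; apply: CV => n _; apply: contrapT; exact: h.
  exists (~` C n); last by exists n; rewrite setICr.
  by apply: open_nbhs_nbhs; split => //; rewrite openC.
Qed.

Lemma compact_bigcap_neq0 (T : topologicalType) (C : nat -> set T) :
  compact [set: T] -> (forall n, closed (C n)) ->
  (forall n, C n.+1 `<=` C n) -> (forall n, C n !=set0) ->
  \bigcap_n C n !=set0.
Proof.
move=> cT clC dC nC; apply: contrapT => h.
have /(compact_bigcap_sub cT clC dC open0)[n Cn] : \bigcap_n C n `<=` set0.
  by move=> x Cx; apply: h; exists x.
by have [x /Cn] := nC n.
Qed.

Lemma compact_hausdorff_shrink (T : topologicalType) (x : T) (V : set T) :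
  compact [set: T] -> hausdorff_space T -> open V -> V x ->
  exists U, [/\ open U, U x & closure U `<=` V].
Proof.
move=> cT hT oV Vx.
have Tx : nbhs x [set: T] by exact: filterT.
have xV : nbhs x V by apply: open_nbhs_nbhs; split.
have [W /= xW WV] := compact_regular hT cT Tx xV.
exists W^°; split; first exact: open_interior.
  exact: xW.
by apply: subset_trans WV; apply: closureS; exact: interior_subset.
Qed.

Lemma set_type_openP (T : topologicalType) (A : set T) (U : set (set_type A)) :
  open U <-> exists2 V : set T, open V & U = set_val @^-1` V.
Proof. by split=> -[V oV VU]; exists V. Qed.

Lemma set_val_continuous (T : topologicalType) (A : set T) :
  continuous (set_val : set_type A -> T).
Proof. exact: initial_continuous. Qed.

Lemma compact_set_val (T : topologicalType) (A : set T) (K : set T) :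
  compact K -> K `<=` A -> compact (set_val @^-1` K : set (set_type A)).
Proof.
move=> cK KA F PF FK.
have PG : ProperFilter (set_val @ F) by exact: fmap_proper_filter.
have [x [Kx clx]] := cK (set_val @ F) PG FK.
exists (exist _ x (mem_set (KA _ Kx))); split => //.
move=> B U FB [_ [[V oV <-] Vx VU]].
have [] := clx (set_val @` B) V.
- by apply: (@filterS _ F _ _ _ _ FB) => y By; exists y.
- by apply: open_nbhs_nbhs; split.
- by move=> _ [[y By <-] Vy]; exists y; split => //; exact: VU.
Qed.

Lemma compact_set_typeT (T : topologicalType) (K : set T) :
  compact K -> compact [set: set_type K].
Proof.
move=> cK; rewrite -(preimage_setT (set_val : set_type K -> T)).
have -> : set_val @^-1` [set: T] = set_val @^-1` K :> set (set_type K).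
  by apply/seteqP; split=> // x _; exact: set_valP.
exact: compact_set_val.
Qed.

Lemma set_type_hausdorff (T : topologicalType) (A : set T) :
  hausdorff_space T -> hausdorff_space (set_type A).
Proof.
move=> hT x y clxy; apply: val_inj; apply: hT => U V xU yV.
have [z [Uz Vz]] := clxy _ _ (set_val_continuous xU) (set_val_continuous yV).
by exists (set_val z).
Qed.

(* If a remainder of G carries an unbounded continuous function, or if G contains
   a nonempty G_delta of one of its compactifications, then some nonempty open
   sets of G shrink to a compact subset of G in this sense. *)
Definition shrinks_to_compact (G : topologicalType) :=
  exists (H : set G) (O : nat -> set G),
    [/\ compact H, forall n, open (O n) /\ O n !=set0 &
        forall V, open V -> H `<=` V -> exists n, O n `<=` V].

(** The local form is needed for the Baire property of the remainder, which concerns every open set;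
    taking W to be the whole space gives that the image of G is not a G_delta. *)
Definition no_residual_piece (G bG : topologicalType) (i : G -> bG) :=
  forall (W : set bG) (V : nat -> set bG), open W -> W !=set0 ->
    (forall n, open (V n) /\ dense (V n)) ->
    ~ (W `&` \bigcap_n V n `<=` range i).

Section remainders.
Variables (G bG : topologicalType) (i : G -> bG).
Hypothesis iG : compactification i.

Let cbG : compact [set: bG]. Proof. by case: iG. Qed.
Let hbG : hausdorff_space bG. Proof. by case: iG. Qed.
Let injG : injective i. Proof. by case: iG => _ _ []. Qed.
Let ctsG : continuous i. Proof. by case: iG => _ _ []. Qed.
Let denseG : dense (range i). Proof. by case: iG. Qed.

Lemma compactification_openP (U : set G) : open U ->
  exists2 V, open V & i @^-1` V = U.
Proof.
case: iG => _ _ [_ _ emb] _ /emb [V oV iUV]; exists V => //.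
apply/seteqP; split=> x.
  by move=> Vx; have [y Uy /injG <-] : (i @` U) (i x) by rewrite iUV; split => //; exists x.
by move=> Ux; have [] : (V `&` range i) (i x) by rewrite -iUV; exists x.
Qed.

Lemma compactification_meets (V : set bG) : open V -> V !=set0 ->
  i @^-1` V !=set0.
Proof. by move=> oV V0; have [z [Vz [x _ xz]]] := denseG V0 oV; exists x; rewrite /= xz. Qed.

Lemma compactification_preimage_open (V : set bG) : open V -> open (i @^-1` V).
Proof. by move=> oV; apply: open_comp => // x _; exact: ctsG. Qed.

Lemma compactification_compact (K : set bG) : compact K -> K `<=` range i ->
  compact (i @^-1` K).
Proof.
move=> cK KG F PF FK.
have PG : ProperFilter (i @ F) by exact: fmap_proper_filter.
have [z [Kz clz]] := cK (i @ F) PG FK.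
have [x _ xz] := KG _ Kz; subst z; exists x; split=> //.
move=> B U FB; rewrite nbhsE => -[U' [oU' U'x] U'U].
have [V oV VU] := compactification_openP oU'.
have [] := clz (i @` B) V.
- by apply: (@filterS _ F _ _ _ _ FB) => y By; exists y.
- by apply: open_nbhs_nbhs; split => //; rewrite -VU in U'x.
- by move=> _ [[y By <-] Vy]; exists y; split => //; apply: U'U; rewrite -VU.
Qed.

(** The compact set is the trace of the intersection of the [C n]. That intersection lies in the
    image of G, so by compactness of bG every open set around it contains some [C n], hence
    [O n]. *)
Lemma shrinks_to_compactP (C O : nat -> set bG) :
  (forall n, closed (C n)) -> (forall n, C n.+1 `<=` C n) ->
  \bigcap_n C n `<=` range i ->
  (forall n, [/\ open (O n), O n !=set0 & O n `<=` C n]) ->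
  shrinks_to_compact G.
Proof.
move=> clC dC CG OC.
exists (i @^-1` (\bigcap_n C n)), (fun n => i @^-1` (O n)); split.
- apply: compactification_compact => //.
  by apply: subclosed_compact cbG _ => //; apply: closed_bigI.
- move=> n; have [oO nO _] := OC n; split.
    exact: compactification_preimage_open.
  exact: compactification_meets.
- move=> V oV CV; have [V' oV' V'V] := compactification_openP oV.
  have [|n CnV] := @compact_bigcap_sub _ C V' cbG clC dC oV'.
    by move=> x /[dup] Cx /CG [y _ yx]; rewrite -yx -[V' _]/((i @^-1` V') y) V'V; apply: CV; rewrite /= yx.
  exists n => x Ox; rewrite -V'V; apply: CnV.
  by have [_ _] := OC n; apply.
Qed.

Lemma no_residual_pieceP : ~ shrinks_to_compact G -> no_residual_piece i.
Proof.
move=> nG W V oW W0 VP WV; apply: nG.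
pose T := {U : set bG | open U /\ U !=set0}.
(* As in the Baire category theorem, the nested closures end up inside W and every [V n], hence
   inside the image of G. *)
have step (n : nat) (U : T) : {U' : T | closure (sval U') `<=` sval U `&` V n}.
  apply: cid; case: U => U [oU U0] /=; have [oV dV] := VP n.
  have [x [Ux Vx]] := dV _ U0 oU.
  have [|//|U' [oU' U'x clU']] := @compact_hausdorff_shrink _ x (U `&` V n) cbG hbG.
    exact: openI.
  have U'P : open U' /\ U' !=set0 by split => //; exists x.
  by exists (exist _ U' U'P).
pose U := fix U n : T := if n is m.+1 then sval (step m (U m)) else
  exist _ W (conj oW W0).
have US n : closure (sval (U n.+1)) `<=` sval (U n) `&` V n by exact: svalP (step n (U n)).
apply: (@shrinks_to_compactP (fun n => closure (sval (U n.+1))) (fun n => sval (U n.+1))).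
- by move=> n; exact: closed_closure.
- move=> n; apply: subset_trans (@US n.+1) _ => x [Ux _]; exact: subset_closure.
- move=> x Ux; apply: WV; split; first by have [] := US 0%N _ (Ux 0%N I).
  by move=> n _; have [] := US n _ (Ux n I).
- by move=> n; have [oU U0] := svalP (U n.+1); split => //; exact: subset_closure.
Qed.

Lemma no_residual_piece_dense : no_residual_piece i -> dense (~` range i).
Proof.
move=> nr W W0 oW; apply: contrapT => h.
apply: (nr W (fun=> setT) oW W0) => [n|x [Wx _]].
  by split; [exact: openT|move=> O [x Ox] _; exists x].
by apply: contrapT => nx; apply: h; exists x.
Qed.

Lemma no_residual_piece_baire : no_residual_piece i -> baire (remainder i).
Proof.
move=> nr U UP O [y Oy] /set_type_openP[W oW OW].
have dY := no_residual_piece_dense nr.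
(* The open extension of [U n] to bG is dense there because the remainder is dense in bG. *)
have V_ n : exists V, [/\ open V, dense V & U n = set_val @^-1` V].
  have [/set_type_openP[V oV UV] dU] := UP n; exists V; split => //.
  move=> W' W'0 oW'; have [z [W'z zG]] := dY _ W'0 oW'.
  have [||t [W't Ut]] := dU (set_val @^-1` W').
  - by exists (exist _ z (mem_set zG)).
  - by apply/set_type_openP; exists W'.
  - by exists (set_val t); split => //; move: Ut; rewrite UV.
have /choice[V VP] := V_.
have W0 : W !=set0 by exists (set_val y); move: Oy; rewrite OW.
have VP' n : open (V n) /\ dense (V n) by have [] := VP n.
have /existsNP[x /not_implyP[[Wx Vx] xG]] := nr _ _ oW W0 VP'.
exists (exist _ x (mem_set xG)); split; first by rewrite OW.
by move=> n _; have [_ _ ->] := VP n; exact: Vx.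
Qed.

Lemma no_residual_piece_NGdelta (g : G) : no_residual_piece i -> ~ Gdelta (range i).
Proof.
move=> nr [V oV VE]; apply: (nr setT V openT).
- by exists (i g).
- move=> n; split => // O O0 oO; have [x [Ox]] := denseG O0 oO.
  by rewrite VE => /(_ n I) Vx; exists x.
- by rewrite setTI -VE.
Qed.

Lemma not_shrinking_pseudocompact (R : realType) :
  ~ shrinks_to_compact G -> pseudocompact (remainder i) R.
Proof.
move=> nG f cf; apply: contrapT => /forallNP ub; apply: (nG).
have dY := no_residual_piece_dense (no_residual_pieceP nG).
have W_ n : exists W, [/\ open W, W !=set0 & [set y | (n%:R < `|f y|)%R] = set_val @^-1` W].
  have /set_type_openP[W oW WE] : open ([set y | (n%:R < `|f y|)%R] : set (remainder i)).
    apply: (@open_comp _ _ (fun y => `|f y|%R) [set r | (n%:R < r)%R]).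
      by move=> y _; apply: continuous_comp; [exact: cf|exact: norm_continuous].
    exact: open_gt.
  exists W; split => //; have /existsNP[y /negP] := ub n%:R%R; rewrite -ltNge => ny.
  by exists (set_val y); rewrite -[W _]/((set_val @^-1` W) y) -WE.
have /choice[W WP] := W_.
(* A point of the remainder in all these closures would have a neighbourhood on which |f| is
   bounded; but this neighbourhood meets some [W n] with n large, and the remainder is dense. *)
apply: (@shrinks_to_compactP (fun m => closure (\bigcup_(n in [set n | m <= n]%N) W n)) W).
- by move=> n; exact: closed_closure.
- by move=> n; apply: closureS => x [k /= nk Wx]; exists k => //=; exact: ltnW.
- move=> x clx; apply: contrapT => xG.
  pose y : remainder i := exist _ x (mem_set xG).
  have /set_type_openP[N oN NE] : open ([set z | (`|f z| < `|f y| + 1)%R] : set (remainder i)).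
    apply: (@open_comp _ _ (fun y => `|f y|%R) [set r | (r < `|f y| + 1)%R]).
      by move=> z _; apply: continuous_comp; [exact: cf|exact: norm_continuous].
    exact: open_lt.
  have Nx : N x by rewrite -[N _]/((set_val @^-1` N) y) -NE /= ltrDl.
  have [m fym] : exists m : nat, (`|f y| + 1 < m%:R)%R.
    by exists (Num.truncn (`|f y| + 1)).+1; rewrite truncnS_gt.
  have [t [[n /= mn Wt] Nt]] := clx m I N (open_nbhs_nbhs (conj oN Nx)).
  have [oW _ WE] := WP n.
  have [|z [[Wz Nz] zG]] := dY (W n `&` N) _ (openI oW oN); first by exists t.
  pose z' : remainder i := exist _ z (mem_set zG).
  have : (set_val @^-1` N) z' by [].
  rewrite -NE /=; have : (set_val @^-1` W n) z' by [].
  rewrite -WE /= => nz zy; have := lt_trans (lt_trans nz zy) fym.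
  by rewrite ltr_nat ltnNge mn.
- by move=> n; have [oW W0 _] := WP n; split => // x Wx; apply: subset_closure; exists n => /=.
Qed.

End remainders.

(** * Complete families of covers and existence of compactifications *)

Lemma countable_range (T : choiceType) (t0 : T) (A : set T) : countable A ->
  exists2 e : nat -> T, A `<=` range e & forall n, e n = t0 \/ A (e n).
Proof.
move=> /countable_injP[f finj].
exists (fun n => xget t0 [set a | A a /\ f a = n]).
  move=> a Aa; exists (f a) => //.
  have /(xgetPex t0)[Ax fx] : exists x, [set b | A b /\ f b = f a] x by exists a.
  by apply: finj => //; rewrite inE.
move=> n; case: xgetP => [x _ [Ax _]|_]; [by right|by left].
Qed.

(* Frolik's internal characterization of Cech-completeness. *)
Definition complete_cover_family (G : topologicalType) :=
  exists (J : countType) (C : J -> set (set G)),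
    [/\ forall k, C k `<=` open, forall k g, exists2 A, C k A & A g &
        forall F : set_system G, ProperFilter F ->
          (forall k, exists2 A, C k A & F A) -> exists g : G, F --> g].

Lemma sigma_compact_lindelof (T : topologicalType) : sigma_compact T -> lindelof T.
Proof.
move=> [K cK KT] F oF FT.
have fin n : exists F', [/\ F' `<=` F, countable F' & K n `<=` \bigcup_(U in F') U].
  pose P A := exists F', [/\ F' `<=` F, countable F' & A `<=` \bigcup_(U in F') U].
  apply: (@compact_property _ _ P) => //.
  - by exists set0; split.
  - move=> A B [FA [sA cA AA]] [FB [sB cB BB]]; exists (FA `|` FB); split.
    + by rewrite subUset.
    + by rewrite -bigcup2E; apply: bigcup_countable => // -[|[|k]] _ //=; exact: countable0.
    + by rewrite bigcup_setU; exact: setUSS.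
  - move=> A B AB [FB [sB cB BB]]; exists FB; split => //.
    exact: subset_trans BB.
  - move=> x _; have : [set: T] x by [].
    rewrite -FT => -[U FU Ux]; exists U.
      by apply: open_nbhs_nbhs; split => //; exact: oF.
    exists [set U]; split; [by move=> _ ->|exact: countable1|by rewrite bigcup_set1].
have /choice[F' F'P] := fin.
exists (\bigcup_n F' n); split.
- by move=> U [n _]; have [+ _ _] := F'P n; apply.
- by apply: bigcup_countable => // n _; have [] := F'P n.
- apply/seteqP; split => // x _; have : [set: T] x by [].
  rewrite -KT => -[n _ Kx]; have [_ _ /(_ _ Kx)[U FU Ux]] := F'P n.
  by exists U => //; exists n.
Qed.

Section complete_covers.
Variables (G bG : topologicalType) (i : G -> bG).
Hypothesis iG : compactification i.

(** [V k] collects the open sets of bG whose trace lies in a member of the k-th cover. If p is in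
    all of them, the trace on G of its neighbourhood filter meets the completeness condition, so it
    converges in G, and its limit is p since bG is Hausdorff. *)
Lemma complete_cover_family_Gdelta : complete_cover_family G -> Gdelta (range i).
Proof.
move=> [J [C [oC covC complC]]].
have [cbG hbG [injG ctsG _] denseG] := iG.
pose V k := \bigcup_(W in [set W | open W /\ exists2 A, C k A & i @^-1` W `<=` A]) W.
pose V' n := if @choice.unpickle J n is Some k then V k else setT.
have oV k : open (V k) by apply: bigcup_open => W [].
exists V' => [n|]; first by rewrite /V'; case: choice.unpickle => // *; exact: openT.
apply/seteqP; split.
  move=> _ [g _ <-] n _; rewrite /V'; case: choice.unpickle => // k.
  have [A CA Ag] := covC k g.
  have [W oW WA] := compactification_openP iG (oC _ _ CA).
  exists W; last by rewrite -[W _]/((i @^-1` W) g) WA.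
  by split => //; exists A => //; rewrite WA.
move=> p Vp; have {}Vp k : V k p by have := Vp (choice.pickle k) I; rewrite /V' choice.pickleK.
pose F : set_system G := [set A | exists2 W, nbhs p W & i @^-1` W `<=` A].
have FF : ProperFilter F.
  apply: Build_ProperFilter.
    move=> [W pW W0]; move: pW; rewrite nbhsE => -[U [oU Up] UW].
    have [||g Ug] := @compactification_meets _ _ _ iG U => //; first by exists p.
    by apply: (W0 g); exact: UW.
  split.
  - by exists setT => //; exact: filterT.
  - move=> A B [W pW WA] [W' pW' WB]; exists (W `&` W'); first exact: filterI.
    by move=> g [Wg W'g]; split; [exact: WA|exact: WB].
  - by move=> A B AB [W pW WA]; exists W => //; exact: subset_trans AB.
have [|g Fg] := complC F FF.
  move=> k; have [W [oW [A CA WA]] Wp] := Vp k; exists A => //.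
  by exists W => //; apply: open_nbhs_nbhs; split.
exists g => //; apply: hbG => A B Ag Bp.
have [W pW WA] : F (i @^-1` A) by apply: Fg; exact: ctsG.
have : nbhs p (W `&` B) by exact: filterI.
rewrite nbhsE => -[U [oU Up] UWB].
have [||h Uh] := @compactification_meets _ _ _ iG U => //; first by exists p.
by have [Wh Bh] := UWB _ Uh; exists (i h); split => //; exact: WA.
Qed.

Lemma Gdelta_remainder_sigma_compact : Gdelta (range i) -> sigma_compact (remainder i).
Proof.
move=> [V oV VE]; have [cbG _ _ _] := iG.
have VP x : range i x <-> (\bigcap_n V n) x by rewrite VE.
exists (fun n => set_val @^-1` (~` V n)) => [n|].
  apply: compact_set_val.
    by apply: subclosed_compact cbG _ => //; rewrite closedC.
  by apply: subsetC; rewrite VE => x; apply.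
apply/seteqP; split => // y _.
have yG : ~ range i (set_val y) := set_valP y.
apply: contrapT => nV; apply: yG; apply/VP => n _; by apply: contrapT => nVn; apply: nV; exists n.
Qed.

End complete_covers.

Section compactification_existence.
Variables (R : realType) (T : topologicalType).
Hypotheses (crT : completely_regular_space T) (hT : hausdorff_space T).

(** Replacing unsuitable functions by 0 lets the cube be indexed by all functions from T to R
    instead of a subtype. *)
Let unit_fun (phi : T -> R) : T -> R :=
  if `[< continuous phi /\ range phi `<=` `[0%R, 1%R] >] then phi else cst 0%R.

Let unit_fun_cts phi : continuous (unit_fun phi).
Proof. by rewrite /unit_fun; case: asboolP => [[]//|_]; exact: cst_continuous. Qed.

Let unit_fun01 phi t : `[0%R, 1%R]%classic (unit_fun phi t).
Proof.
rewrite /unit_fun; case: asboolP => [[_]|_]; first by apply; exists t.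
by rewrite /= in_itv /= lexx ler01.
Qed.

Let unit_fun_sep : separate_points_from_closed unit_fun.
Proof.
move=> B x clB nBx.
have /(@uniform_separatorP _ R)[f [cf f01 f0 f1]] := crT clB nBx.
exists f; rewrite /unit_fun asboolT //; have -> : f x = 0%R by apply: f0; exists x.
move=> /(_ [set r | (r < 1)%R]) [].
  by apply: open_nbhs_nbhs; split => /=; [exact: open_lt|exact: ltr01].
by move=> _ [/f1 -> /=]; rewrite ltxx.
Qed.

Let j : T -> prod_topology (fun _ : T -> R => R) := join_product unit_fun.

Let K : set (prod_topology (fun _ : T -> R => R)) := closure (range j).

Let cK : compact K.
Proof.
have cube : compact ([set f | forall phi, `[0%R, 1%R]%classic (f phi)] : set (prod_topology (fun _ : T -> R => R))).
  by apply: (@tychonoff (T -> R) (fun=> R) (fun=> `[0%R, 1%R]%classic)) => _; exact: segment_compact.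
apply: subclosed_compact cube _; first exact: closed_closure.
have := @closed_bigI (prod_topology (fun _ : T -> R => R)) _ setT (fun phi => @proj (T -> R) (fun=> R) phi @^-1` `[0%R, 1%R]).
have -> : \bigcap_phi (@proj (T -> R) (fun=> R) phi @^-1` `[0%R, 1%R]) =
   [set f : prod_topology (fun _ : T -> R => R) | forall phi, `[0%R, 1%R]%classic (f phi)].
  by apply/seteqP; split=> f Hf; [move=> phi; exact: Hf|move=> phi _; exact: Hf].
move=> clC; apply: (subset_trans _ (clC _)).
  by apply: closureS => _ [t _ <-] phi; exact: unit_fun01.
move=> phi _; apply: preimage_closed; last exact: interval_closed.
by move=> f _; exact: proj_continuous.
Qed.

(** This is the Stone-Cech construction: complete regularity makes the map to the cube an embedding,
    and the closure of its image is compact. *)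
Lemma compactification_exists : exists (bG : topologicalType) (i : T -> bG), compactification i.
Proof.
have jinj := join_product_inj unit_fun_sep (hausdorff_accessible hT).
have jK t : K (j t) by apply: subset_closure; exists t.
exists (set_type K), (fun t => exist _ (j t) (mem_set (jK t))).
split.
- exact: (compact_set_typeT cK).
- apply: set_type_hausdorff; apply: hausdorff_product => _; exact: Rhausdorff.
- split.
  + by move=> s t [] st; apply: jinj; rewrite ?inE.
  + apply/continuousP => _ [V oV <-].
    rewrite (_ : _ @^-1` _ = j @^-1` V)//.
    by apply: open_comp => // x _; exact: join_product_continuous.
  + move=> U; rewrite (join_product_initial unit_fun_sep unit_fun_cts jinj) => -[V oV VU].
    exists (set_val @^-1` V); first by exists V.
    apply/seteqP; split.
      by move=> _ [t Ut <-]; split; [rewrite -VU in Ut|exists t].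
    by move=> z [Vz [t _ tz]]; exists t => //; rewrite -VU; move: Vz; rewrite -tz.
- move=> O [x Ox] [V oV VO].
  have Vx : V (set_val x) by rewrite -VO in Ox.
  have [_ [[t _ <-] Vt]] := set_valP x V (open_nbhs_nbhs (conj oV Vx)).
  by exists (exist _ (j t) (mem_set (jK t))); split; [rewrite -VO|exists t].
Qed.

End compactification_existence.

(** * Lindelof remainders *)

Lemma compact_hausdorff_separate (T : topologicalType) (K : set T) (y : T) :
  hausdorff_space T -> compact K -> ~ K y ->
  exists V, [/\ open V, K `<=` V & ~ closure V y].
Proof.
move=> hT cK nKy.
pose P A := exists V, [/\ open V, A `<=` V & ~ closure V y].
apply: (@compact_property _ _ P) => //.
- by exists set0; split; [exact: open0|by []|rewrite closure0].
- move=> A B [U [oU AU Uy]] [V [oV BV Vy]]; exists (U `|` V); split.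
  + exact: openU.
  + exact: setUSS.
  + by rewrite closureU => -[].
- by move=> A B AB [V [oV BV Vy]]; exists V; split => //; exact: subset_trans BV.
- move=> x Kx; have /eqP xy : x <> y by move=> xy; rewrite xy in Kx.
  move: hT; rewrite open_hausdorff => /(_ _ _ xy)[[U V] /= [xU yV] [oU oV /eqP UV0]].
  rewrite !inE in xU yV.
  exists U; first by apply: open_nbhs_nbhs; split.
  exists U; split => // /(_ V (open_nbhs_nbhs (conj oV yV)))[z].
  by rewrite UV0.
Qed.

Section lindelof_remainders.
Variables (G bG : topologicalType) (i : G -> bG).
Hypothesis iG : compactification i.

(** Let K be the part of bG missed by the open extensions of the cover; it is a compact subset of G.
    The compact complement of an open set around K needs only countably many members, and the sets
    [E s], which trace finite unions of basic sets on G, provide countably many neighbourhoods of K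
    that suffice to exclude each point of the remainder. *)
Lemma second_countable_remainder_lindelof (B : nat -> set G) :
  (forall n, open (B n)) ->
  (forall U g, open U -> U g -> exists2 n, B n g & B n `<=` U) ->
  lindelof (remainder i).
Proof.
move=> oB baseB F oF FY; have [cbG hbG [injG ctsG _] denseG] := iG.
pose O (s : {fset nat}) := \bigcup_(n in [set` s]) B n.
have /choice[E EP] (s : {fset nat}) : exists E, open E /\ i @^-1` E = O s.
  have [|E oE Es] := @compactification_openP _ _ _ iG (O s).
    by apply: bigcup_open => n _; exact: oB.
  by exists E.
pose F' := [set V : set bG | open V /\ F (set_val @^-1` V)].
pose U := \bigcup_(V in F') V.
have oU : open U by apply: bigcup_open => V [].
have UY : ~` range i `<=` U.
  move=> y yG; have : [set: remainder i] (exist _ y (mem_set yG)) by [].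
  rewrite -FY => -[W FW Wy]; have /set_type_openP[V oV WV] := oF _ FW.
  by exists V; [split => //; rewrite -WV|move: Wy; rewrite WV].
pose K := ~` U.
have clK : closed K by rewrite closedC.
have KG : K `<=` range i by move=> x Kx; apply: contrapT => /UY.
have cK : compact K by exact: subclosed_compact cbG _.
pose P (A : set bG) := exists F0, [/\ F0 `<=` F, countable F0 &
  set_val @^-1` A `<=` \bigcup_(W in F0) W].
have fin s : exists F0, [/\ F0 `<=` F, countable F0 & K `<=` E s ->
    set_val @^-1` (~` E s) `<=` \bigcup_(W in F0) W].
  have [KE|nKE] := pselect (K `<=` E s); last by exists set0; split.
  suff [F0 [? ? ?]] : P (~` E s) by exists F0; split.
  apply: compact_property.
  - by apply: subclosed_compact cbG _ => //; rewrite closedC; have [] := EP s.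
  - by exists set0; split.
  - move=> A A' [FA [sA cA AA]] [FB [sB cB BB]]; exists (FA `|` FB); split.
    + by rewrite subUset.
    + by rewrite -bigcup2E; apply: bigcup_countable => // -[|[|k]] _ //=; exact: countable0.
    + by rewrite bigcup_setU preimage_setU; exact: setUSS.
  - move=> A A' AB [FB [sB cB BB]]; exists FB; split => //.
    by apply: subset_trans BB; exact: preimage_subset.
  - move=> x nEx; have [V [oV FV] Vx] : U x by apply: contrapT => nUx; exact/nEx/KE.
    exists V; first by apply: open_nbhs_nbhs; split.
    exists [set set_val @^-1` V]; split; [by move=> _ ->|exact: countable1|by rewrite bigcup_set1].
have /choice[F0 F0P] := fin.
exists (\bigcup_s F0 s); split.
- by move=> W [s _]; have [+ _ _] := F0P s; apply.
- by apply: bigcup_countable => // s _; have [] := F0P s.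
apply/seteqP; split=> // y _.
have nKy : ~ K (set_val y) by move=> /KG; exact: set_valP y.
have [V [oV KV Vy]] := compact_hausdorff_separate hbG cK nKy.
have [s [Ks sV]] : exists s, i @^-1` K `<=` O s /\ O s `<=` i @^-1` V.
  pose Q A := exists s, A `<=` O s /\ O s `<=` i @^-1` V.
  apply: (@compact_property _ _ Q).
  - exact: (compactification_compact iG).
  - by exists fset0; split => // g [n /=]; rewrite inE.
  - move=> A A' [s [As sV]] [s' [As' sV']]; exists (s `|` s')%fset.
    by rewrite /O set_fsetU bigcup_setU; split; [exact: setUSS|rewrite subUset].
  - by move=> A A' AA' [s [As sV]]; exists s; split => //; exact: subset_trans As.
  - move=> g Kg; have [|n Bg BV] := baseB (i @^-1` V) g _ (KV _ Kg).
      exact: (compactification_preimage_open iG).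
    exists (B n); first by apply: open_nbhs_nbhs.
    by exists [fset n]%fset; rewrite /O set_fset1 bigcup_set1; split.
have [oE EO] := EP s.
have KE : K `<=` E s.
  move=> x /[dup] Kx /KG[g _ gx]; rewrite -gx -[E s _]/((i @^-1` E s) g) EO.
  by apply: Ks; rewrite /= gx.
(* As G is dense, [E s] lies in the closure of its trace [O s], hence in the closure of V. *)
have nEy : ~ E s (set_val y).
  move=> Ey; apply: Vy => W Wy.
  have : nbhs (set_val y) (E s `&` W) by apply: filterI => //; apply: open_nbhs_nbhs.
  rewrite nbhsE => -[W' [oW' W'y] W'EW].
  have [||g W'g] := @compactification_meets _ _ _ iG W' => //; first by exists (set_val y).
  have [Eg Wg] := W'EW _ W'g; exists (i g); split => //.
  by apply: sV; rewrite -EO.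
by have [_ _ /(_ KE _ nEy)[W FW Wy]] := F0P s; exists W => //; exists s.
Qed.

(* If Y is not closed at p, the Lindelof property gives open sets O n decreasing
   to p with no common point in Y; the bumps g n at O n form a family that is
   locally finite on Y, and their sum is unbounded there. *)
Lemma lindelof_pseudocompact_remainder (R : realType) :
  lindelof (remainder i) -> pseudocompact (remainder i) R -> open (range i).
Proof.
move=> lY pY; have [cbG hbG [injG ctsG _] denseG] := iG.
suff : closed (~` range i) by rewrite closedC.
move=> p clp pG.
have nbG : normal_space bG by exact: compact_normal.
pose F : set (set (remainder i)) :=
  [set W | exists N, [/\ open N, ~ closure N p & W = set_val @^-1` N]].
have [||F' [F'F cF' F'Y]] := lY F.
- by move=> _ [N [oN _ ->]]; apply/set_type_openP; exists N.
- apply/seteqP; split=> // y _.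
  have [||N [oN yN Np]] := @compact_hausdorff_separate bG [set set_val y] p hbG _ _.
  + exact: compact_set1.
  + have yG : ~ range i (set_val y) := set_valP y.
    by move=> py; apply: yG; rewrite -py.
  by exists (set_val @^-1` N); [exists N|exact: yN].
have /countable_range := cF' => /(_ set0)[e F'e eF].
have /choice[N NP] n : exists N, [/\ open N, ~ closure N p & e n = set_val @^-1` N].
  have [->|/F'F[N NP]] := eF n; last by exists N.
  by exists set0; split; [exact: open0|rewrite closure0|rewrite preimage_set0].
pose T := {U : set bG | open U /\ U p}.
have step n (U : T) : {U' : T | closure (sval U') `<=` sval U `\` closure (N n)}.
  apply: cid; case: U => U [oU Up] /=; have [oN Np _] := NP n.
  have [|//|U' [oU' U'p clU']] := @compact_hausdorff_shrink _ p (U `\` closure (N n)) cbG hbG.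
    by apply: openI => //; rewrite openC; exact: closed_closure.
  by exists (exist _ U' (conj oU' U'p)).
pose U := fix U n : T := if n is m.+1 then sval (step m (U m)) else
  exist _ setT (conj openT I).
pose O n := sval (U n).
have OS n : closure (O n.+1) `<=` O n `\` closure (N n) by exact: svalP (step n (U n)).
have oO n : open (O n) by have [] := svalP (U n).
have Op n : O n p by have [] := svalP (U n).
have dO : forall m n, (m <= n)%N -> O n `<=` O m.
  by apply: decreasing_subset => n x Ox; have [] := OS n x (subset_closure Ox).
have /choice[g gP] n : exists g : bG -> R, [/\ continuous g,
    forall x, (0 <= g x)%R, forall x, ~ O n x -> g x = 0%R &
    forall x, O n.+1 x -> g x = 1%R].
  have /(@uniform_separatorP _ R)[f [cf f01 f0 f1]] : uniform_separator (~` O n) (closure (O n.+1)).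
    apply: ((@normal_separatorP R bG).1 nbG); [by rewrite closedC|exact: closed_closure|].
    by apply/seteqP; split=> // x [nOx /OS[]].
  exists f; split=> // x; first by have := f01 (f x) (imageT f x); rewrite /= in_itv /= => /andP[].
    by move=> Ox; apply: f0; exists x.
  move=> Ox.
  by apply: f1; exists x => //; exact: subset_closure.
pose S M x : R := (\sum_(k < M) g k x)%R.
have SE M M' x : ~ O M x -> (M <= M')%N -> S M' x = S M x.
  move=> nO /subnK <-; elim: (M' - M)%N => // k ih.
  rewrite /S addSn big_ord_recr /= -/(S _ _) ih.
  have nOk : ~ O (k + M)%N x by move=> Ox; apply: nO; exact: (dO _ _ (leq_addl k M) _ Ox).
  by have [_ _ gz _] := gP (k + M)%N; rewrite gz// addr0.
have SE' M M' x : ~ O M x -> ~ O M' x -> S M x = S M' x.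
  by move=> nO nO'; rewrite -(SE _ _ _ nO (leq_maxl M M')) -(SE _ _ _ nO' (leq_maxr M M')).
have /choice[nu nuP] (y : remainder i) : exists n, ~ closure (O n) (set_val y).
  have : [set: remainder i] y by []; rewrite -F'Y => -[W /F'e[n _ <-] ey].
  exists n.+1 => /OS[_]; apply; apply: subset_closure.
  by move: ey; have [_ _ ->] := NP n.
have nuP' y : ~ O (nu y) (set_val y) by move=> Oy; apply: (nuP y); exact: subset_closure.
(* All bumps from index [nu y] on vanish near y, so this is the full sum at y, and one finite
   partial sum computes f around y. *)
pose f y := S (nu y) (set_val y).
have cf : continuous f.
  move=> y; have cS M : continuous (fun z : remainder i => S M (set_val z)).
    move=> z; apply: (@continuous_comp _ _ _ set_val (S M)); first exact: set_val_continuous.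
    apply: (@continuous_big _ _ +%R) => //; first by move=> x; exact: add_continuous.
    by move=> k _ ; have [+ _ _ _] := gP k; apply.
  have nz : \forall z \near y, ~ closure (O (nu y)) (set_val z).
    apply: (@set_val_continuous _ _ y (~` closure (O (nu y)))).
    apply: open_nbhs_nbhs; split; last exact: nuP.
    by rewrite openC; exact: closed_closure.
  move=> V /(cS (nu y) y V); apply: filterS2 nz => z nz; rewrite /= /f (SE' (nu z) (nu y))//.
  by move=> Oz; apply: nz; exact: subset_closure.
have [M fM] := pY f cf.
pose n := (Num.truncn M).+1.
(* On [O n] the first n bumps equal 1, so f is at least n at this point of the remainder. *)
have [z [zG Oz]] := clp (O n) (open_nbhs_nbhs (conj (oO n) (Op n))).
pose y : remainder i := exist _ z (mem_set zG).
have : (n%:R <= f y)%R.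
  have ny : (n <= nu y)%N by rewrite leqNgt; apply/negP => /ltnW/dO /(_ _ Oz) /nuP'.
  have Snn : S n z = n%:R%R.
    rewrite /S (eq_bigr (fun=> 1%R)) ?sumr_const ?card_ord// => k _.
    by have [_ _ _ ->] := gP k => //; apply: dO Oz.
  have SS k : (S n z <= S (k + n)%N z)%R; last by rewrite -Snn /f -(subnK ny); exact: SS.
  elim: k => // k ih; apply: (le_trans ih).
  rewrite addSn /S big_ord_recr /= lerDl.
  by have [_ + _ _] := gP (k + n)%N; apply.
move=> /le_trans/(_ (le_trans (ler_norm _) (fM y))).
by rewrite leNgt truncnS_gt.
Qed.

End lindelof_remainders.

(** * The topology of pointwise convergence *)

Section pointwise_topology.
Variables (X : choiceType) (V : topologicalType) (A : set {ptws X -> V}).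
Notation G := (set_type A).

Lemma ptws_base (g : {ptws X -> V}) (U : set {ptws X -> V}) : nbhs g U ->
  exists (s : seq X) (N : X -> set V), (forall x, nbhs (g x) (N x)) /\
    forall h : {ptws X -> V}, (forall x, x \in s -> N x (h x)) -> U h.
Proof.
(* Convergence of F to g is checked one coordinate at a time, and it means that every neighbourhood
   of g belongs to F. *)
pose F : set_system {ptws X -> V} := [set B | exists (s : seq X) (N : X -> set V),
  (forall x, nbhs (g x) (N x)) /\ forall h, (forall x, x \in s -> N x (h x)) -> B h].
suff FF : Filter F.
  suff : F --> g by apply.
  apply/cvg_sup => x B [_ [[W oW <-] Wg] WB].
  exists [:: x], (fun y => if y == x then W else setT); split.
    move=> y; case: eqP => [->|_]; last exact: filterT.
    by apply: open_nbhs_nbhs.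
  move=> h hN; apply: WB; rewrite /=.
  by have := hN x (mem_head _ _); rewrite eqxx.
split.
- by exists [::], (fun=> setT); split => // x; exact: filterT.
- move=> B C [s [N [Ng NB]]] [t [M [Mg MC]]].
  exists (s ++ t), (fun x => N x `&` M x); split; first by move=> x; exact: filterI.
  move=> h hNM; split.
    by apply: NB => x xs; have [] := hNM x; rewrite // mem_cat xs.
  by apply: MC => x xt; have [] := hNM x; rewrite // mem_cat xt orbT.
- move=> B C BC [s [N [Ng NB]]]; exists s, N; split => // h /NB; exact: BC.
Qed.

Lemma sub_ptws_base (g : G) (U : set G) : open U -> U g ->
  exists (s : seq X) (N : X -> set V), (forall x, nbhs (set_val g x) (N x)) /\
    forall h : G, (forall x, x \in s -> N x (set_val h x)) -> U h.
Proof.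
move=> /set_type_openP[W oW ->] Wg.
have [s [N [Ng NW]]] := ptws_base (open_nbhs_nbhs (conj oW Wg)).
by exists s, N; split => // h hN; apply: NW.
Qed.

Lemma sub_ptws_eval_continuous (x : X) : continuous (fun h : G => set_val h x).
Proof.
move=> g; apply: (@continuous_comp _ _ _ set_val (fun h : {ptws X -> V} => h x)).
  exact: set_val_continuous.
exact: (@proj_continuous X (fun=> V) x).
Qed.

Lemma sub_ptws_cvg (F : set_system G) (g : G) : Filter F ->
  (forall x N, nbhs (set_val g x) N -> F [set h | N (set_val h x)]) -> F --> g.
Proof.
move=> FF Fg U; rewrite nbhsE => -[W [oW Wg] WU].
have [s [N [Ng NW]]] := sub_ptws_base oW Wg.
have FN : F [set h | forall x, x \in s -> N x (set_val h x)].
  elim: s {NW} => [|x s ih]; first by apply: filterS filterT => h _ x.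
  apply: filterS2 (Fg x _ (Ng x)) ih => h hx hs y.
  by rewrite in_cons => /predU1P[->|/hs].
by apply: filterS FN => h /NW /WU.
Qed.

Lemma sub_ptws_completely_regular (R : realType) :
  completely_regular_space V -> completely_regular_space G.
Proof.
move=> crV g B clB nBg.
have oB : open (~` B) by rewrite openC.
have [s [N [Ng NB]]] := sub_ptws_base oB nBg.
have /choice[f fP] x : exists f : V -> R, [/\ continuous f,
    forall y, (0 <= f y <= 1)%R, f (set_val g x) = 0%R & forall y, ~ N x y -> f y = 1%R].
  have [W [oW Wg] WN] : exists2 W, open_nbhs (set_val g x) W & W `<=` N x.
    by have := Ng x; rewrite nbhsE.
  have clW : closed (~` W) by rewrite closedC.
  have /(@uniform_separatorP _ R)[f [cf f01 f0 f1]] := crV _ _ clW (fun h => h Wg).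
  exists f; split => //.
  - by move=> y; have := f01 (f y) (imageT f y); rewrite /= in_itv.
  - by apply: f0; exists (set_val g x).
  - by move=> y Ny; apply: f1; exists y => // /WN.
(* The product is 1 at g and vanishes as soon as one coordinate in s leaves its neighbourhood, so 1
   - p separates g from B. *)
pose p (h : G) := (\prod_(x <- s) (1 - f x (set_val h x)))%R.
apply/(@uniform_separatorP _ R); exists (fun h => (1 - p h)%R); split.
- have cB (k : G -> R) : continuous k -> continuous (fun h => 1 - k h)%R.
    by move=> ck h; apply: (@cvgB R R G (nbhs h) _ (cst 1%R) k); [exact: cvg_cst|exact: ck].
  apply: (cB); rewrite /p; apply: (@continuous_big R X *%R 1%R xpredT) => [x|x _].
    exact: mul_continuous.
  apply: cB => h; apply: (@continuous_comp _ _ _ (fun h : G => set_val h x) (f x)).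
    exact: sub_ptws_eval_continuous.
  by have [+ _ _ _] := fP x; apply.
- move=> _ [h _ <-]; rewrite /= in_itv /= subr_ge0 lerBlDr lerDl; apply/andP; split.
    rewrite (le_trans (@ler_prod _ _ s xpredT _ (fun=> 1%R) _)) ?big1// => x _.
    by have [_ /(_ (set_val h x))/andP[f0 f1] _ _] := fP x; rewrite subr_ge0 f1 gerBl f0.
  by apply: prodr_ge0 => x _; have [_ /(_ (set_val h x))/andP[_]] := fP x; rewrite subr_ge0.
- move=> _ [_ -> <-]; rewrite /p big1 ?subrr// => x _.
  by have [_ _ -> _] := fP x; rewrite subr0.
- move=> _ [h Bh <-].
  have [x xs nNx] : exists2 x, x \in s & ~ N x (set_val h x).
    apply: contrapT => nx; apply: (NB h _ Bh) => x xs.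
    by apply: contrapT => nNx; apply: nx; exists x.
  rewrite /p (big_rem x)//=; have [_ _ _ ->] := fP x => //.
  by rewrite subrr mul0r subr0.
Qed.

Lemma sub_ptws_compactification (R : realType) :
  completely_regular_space V -> hausdorff_space V ->
  exists (bG : topologicalType) (i : G -> bG), compactification i.
Proof.
move=> crV hV; apply: (@compactification_exists R).
  exact: sub_ptws_completely_regular R crV.
by apply: set_type_hausdorff; apply: hausdorff_product => _.
Qed.

End pointwise_topology.

(** * Groups of permutations of a discrete set *)

Section discrete_permutations.
Variables (X : choiceType).
Notation dX := (discrete_topology X).
Variable (A : set {ptws dX -> dX}).
Notation G := (set_type A).

Lemma discrete_sub_ptws_base (g : G) (U : set G) : open U -> U g ->
  exists s : seq X, forall h : G, (forall x, x \in s -> set_val h x = set_val g x) -> U h.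
Proof.
move=> oU Ug; have [s [N [Ng NU]]] := sub_ptws_base oU Ug.
by exists s => h hs; apply: NU => x /hs ->; exact: nbhs_singleton.
Qed.

(** The first hypothesis says that pointwise stabilizers of finite sets have infinite orbits outside
    these sets, transported to the coset of g. Compactness allows h x only finitely many values on
    H. *)
Lemma discrete_not_shrinks :
  (forall (g : G) (s : seq X) x, x \notin s ->
    infinite_set [set set_val h x | h in [set h : G |
      forall y, y \in s -> set_val h y = set_val g y]]) ->
  ~ countable [set: X] -> ~ shrinks_to_compact G.
Proof.
move=> moves ncX [H [U [cH UP HU]]].
have /choice[p pP] n : exists p : G * seq X, forall h : G,
    (forall x, x \in p.2 -> set_val h x = set_val p.1 x) -> U n h.
  have [oU [g Ug]] := UP n; have [s sP] := discrete_sub_ptws_base oU Ug.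
  by exists (g, s).
have [x xC] : exists x, forall n, x \notin (p n).2.
  apply: contrapT => /forallNP h; apply: ncX.
  have -> : [set: X] = \bigcup_n [set` (p n).2].
    apply/seteqP; split => // x _.
    by have /existsNP[n /negP] := h x; rewrite negbK; exists n.
  by apply: bigcup_countable => // n _; exact: finite_set_countable.
pose P (B : set G) := exists D : set X, finite_set D /\ forall h, B h -> D (set_val h x).
have [D [fD HD]] : P H.
  apply: compact_property => //.
  - by exists set0; split.
  - move=> B C [D [fD BD]] [E [fE CE]]; exists (D `|` E); split.
      by rewrite finite_setU.
    by move=> h [/BD|/CE]; [left|right].
  - by move=> B C BC [D [fD CD]]; exists D; split => // h /BC /CD.
  - move=> g Hg; exists ((fun h : G => set_val h x) @^-1` [set set_val g x]).
      by apply: sub_ptws_eval_continuous; exact: discrete_set1.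
    by exists [set set_val g x]; split; [exact: finite_set1|].
have [n Un] : exists n, U n `<=` (fun h : G => set_val h x) @^-1` D.
  apply: HU; last exact: HD.
  apply: open_comp; last exact: discrete_open.
  by move=> h _; exact: sub_ptws_eval_continuous.
apply: (moves (p n).1 (p n).2 x (xC n)).
apply: sub_finite_set fD => _ [h /= hp <-]; apply: Un; exact: pP.
Qed.

(** The covers fix the value of h at [e n] and the point sent to [e n]; the latter makes the limit
    bijective. Membership in A is tested on pairs of points, which is enough to preserve an
    order. *)
Lemma discrete_complete_cover :
  (forall g : {ptws dX -> dX}, A g -> bijective g) ->
  (forall g : {ptws dX -> dX}, bijective g ->
     (forall x y, exists2 h, A h & h x = g x /\ h y = g y) -> A g) ->
  countable [set: X] -> complete_cover_family G.
Proof.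
move=> bijA clA cX.
have [X0|/contrapT[x0 _]] := pselect ([set: X] !=set0 -> False).
  exists nat, (fun=> [set setT]); split.
  - by move=> _ _ ->; exact: openT.
  - by move=> _ g; exists setT.
  - move=> F FF _; have [g _] := @filter_ex _ F FF setT filterT.
    exists g; apply: sub_ptws_cvg => x; exfalso; by apply: X0; exists x.
have [e eX _] := countable_range x0 cX.
pose C (k : bool * nat) : set (set G) := [set B | exists y : X,
  B = if k.1 then [set h : G | set_val h (e k.2) = y] else [set h : G | set_val h y = e k.2]].
have oC x y : open [set h : G | set_val h x = y].
  apply: (@open_comp _ _ (fun h : G => set_val h x) [set y]); last exact: discrete_open.
  by move=> h _; exact: sub_ptws_eval_continuous.
exists (bool * nat)%type, C; split.
- by move=> [[] n] _ [y ->] /=.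
- move=> [[] n] g; rewrite /C /=; first by exists [set h : G | set_val h (e n) = set_val g (e n)] => //; exists (set_val g (e n)).
  have [g' _ gK] := bijA _ (set_valP g).
  exists [set h : G | set_val h (g' (e n)) = e n]; first by exists (g' (e n)).
  exact: gK.
move=> F FF FC.
have /choice[g gP] x : exists y, F [set h : G | set_val h x = y].
  have [n _ <-] := eX x I.
  by have [B [y ->] FB] := FC (true, n); exists y.
have /choice[f fP] x : exists y, F [set h : G | set_val h y = x].
  have [n _ <-] := eX x I.
  by have [B [y ->] FB] := FC (false, n); exists y.
have gf x : g (f x) = x.
  have [h [/= <- //]] := @filter_ex _ F FF _ (filterI (gP (f x)) (fP x)).
have fg x : f (g x) = x.
  have [h [/= hx hfx]] := @filter_ex _ F FF _ (filterI (gP x) (fP (g x))).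
  by apply: (bij_inj (bijA _ (set_valP h))); rewrite [LHS]hfx [RHS]hx.
have Ag : A g.
  apply: clA; first by exists f.
  move=> x y; have [h [/= hx hy]] := @filter_ex _ F FF _ (filterI (gP x) (gP y)).
  by exists (set_val h) => //; exact: set_valP.
exists (exist _ g (mem_set Ag)); apply: sub_ptws_cvg => x N Nx.
by apply: filterS (gP x) => h /= ->; exact: nbhs_singleton.
Qed.

End discrete_permutations.
Lemma discrete_completely_regular (R : realType) (X : choiceType) :
  completely_regular_space (discrete_topology X).
Proof. exact: (@uniform_completely_regular R). Qed.

(** * The unitary group *)

Section l2_operators.
Local Open Scope ring_scope.
Local Open Scope complex_scope.
Variables (R : realType) (X : choiceType).
Local Notation l2 := (l2 R X).
Implicit Types (u v w : l2) (T : l2 -> l2).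

Lemma l2_normN u : l2_norm (- u) = l2_norm u.
Proof. by rewrite -scaleN1r l2_normZ normrN normr1 mul1r. Qed.

Lemma l2_normBC u v : l2_norm (u - v) = l2_norm (v - u).
Proof. by rewrite -l2_normN opprB. Qed.

Lemma l2_dist_triangle v u w : l2_norm (u - w) <= l2_norm (u - v) + l2_norm (v - w).
Proof. by have := l2_normD (u - v) (v - w); rewrite addrA subrK. Qed.

Lemma l2_norm0_le u : (forall e : R, 0 < e -> l2_norm u <= e) -> u = 0.
Proof.
move=> h; apply: l2_norm_eq0; apply/eqP; rewrite eq_le l2_norm_ge0 andbT.
by apply/ler_addgt0Pr => e e0; rewrite add0r; exact: h.
Qed.

Lemma l2_norm_approx u (e : R) : 0 < e ->
  exists A : {fset X}, l2_norm u ^+ 2 - e < \sum_(x <- A) sqmod (u x).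
Proof.
move=> e0; apply: contrapT => /forallNP h.
have hA (A : {fset X}) : \sum_(x <- A) sqmod (u x) <= l2_norm u ^+ 2 - e.
  by rewrite leNgt; apply/negP/h.
have ue0 : 0 <= l2_norm u ^+ 2 - e by apply: le_trans (hA fset0); rewrite big_seq_fset0.
have : l2_norm u <= Num.sqrt (l2_norm u ^+ 2 - e).
  by apply/(l2_norm_leP u (sqrtr_ge0 _)) => A; rewrite sqr_sqrtr.
move=> h1; have : l2_norm u ^+ 2 <= Num.sqrt (l2_norm u ^+ 2 - e) ^+ 2.
  by rewrite ler_sqr ?nnegrE ?l2_norm_ge0 ?sqrtr_ge0.
by rewrite sqr_sqrtr// => ule; lra.
Qed.

Lemma l2_partial_sum_cvg u :
  @summability.partial_sum X R[i]^o (fun x => u x * (u x)^*%C) A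
    @[A --> summability.totally] --> ((l2_norm u ^+ 2)%:C : R[i]^o).
Proof.
have psE (A : {fset X}) :
    @summability.partial_sum X R[i]^o (fun x => u x * (u x)^*%C) A =
    (\sum_(x <- A) sqmod (u x))%:C.
  rewrite /summability.partial_sum rmorph_sum /= [RHS]big_seq_fsetE /=.
  apply: eq_bigr => x _; case: (u (fsval x)) => a b.
  by rewrite /sqmod /=; simpc; congr Complex; ring.
have FF := @summability.totally_filter X.
apply/(@cvgrPdist_lt R[i] R[i]^o) => -[e e'] /=; rewrite ltcE /= => /andP[/eqP -> e0].
have [A uA] := l2_norm_approx u e0.
exists A => // B /= AB; rewrite psE -rmorphB /= normc_def /= expr0n /= addr0.
rewrite sqrtr_sqr ltcR ger0_norm ?subr_ge0 ?l2_norm_sum//.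
rewrite ltrBlDl -ltrBlDr; apply: lt_le_trans uA _.
rewrite [leRHS](big_fsetID _ (mem A)) /=.
have -> : [fset x in B | x \in A]%fset = A.
  by apply/fsetP => x; rewrite !inE andbC; case: (boolP (x \in A)) => //= /(fsubsetP AB).
by rewrite lerDl sumr_ge0// => x _; exact: sqmod_ge0.
Qed.


Let I0 : R[i] := Complex 0 1.

(* The polarization identity expresses l2_dot through norms; this also settles
   the convergence of the sum defining it. *)
Lemma complex_polar (z w : R[i]) : z * w^*%C + z * w^*%C + (z * w^*%C + z * w^*%C) =
  ((z + w) * (z + w)^*%C - (z - w) * (z - w)^*%C) +
   I0 * ((z + I0 * w) * (z + I0 * w)^*%C - (z - I0 * w) * (z - I0 * w)^*%C).
Proof.
case: z w => [a b] [c d].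
by apply/eqP; rewrite eq_complex /=; apply/andP; split; apply/eqP; ring.
Qed.

Lemma l2_dot_polar u v : l2_dot u v = 4^-1 *
  (((l2_norm (u + v) ^+ 2)%:C - (l2_norm (u - v) ^+ 2)%:C) +
   I0 * ((l2_norm (u + I0 *: v) ^+ 2)%:C - (l2_norm (u - I0 *: v) ^+ 2)%:C)).
Proof.
have FF := @summability.totally_filter X.
apply: (@cvg_lim R[i]^o); first exact: norm_hausdorff.
pose ps u (A : {fset X}) := @summability.partial_sum X R[i]^o (fun x => u x * (u x)^*%C) A.
have psE A : @summability.partial_sum X R[i]^o (fun x => u x * (v x)^*%C) A =
   4^-1 * ((ps (u + v) A - ps (u - v) A) + I0 * (ps (u + I0 *: v) A - ps (u - I0 *: v) A)).
  rewrite /ps /summability.partial_sum -!sumrB mulr_sumr -big_split /= mulr_sumr.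
  apply: eq_bigr => x _; rewrite /=.
  have quarter (z : R[i]) : z = 4^-1 * (z + z + (z + z)) by field.
  rewrite [LHS]quarter.
  by congr (_ * _); exact: complex_polar.
have cps w : ps w A @[A --> summability.totally] --> ((l2_norm w ^+ 2)%:C : R[i]^o).
  exact: l2_partial_sum_cvg.
rewrite (_ : summability.partial_sum _ = (fun A => 4^-1 * ((ps (u + v) A - ps (u - v) A) +
   I0 * (ps (u + I0 *: v) A - ps (u - I0 *: v) A)))); last exact/funext.
apply: cvgM; first exact: cvg_cst.
apply: cvgD; first by apply: cvgB; exact: cps.
apply: cvgM; first exact: cvg_cst.
by apply: cvgB; exact: cps.
Qed.

(** By polarization a linear isometry preserves [l2_dot]. Norms are easier to pass to limits than
    the sum that defines [l2_dot]. *)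
Lemma unitaryP T : unitary T <->
  [/\ linear T, bijective T & forall u, l2_norm (T u) = l2_norm u].
Proof.
split=> -[linT bijT isoT]; split => //.
  move=> u; have := isoT u u; rewrite !l2_dotuu => -[/eqP].
  by rewrite eqrXn2 ?l2_norm_ge0// => /eqP.
have TD u v : T (u + v) = T u + T v by have := linT 1 u v; rewrite !scale1r.
have T0 : T 0 = 0 by apply: (@addrI _ (T 0)); rewrite -TD !addr0.
have TZ a u : T (a *: u) = a *: T u by have := linT a u 0; rewrite T0 !addr0.
have TN u : T (- u) = - T u by rewrite -scaleN1r TZ scaleN1r.
by move=> u v; rewrite !l2_dot_polar -!TZ -!TN -!TD !isoT.
Qed.


Definition l2_delta_fun (x : X) : X -> R[i] := fun y => if y == x then 1 else 0.

Lemma l2_delta_subproof x : l2_delta_fun x \in @l2_pred R X.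
Proof.
apply/l2_predP; exists 1 => A.
have [xA|xA] := boolP (x \in A).
  rewrite (big_fsetD1 x)//= big_seq big1 => [|y]; rewrite /l2_delta_fun.
    by rewrite eqxx /sqmod /= expr1n expr0n addr0 addr0.
  by rewrite !inE => /andP[/negPf -> _]; rewrite /sqmod /= expr0n addr0.
rewrite big_seq big1 ?ler01// => y yA; rewrite /l2_delta_fun.
by case: eqP => [yx|_]; [rewrite -yx yA in xA|rewrite /sqmod /= expr0n addr0].
Qed.

Definition l2_delta x : l2 := L2 (l2_delta_subproof x).

(** Reading a single coordinate gives 1 instead of the exact square root of 2; this already excludes
    two points within distance 1/2 of a common one. *)
Lemma l2_delta_dist x y : x != y -> 1 <= l2_norm (l2_delta x - l2_delta y).
Proof.
move=> xy; rewrite -(@ler_sqr R) ?nnegrE ?l2_norm_ge0// expr1n.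
apply: le_trans (l2_norm_sum _ [fset x]%fset); rewrite big_seq_fset1 /=.
rewrite -[(_ - _) x]/(l2_delta_fun x x - l2_delta_fun y x) /l2_delta_fun eqxx (negPf xy) subr0.
by rewrite /sqmod /= expr1n expr0n addr0.
Qed.

Lemma l2_perm_subproof (s : X -> X) u : injective s -> (u \o s) \in @l2_pred R X.
Proof.
move=> injs; apply/l2_predP; exists (l2_norm u ^+ 2) => A.
apply: le_trans (l2_norm_sum u [fset s x | x in A]%fset).
by rewrite big_imfset //= => x y _ _; exact: injs.
Qed.

Definition l2_perm (s : X -> X) (injs : injective s) u : l2 := L2 (l2_perm_subproof u injs).

Lemma l2_perm_unitary (s : X -> X) (injs : injective s) : involutive s -> unitary (l2_perm injs).
Proof.
move=> sK; apply/unitaryP; split.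
- by move=> a u v; apply: val_inj.
- by exists (l2_perm injs) => u; apply: val_inj; apply/funext => x /=; rewrite sK.
- have le u : l2_norm (l2_perm injs u) <= l2_norm u.
    apply/(l2_norm_leP _ (l2_norm_ge0 _)) => A.
    apply: le_trans (l2_norm_sum u [fset s x | x in A]%fset).
    by rewrite big_imfset //= => x y _ _; exact: injs.
  move=> u; apply/eqP; rewrite eq_le le /=; apply: le_trans (le _).
  by rewrite (_ : l2_perm injs _ = u)//; apply: val_inj; apply/funext => x /=; rewrite sK.
Qed.

Lemma l2_countable_support u : countable [set x | u x != 0].
Proof.
(* Each level set is finite: its size is at most n + 1 times the squared norm of u. *)
have -> : [set x | u x != 0] = \bigcup_n [set x | n.+1%:R^-1 <= sqmod (u x)].
  apply/seteqP; split => x /= ux.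
    have s0 : 0 < sqmod (u x).
      by rewrite lt_neqAle sqmod_ge0 andbT eq_sym; apply: contra ux => /eqP h; apply/eqP/sqmod_eq0; rewrite h.
    exists (Num.truncn (sqmod (u x))^-1) => //=.
    rewrite invf_ple ?posrE//; exact/ltW/truncnS_gt.
  case: ux => n _ /= h; apply/eqP => ux0; move: h.
  by rewrite ux0 /sqmod /= expr0n addr0 leNgt invr_gt0 ltr0Sn.
apply: bigcup_countable => // n _; apply: finite_set_countable.
apply: contrapT => /(@infinite_set_fset _ _ (Num.truncn (n.+1%:R * l2_norm u ^+ 2)).+1)[A An cA].
have := l2_norm_sum u A; rewrite leNgt => /negP; apply.
have : \sum_(x <- A) n.+1%:R^-1 <= \sum_(x <- A) sqmod (u x).
  by rewrite big_seq [leRHS]big_seq; apply: ler_sum => x xA; exact: An.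
apply: lt_le_trans; rewrite big_const_seq count_predT iter_addr_0.
rewrite -[_ *+ _]mulr_natl ltr_pdivlMr// mulrC; apply: lt_le_trans (truncnS_gt _) _.
by rewrite ler_nat.
Qed.

End l2_operators.

Section unitary_groups.
Local Open Scope ring_scope.
Local Open Scope complex_scope.
Variables (R : realType) (X : choiceType).
Local Notation l2 := (l2 R X).
Notation G := (set_type (@unitary R X : set {ptws l2 -> l2})).
Implicit Types (u v w : l2).

Lemma l2_nbhsP u (N : set l2) : nbhs u N <->
  exists2 e : R, 0 < e & forall v, l2_norm (v - u) < e -> N v.
Proof.
split.
  move=> /(@nbhs_normP R[i] l2)[[e e'] /=]; rewrite ltcE /= => /andP[/eqP -> e0] eN.
  exists e => // v uv; apply: eN.
  by change ((l2_norm (u - v))%:C < e%:C); rewrite ltcR l2_normBC.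
move=> [e e0 eN]; apply/(@nbhs_normP R[i] l2); exists e%:C; first by rewrite /= ltcR.
by move=> v /=; rewrite ltcR l2_normBC; exact: eN.
Qed.

Lemma l2_hausdorff : hausdorff_space l2.
Proof. exact: (@norm_hausdorff R[i] l2). Qed.

Lemma l2_completely_regular : completely_regular_space l2.
Proof. exact: (@uniform_completely_regular R l2). Qed.

Lemma unitary_comp (S T : l2 -> l2) : unitary S -> unitary T -> unitary (S \o T).
Proof.
move=> /unitaryP[linS bijS isoS] /unitaryP[linT bijT isoT]; apply/unitaryP; split.
- by move=> a u v; rewrite /= linT linS.
- exact: bij_comp.
- by move=> u; rewrite /= isoS isoT.
Qed.

Lemma unitary_dist (T : l2 -> l2) u v : unitary T -> l2_norm (T u - T v) = l2_norm (u - v).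
Proof.
move=> /unitaryP[linT _ isoT]; rewrite -[RHS]isoT.
by have := linT (-1) v u; rewrite !scaleN1r [u - v]addrC => ->; rewrite addrC.
Qed.

Lemma unitary_not_shrinks : ~ countable [set: X] -> ~ shrinks_to_compact G.
Proof.
move=> ncX [H [U [cH UP HU]]].
have /choice[p pP] n : exists p : G * seq l2, forall h : G,
    (forall u, u \in p.2 -> set_val h u = set_val p.1 u) -> U n h.
  have [oU [g Ug]] := UP n; have [s [N [Ng NU]]] := sub_ptws_base oU Ug.
  by exists (g, s) => h hg; apply: NU => u us; rewrite hg//; exact: nbhs_singleton.
pose C := \bigcup_n \bigcup_(u in [set` (p n).2]) [set x | u x != 0].
have cC : countable C.
  apply: bigcup_countable => // n _; apply: bigcup_countable.
    exact: finite_set_countable.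
  by move=> u _; exact: l2_countable_support.
have iC : infinite_set (~` C).
  move=> fC; apply: ncX; rewrite -(setUv C) -bigcup2E.
  apply: bigcup_countable => // -[|[|k]] _ /=; [by []|exact: finite_set_countable|exact: countable0].
have [x xC] : ~` C !=set0.
  by apply/set0P/eqP => C0; apply: iC; rewrite C0.
pose P (B : set G) := exists2 D : set l2, finite_set D &
  forall h, B h -> exists2 d, D d & l2_norm (set_val h (l2_delta R x) - d) < 2^-1.
(* Compactness makes the values at the basis vector of x totally bounded, even on a neighbourhood V
   of H. *)
have [V [oV HV [D fD VD]]] : exists V : set G, [/\ open V, H `<=` V & P V].
  pose Q (B : set G) := exists V : set G, [/\ open V, B `<=` V & P V].
  apply: (@compact_property _ _ Q) => //.
  - by exists set0; split => //; [exact: open0|exists set0].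
  - move=> B B' [V [oV BV [D fD VD]]] [V' [oV' BV' [D' fD' VD']]].
    exists (V `|` V'); split; [exact: openU|exact: setUSS|].
    exists (D `|` D'); first by rewrite finite_setU.
    move=> h [/VD[d Dd hd]|/VD'[d Dd hd]]; exists d => //; [by left|by right].
  - by move=> B B' BB' [V [oV BV VP]]; exists V; split => //; exact: subset_trans BV.
  - move=> g Hg; pose W : set l2 := [set v | l2_norm (v - set_val g (l2_delta R x)) < 2^-1].
    have oW : open W.
      rewrite openE => v /= Wv; apply/l2_nbhsP.
      exists (2^-1 - l2_norm (v - set_val g (l2_delta R x))); first by rewrite subr_gt0.
      by move=> w wv; rewrite /W /=; apply: le_lt_trans (l2_dist_triangle v _ _) _; rewrite -ltrBrDr.
    have oV : open ((fun h : G => set_val h (l2_delta R x)) @^-1` W).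
      by apply: open_comp => // h _; exact: sub_ptws_eval_continuous.
    have Vg : ((fun h : G => set_val h (l2_delta R x)) @^-1` W) g.
      by rewrite /W /= subrr; have /eqP := @normr0 _ l2; rewrite /= => /eqP [->]; rewrite invr_gt0.
    exists ((fun h : G => set_val h (l2_delta R x)) @^-1` W).
      by apply: open_nbhs_nbhs.
    exists ((fun h : G => set_val h (l2_delta R x)) @^-1` W); split => //.
    exists [set set_val g (l2_delta R x)]; first exact: finite_set1.
    by move=> h Wh; exists (set_val g (l2_delta R x)).
have [n UV] := HU V oV HV.
(* Exchanging x and y fixes every vector supported in C, so composing with this exchange stays in
   [U n] and sends the basis vector of x to the image of that of y. These images are 1-separated,
   yet all are close to the finite set D. *)
have close y : exists d, (~` C) y -> D d /\ l2_norm (set_val (p n).1 (l2_delta R y) - d) < 2^-1.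
  have [yC|] := pselect ((~` C) y); last by exists 0.
  pose s z := if z == x then y else if z == y then x else z.
  have sK : involutive s.
    rewrite /s => z; case: (eqVneq z x) => [->|zx].
      by case: (eqVneq y x) => [->//|yx]; rewrite eqxx.
    by case: (eqVneq z y) => [->|zy]; rewrite ?eqxx// (negPf zx) (negPf zy).
  have uT : unitary (set_val (p n).1 \o l2_perm (inv_inj sK)).
    apply: unitary_comp; [exact: (set_valP (p n).1)|exact: l2_perm_unitary].
  pose h : G := exist _ (set_val (p n).1 \o l2_perm (inv_inj sK)) (mem_set uT).
  have [|d Dd hd] := VD h.
    apply: UV; apply: pP => u us; congr (set_val (p n).1 _).
    have supp z : (~` C) z -> u z = 0.
      by move=> zC; apply/eqP/negP => /negP uz; apply: zC; exists n => //; exists u.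
    apply: val_inj; apply/funext => z; rewrite /= /s.
    case: (eqVneq z x) => [->|zx]; first by rewrite !supp.
    by case: (eqVneq z y) => [->|//]; rewrite !supp.
  have hx : l2_perm (inv_inj sK) (l2_delta R x) = l2_delta R y.
    apply: val_inj; apply/funext => z; rewrite /= /l2_delta_fun /s.
    have [->|zx] := eqVneq z x; first by rewrite eq_sym.
    have [_|zy] := eqVneq z y; first by rewrite eqxx.
    by rewrite (negPf zx).
  by exists d => _; split; [exact: Dd|rewrite -hx; exact: hd].
have /choice[phi phiP] := close.
have injphi : {in ~` C &, injective phi}.
  move=> y z; rewrite !inE => /phiP[_ yd] /phiP[_ zd] yz; apply/eqP/negP => /negP yNz.
  have := l2_delta_dist R yNz.
  rewrite -(unitary_dist _ _ (set_valP (p n).1 : unitary _)).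
  rewrite leNgt => /negP; apply; apply: le_lt_trans (l2_dist_triangle (phi y) _ _) _.
  by rewrite [X in _ + X]l2_normBC {2}yz [1]splitr div1r ltrD.
apply: iC; rewrite -(eq_finite_set (inj_card_eq injphi)).
by apply: sub_finite_set fD => _ [y yC <-]; have [] := phiP _ yC.
Qed.
End unitary_groups.

(** * Completeness of l2 and Cauchy families of isometries *)

Section l2_limits.
Local Open Scope ring_scope.
Local Open Scope complex_scope.
Variables (R : realType) (X : choiceType).
Local Notation l2 := (l2 R X).
Implicit Types (u v w : l2).

(** The index type is arbitrary because it will be the group itself, with s the evaluation at a
    vector. *)
Definition l2_cauchy (T : Type) (F : set_system T) (s : T -> l2) :=
  forall e : R, 0 < e -> exists2 B, F B & forall g h, B g -> B h -> l2_norm (s g - s h) <= e.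

Definition l2_cvg (T : Type) (F : set_system T) (s : T -> l2) (a : l2) :=
  forall e : R, 0 < e -> F [set g | l2_norm (s g - a) <= e].

Lemma l2_norm00 : l2_norm (0 : l2) = 0.
Proof. by rewrite -[0](scale0r (0 : l2)) l2_normZ normr0 mul0r. Qed.

Lemma sqmod_le_l2_norm u x : sqmod (u x) <= l2_norm u ^+ 2.
Proof. by have := l2_norm_sum u [fset x]%fset; rewrite big_seq_fset1. Qed.

Lemma Re_le_l2_norm u x : `|complex.Re (u x)| <= l2_norm u.
Proof.
rewrite -(@ler_sqr R) ?nnegrE ?l2_norm_ge0//; apply: le_trans (sqmod_le_l2_norm u x).
by rewrite real_normK ?num_real// /sqmod lerDl sqr_ge0.
Qed.

Lemma Im_le_l2_norm u x : `|complex.Im (u x)| <= l2_norm u.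
Proof.
rewrite -(@ler_sqr R) ?nnegrE ?l2_norm_ge0//; apply: le_trans (sqmod_le_l2_norm u x).
by rewrite real_normK ?num_real// /sqmod lerDr sqr_ge0.
Qed.

Lemma real_cauchy_cvg (T : Type) (F : set_system T) (f : T -> R) : ProperFilter F ->
  (forall e : R, 0 < e -> exists2 B, F B & forall g h, B g -> B h -> `|f g - f h| <= e) ->
  cvg (f @ F).
Proof.
move=> FF cf; apply: cauchy_cvg; apply: cauchy_exP => e e0.
have e2 : 0 < e / 2 by rewrite divr_gt0.
have [B FB Bfe] := cf _ e2; have [g Bg] := filter_ex FB.
exists (f g); apply: (@filterS _ F _ _ _ _ FB) => h Bh; rewrite -ball_normE /=.
by apply: le_lt_trans (Bfe _ _ Bg Bh) _; rewrite ltr_pdivrMr// ltr_pMr// ltr1n.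
Qed.

(** The limit is taken in each coordinate. Cauchy bounds on finite partial sums pass to this limit,
    which shows at once that s g - a is square summable and that it is small. *)
Lemma l2_complete (T : Type) (F : set_system T) (s : T -> l2) : ProperFilter F ->
  l2_cauchy F s -> exists a, l2_cvg F s a.
Proof.
move=> FF cs.
have cRe x : cvg ((fun g => complex.Re (s g x)) @ F).
  apply: real_cauchy_cvg => e e0; have [B FB Be] := cs _ e0; exists B => // g h Bg Bh.
  apply: le_trans (Be _ _ Bg Bh); apply: le_trans (Re_le_l2_norm _ x).
  by rewrite -[(_ - _ : l2) x]/(s g x - s h x) raddfB.
have cIm x : cvg ((fun g => complex.Im (s g x)) @ F).
  apply: real_cauchy_cvg => e e0; have [B FB Be] := cs _ e0; exists B => // g h Bg Bh.
  apply: le_trans (Be _ _ Bg Bh); apply: le_trans (Im_le_l2_norm _ x).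
  by rewrite -[(_ - _ : l2) x]/(s g x - s h x) raddfB.
pose a x : R[i] := Complex (lim ((fun g => complex.Re (s g x)) @ F)) (lim ((fun g => complex.Im (s g x)) @ F)).
have bound e B (A : {fset X}) : F B -> (forall g h, B g -> B h -> l2_norm (s g - s h) <= e) ->
    forall g, B g -> \sum_(x <- A) sqmod (s g x - a x) <= e ^+ 2.
  move=> FB Be g Bg.
  have lim_sum : (\sum_(x <- A) sqmod (s g x - s h x)) @[h --> F] --> \sum_(x <- A) sqmod (s g x - a x).
    apply: (@cvg_big R X +%R 0 xpredT) => [x|x _]; first exact: add_continuous.
    rewrite /sqmod; apply: cvgD; rewrite raddfB /=.
      under eq_fun do rewrite raddfB /=.
      by apply: cvgM; apply: cvgB; [exact: cvg_cst|exact: cRe|exact: cvg_cst|exact: cRe].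
    under eq_fun do rewrite raddfB /=.
    by apply: cvgM; apply: cvgB; [exact: cvg_cst|exact: cIm|exact: cvg_cst|exact: cIm].
  apply: (closed_cvg (fun r : R => r <= e ^+ 2)) lim_sum; first exact: closed_le.
  apply: filterS FB => h Bh; apply: le_trans (l2_norm_sum (s g - s h) A) _.
  by rewrite ler_sqr ?nnegrE ?l2_norm_ge0 ?Be// (le_trans (l2_norm_ge0 _) (Be _ _ Bg Bh)).
have [B FB B1] := cs 1 ltr01; have [g Bg] := filter_ex FB.
have sga : (fun x => s g x - a x) \in @l2_pred R X.
  by apply/l2_predP; exists (1 ^+ 2) => A; exact: bound FB B1 _ Bg.
have al2 : a \in @l2_pred R X.
  have -> : a = (s g : X -> R[i]) - (fun x => s g x - a x).
    by apply/funext => x; rewrite -[RHS]/(s g x - (s g x - a x)) opprB addrC subrK.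
  by apply: rpredB => //; exact: (valP (s g)).
exists (L2 al2) => e e0; have [B' FB' Be] := cs _ e0; apply: filterS (FB') => h Bh /=.
by apply/(l2_norm_leP _ (ltW e0)) => A; exact: bound FB' Be _ Bh.
Qed.

Lemma l2_cauchy_scale (T : Type) (F : set_system T) (s : T -> l2) (c : R[i]) :
  Filter F -> l2_cauchy F s -> l2_cauchy F (fun t => c *: s t).
Proof.
move=> FF cs e e0; have n0 : 0 < complex.Re `|c| + 1.
  by rewrite ltr_wpDl// normc_def sqrtr_ge0.
have [B FB Be] := cs _ (divr_gt0 e0 n0); exists B => // g h Bg Bh.
rewrite -scalerBr l2_normZ; apply: (@le_trans _ _ ((complex.Re `|c| + 1) * (e / (complex.Re `|c| + 1)))).
  by apply: ler_pM; rewrite ?Be ?l2_norm_ge0 ?lerDl// normc_def sqrtr_ge0.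
by rewrite mulrC divfK// gt_eqF.
Qed.

Lemma l2_cauchyD (T : Type) (F : set_system T) (s t : T -> l2) :
  Filter F -> l2_cauchy F s -> l2_cauchy F t -> l2_cauchy F (fun x => s x + t x).
Proof.
move=> FF cs ct e e0; have e2 : 0 < e / 2 by rewrite divr_gt0.
have [B FB Be] := cs _ e2; have [C FC Ce] := ct _ e2.
exists (B `&` C); first exact: filterI.
move=> g h [Bg Cg] [Bh Ch]; rewrite opprD addrACA; apply: le_trans (l2_normD _ _) _.
by rewrite [leRHS]splitr; apply: lerD; [exact: Be|exact: Ce].
Qed.

Lemma l2_delta_approx u (e : R) : 0 < e ->
  exists A : {fset X}, l2_norm (u - \sum_(x <- A) u x *: l2_delta R x) <= e.
Proof.
move=> e0; have e2 : 0 < e ^+ 2 by rewrite exprn_gt0.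
have [A uA] := l2_norm_approx u e2; exists A.
apply/(l2_norm_leP _ (ltW e0)) => B.
have sumE (r : seq X) y : (\sum_(x <- r) u x *: l2_delta R x : l2) y =
    \sum_(x <- r) u x * (if y == x then 1 else 0).
  by elim: r => [|x r ih]; rewrite ?big_nil// !big_cons -ih.
have coord y : sqmod ((u - \sum_(x <- A) u x *: l2_delta R x : l2) y) =
    if y \in A then 0 else sqmod (u y).
  rewrite -[(_ - _ : l2) y]/(u y - (\sum_(x <- A) u x *: l2_delta R x : l2) y) sumE.
  case: ifPn => yA.
    rewrite (big_fsetD1 y)//= eqxx mulr1 big_seq big1 ?addr0 ?subrr.
      by rewrite /sqmod /= expr0n addr0.
    by move=> x; rewrite !inE eq_sym => /andP[/negPf -> _]; rewrite mulr0.
  rewrite big_seq big1 ?subr0// => x xA; case: eqP => [yx|_]; last by rewrite mulr0.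
  by rewrite yx xA in yA.
under eq_bigr do rewrite coord.
have := l2_norm_sum u (A `|` B)%fset.
rewrite (big_fsetID _ (mem A)) /=.
have -> : [fset x in (A `|` B)%fset | x \in A]%fset = A.
  by apply/fsetP => x; rewrite !inE; case: (x \in A); rewrite ?andbF ?andbT.
have -> : [fset x in (A `|` B)%fset | x \notin A]%fset = [fset x in B | x \notin A]%fset.
  by apply/fsetP => x; rewrite !inE; case: (x \in A); rewrite ?andbF ?andbT.
move=> uAB; rewrite (big_fsetID _ (mem A)) /= big_seq big1 ?add0r => [|x]; last first.
  by rewrite !inE => /andP[_ ->].
rewrite (_ : \sum_(x <- _) _ = \sum_(x <- [fset x in B | x \notin A]%fset) sqmod (u x)).
  lra.
by rewrite big_seq [RHS]big_seq; apply: eq_bigr => x; rewrite !inE => /andP[_ /negPf ->].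
Qed.

(** Isometries are equicontinuous, so the Cauchy property spreads from basis vectors to their
    combinations and then to the closure. This is why countably many covers suffice when X is
    countable. *)
Lemma l2_cauchy_isometries (T : Type) (F : set_system T) (s : T -> l2 -> l2) : Filter F ->
  (forall t, linear (s t)) -> (forall t u, l2_norm (s t u) = l2_norm u) ->
  (forall x, l2_cauchy F (s^~ (l2_delta R x))) -> forall u, l2_cauchy F (s^~ u).
Proof.
move=> FF lins isos cs u.
have sD t v w : s t (v + w) = s t v + s t w by have := lins t 1 v w; rewrite !scale1r.
have s0 t : s t 0 = 0 by apply: (@addrI _ (s t 0)); rewrite -sD !addr0.
have sZ t a v : s t (a *: v) = a *: s t v by have := lins t a v 0; rewrite s0 !addr0.
have sN t v : s t (- v) = - s t v by rewrite -scaleN1r sZ scaleN1r.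
have csum (r : seq X) (c : X -> R[i]) : l2_cauchy F (s^~ (\sum_(x <- r) c x *: l2_delta R x)).
  elim: r => [|x r ih].
    move=> e e0; exists setT; first exact: filterT.
    by move=> g h _ _; rewrite big_nil !s0 subrr l2_norm00 ltW.
  rewrite (_ : _^~ _ = fun t => c x *: s t (l2_delta R x) + s t (\sum_(x <- r) c x *: l2_delta R x)).
    by apply: l2_cauchyD => //; exact: l2_cauchy_scale.
  by apply/funext => t; rewrite big_cons sD sZ.
move=> e e0; have e3 : 0 < e / 3 by rewrite divr_gt0.
have [A uA] := l2_delta_approx u e3; set v := \sum_(x <- A) _ in uA.
have [B FB Be] := csum A u _ e3; exists B => // g h Bg Bh.
apply: le_trans (l2_dist_triangle (s g v) _ _) _.
apply: le_trans (lerD (lexx _) (l2_dist_triangle (s h v) _ _)) _.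
rewrite [s g u - _](_ : _ = s g (u - v)) ?isos; last by rewrite sD sN.
rewrite [s h v - _](_ : _ = s h (v - u)) ?isos; last by rewrite sD sN.
rewrite [l2_norm (v - u)]l2_normBC.
have -> : e = e / 3 + (e / 3 + e / 3) by field.
by apply: lerD => //; apply: lerD => //; exact: Be.
Qed.

End l2_limits.

Section unitary_completeness.
Local Open Scope ring_scope.
Local Open Scope complex_scope.
Variables (R : realType) (X : choiceType).
Local Notation l2 := (l2 R X).
Notation G := (set_type (@unitary R X : set {ptws l2 -> l2})).
Implicit Types (u v w : l2).

Lemma l2_cvg_unique (T : Type) (F : set_system T) (s : T -> l2) a b :
  ProperFilter F -> l2_cvg F s a -> l2_cvg F s b -> a = b.
Proof.
move=> FF sa sb; apply/eqP; rewrite -subr_eq0; apply/eqP; apply: l2_norm0_le => e e0.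
have e2 : 0 < e / 2 by rewrite divr_gt0.
have [t [/= ta tb]] := filter_ex (filterI (sa _ e2) (sb _ e2)).
apply: le_trans (l2_dist_triangle (s t) _ _) _.
by rewrite [leRHS]splitr l2_normBC; apply: lerD.
Qed.

Lemma l2_cvg_linear (T : Type) (F : set_system T) (s : T -> l2 -> l2) (a : l2 -> l2) :
  ProperFilter F -> (forall t, linear (s t)) -> (forall u, l2_cvg F (s^~ u) (a u)) -> linear a.
Proof.
move=> FF lins sa c u v; apply: (@l2_cvg_unique _ F (s^~ (c *: u + v))) => // e e0.
have n0 : 0 < complex.Re `|c| + 1 by rewrite ltr_wpDl// normc_def sqrtr_ge0.
have e2 : 0 < e / 2 by rewrite divr_gt0.
have e3 : 0 < e / 2 / (complex.Re `|c| + 1) by rewrite divr_gt0.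
apply: filterS2 (sa u _ e3) (sa v _ e2) => t /= tu tv.
rewrite lins opprD addrACA -scalerBr; apply: le_trans (l2_normD _ _) _.
rewrite [leRHS]splitr; apply: lerD => //; rewrite l2_normZ.
apply: (@le_trans _ _ ((complex.Re `|c| + 1) * (e / 2 / (complex.Re `|c| + 1)))).
  by apply: ler_pM; rewrite ?l2_norm_ge0 ?lerDl// normc_def sqrtr_ge0.
by rewrite mulrC divfK// gt_eqF.
Qed.

Lemma l2_cvg_norm (T : Type) (F : set_system T) (s : T -> l2) (a : l2) (r : R) :
  ProperFilter F -> (forall t, l2_norm (s t) = r) -> l2_cvg F s a -> l2_norm a = r.
Proof.
move=> FF sr sa; apply/eqP; rewrite eq_le; apply/andP; split; apply/ler_addgt0Pr => e e0.
  have [t /= te] := filter_ex (sa _ e0).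
  by rewrite -(sr t) -[a](subrK (s t)) addrC (le_trans (l2_normD _ _))// lerD2l l2_normBC.
have [t /= te] := filter_ex (sa _ e0).
by rewrite -(sr t) -[s t](subrK a) (le_trans (l2_normD _ _))// addrC lerD2l.
Qed.

(** As [s t] is an isometry, it carries the closeness of [b u] and [s' t u] to that of [s t (b u)]
    and u. *)
Lemma l2_cvg_cancel (T : Type) (F : set_system T) (s s' : T -> l2 -> l2) (a b : l2 -> l2) :
  ProperFilter F -> (forall t, unitary (s t)) -> (forall t, cancel (s' t) (s t)) ->
  (forall u, l2_cvg F (s^~ u) (a u)) -> (forall u, l2_cvg F (s'^~ u) (b u)) -> cancel b a.
Proof.
move=> FF us sK sa sb u; apply/eqP; rewrite -subr_eq0; apply/eqP; apply: l2_norm0_le => e e0.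
have e2 : 0 < e / 2 by rewrite divr_gt0.
have [t [/= ta tb]] := filter_ex (filterI (sa (b u) _ e2) (sb u _ e2)).
apply: le_trans (l2_dist_triangle (s t (b u)) _ _) _.
rewrite [leRHS]splitr; apply: lerD; first by rewrite l2_normBC.
by rewrite -[X in _ - X](sK t u) unitary_dist// l2_normBC.
Qed.

(** A strong limit of unitary operators is an isometry that may fail to be onto. The covers
    therefore bound the oscillation of both h and its inverse at basis vectors, and the limit of the
    inverses inverts the limit. *)
Lemma unitary_complete_cover (x0 : X) : countable [set: X] -> complete_cover_family G.
Proof.
move=> cX; have [e eX _] := countable_range x0 cX.
have /choice[inv invP] (h : G) : exists k : l2 -> l2, cancel (set_val h) k /\ cancel k (set_val h).
  by have /unitaryP[_ [k hk kh] _] := set_valP h; exists k.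
have hK (h : G) : cancel (set_val h) (inv h) by have [] := invP h.
have invK (h : G) : cancel (inv h) (set_val h) by have [] := invP h.
have uh (h : G) : unitary (set_val h : l2 -> l2) := set_valP h.
have uinv (h : G) : unitary (inv h).
  have /unitaryP[linh _ isoh] := uh h; apply/unitaryP; split.
  - by move=> c u v; apply: (can_inj (hK h)); rewrite linh !invK.
  - by exists (set_val h).
  - by move=> u; rewrite -isoh invK.
pose s (b : bool) (h : G) : l2 -> l2 := if b then set_val h else inv h.
have us b (h : G) : unitary (s b h) by case: b; [exact: uh|exact: uinv].
pose C (k : bool * nat * nat) : set (set G) := [set V | open V /\
  forall S T, V S -> V T -> l2_norm (s k.1.1 S (l2_delta R (e k.1.2)) - s k.1.1 T (l2_delta R (e k.1.2))) <= k.2.+1%:R^-1].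
have oball (u w : l2) (r : R) : 0 < r -> open [set h : G | l2_norm (set_val h u - w) < r].
  move=> r0; apply: (@open_comp _ _ (fun h : G => set_val h u) [set v | l2_norm (v - w) < r]).
    by move=> h _; exact: sub_ptws_eval_continuous.
  rewrite openE => v /= wv; apply/l2_nbhsP.
  exists (r - l2_norm (v - w)); first by rewrite subr_gt0.
  by move=> v' vv'; rewrite /=; apply: le_lt_trans (l2_dist_triangle v _ _) _; rewrite -ltrBrDr.
exists (bool * nat * nat)%type, C; split.
- by move=> k V [].
- move=> [[b n] k] g; rewrite /C /=; set d := l2_delta R (e n).
  have k0 : 0 < k.+1%:R^-1 / 2 :> R by rewrite divr_gt0.
  pose u := if b then d else inv g d.
  exists [set h : G | l2_norm (set_val h u - set_val g u) < k.+1%:R^-1 / 2]; last first.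
    by rewrite /= subrr l2_norm00.
  split; first exact: oball.
  move=> S T /= Su Tu.
  (* For inverses, h is applied to the difference: the distance from [inv h d] to [inv g d] is that
     from d to [set_val h (inv g d)], which evaluation at the single vector u controls. *)
  have dist (h : G) : l2_norm (s b h d - s b g d) = l2_norm (set_val h u - set_val g u).
    rewrite /s /u; case: (b) => //.
    by rewrite -(unitary_dist _ _ (uh h)) invK l2_normBC invK.
  apply: le_trans (l2_dist_triangle (s b g d) _ _) _.
  rewrite [leRHS]splitr; apply: lerD; last rewrite l2_normBC.
    by rewrite (dist S); exact: ltW Su.
  by rewrite (dist T); exact: ltW Tu.
move=> F FF FC.
have cau b u : l2_cauchy F (fun h => s b h u).
  have linb t : linear (s b t) by have /unitaryP[] := us b t.
  have isob t v : l2_norm (s b t v) = l2_norm v by have /unitaryP[] := us b t.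
  apply: l2_cauchy_isometries linb isob _ u => x r r0.
  have [n _ <-] := eX x I.
  have [V [oV VP] FV] := FC (b, n, Num.truncn r^-1); exists V => // S T VS VT.
  apply: le_trans (VP _ _ VS VT) _; rewrite /= invf_ple ?posrE//.
  exact/ltW/truncnS_gt.
have /choice[a aP] u := l2_complete FF (cau true u).
have /choice[b bP] u := l2_complete FF (cau false u).
have ua : unitary a.
  apply/unitaryP; split.
  - by apply: (@l2_cvg_linear _ F (s true)) => // t; have /unitaryP[] := us true t.
  - exists b.
      exact: (@l2_cvg_cancel _ F (s false) (s true)).
    exact: (@l2_cvg_cancel _ F (s true) (s false)).
  - by move=> u; apply: (@l2_cvg_norm _ F (s true ^~ u)) => // t; have /unitaryP[] := us true t.
exists (exist _ a (mem_set ua)); apply: sub_ptws_cvg => u N /l2_nbhsP[r r0 rN].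
have r2 : 0 < r / 2 by rewrite divr_gt0.
apply: filterS (aP u _ r2) => h /= hu; apply: rN; apply: le_lt_trans hu _.
by rewrite ltr_pdivrMr// ltr_pMr// ltr1n.
Qed.

End unitary_completeness.

(** * Ultrahomogeneous chains *)

Section chains.
Variables (d : Order.disp_t) (X : orderType d).
Local Open Scope order_scope.
Local Open Scope classical_set_scope.
Hypothesis uhX : ultrahomogeneous_chain X.

Lemma order_automorphism_lt (g : X -> X) : order_automorphism g -> {mono g : x y / x < y}.
Proof. by case=> _ mg; exact: leW_mono. Qed.

Lemma chain_extension (s : seq X) (phi : X -> X) :
  {in s &, {homo phi : x y / x < y}} ->
  exists2 g, order_automorphism g & {in s, g =1 phi}.
Proof.
move=> phi_lt; have [_ uh] := uhX.
pose t := sort <=%O (undup s).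
have st x : (x \in t) = (x \in s) by rewrite mem_sort mem_undup.
have sorted_t : sorted <%O t by rewrite sort_lt_sorted undup_uniq.
have sorted_phi : sorted <%O (map phi t).
  rewrite sorted_map; apply: (@sub_in_sorted _ (mem s) <%O) sorted_t.
    by move=> x y xs ys; exact: phi_lt.
  by apply/allP => x; rewrite st.
have [|g gA gt] := uh t (map phi t) _ sorted_t sorted_phi; first by rewrite size_map.
exists g => // x; rewrite -st => xt.
by move/eq_in_map: gt; apply.
Qed.

Lemma chain_three : exists p q r : X, p < q < r.
Proof.
have [iX _] := uhX; have [B _ B3] := infinite_set_fset 3 iX.
pose t := sort <=%O (B : seq X).
have st : size t = #|` B| by rewrite size_sort.
have: sorted <%O t by rewrite sort_lt_sorted fset_uniq.
move: st B3; case: t => [|p [|q [|r t]]] /=; try by move=> <-.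
by move=> _ _ /and3P[pq qr _]; exists p, q, r; rewrite pq qr.
Qed.

Lemma chain_dense (a b : X) : a < b -> exists c, a < c < b.
Proof.
move=> ab; have [p [q [r /andP[pq qr]]]] := chain_three.
have [|g gA gE] := @chain_extension [:: p; r] (fun x => if x == p then a else b).
  have rp : r == p = false by rewrite gt_eqF// (lt_trans pq).
  move=> x y; rewrite !inE => /orP[] /eqP -> /orP[] /eqP ->; rewrite ?eqxx ?ltxx ?rp//.
  by move=> rp'; have := lt_trans (lt_trans pq qr) rp'; rewrite ltxx.
exists (g q); have rp : r == p = false by rewrite gt_eqF// (lt_trans pq).
have ga : g p = a by rewrite gE ?inE eqxx.
have gb : g r = b by rewrite gE ?inE ?eqxx ?orbT// rp.
by rewrite -ga -gb !(order_automorphism_lt gA) pq.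
Qed.

Lemma chain_unbounded (a : X) : (exists b, a < b) /\ (exists b, b < a).
Proof.
have [p [q [r /andP[pq qr]]]] := chain_three.
have [|g gA gE] := @chain_extension [:: q] (fun=> a).
  by move=> x y; rewrite !inE => /eqP-> /eqP->; rewrite ltxx.
have ga : g q = a by rewrite gE ?inE.
by split; [exists (g r)|exists (g p)]; rewrite -ga (order_automorphism_lt gA).
Qed.

(** The interval between a and x is free of s; the floor c provides a even when no point of s lies
    below x. *)
Lemma chain_gap_left (s : seq X) (c x : X) : c < x ->
  exists2 a, c <= a < x & forall z, z \in s -> z < x -> z <= a.
Proof.
move=> cx; elim: s => [|y s [a /andP[ca ax] aP]]; first by exists c; rewrite ?lexx.
have [yx|xy] := ltP y x.
  exists (Order.max a y); first by rewrite le_max ca gt_max ax yx.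
  move=> z; rewrite in_cons le_max => /predU1P[->|zs zx]; first by rewrite lexx orbT.
  by rewrite aP.
exists a; rewrite ?ca// => z; rewrite in_cons => /predU1P[->|//]; last exact: aP.
by rewrite ltNge xy.
Qed.

Lemma chain_gap_right (s : seq X) (c x : X) : x < c ->
  exists2 b, x < b <= c & forall z, z \in s -> x < z -> b <= z.
Proof.
move=> xc; elim: s => [|y s [b /andP[xb bc] bP]]; first by exists c; rewrite ?lexx ?xc.
have [xy|yx] := ltP x y.
  exists (Order.min b y); first by rewrite ge_min bc lt_min xb xy.
  move=> z; rewrite in_cons ge_min => /predU1P[->|zs zx]; first by rewrite lexx orbT.
  by rewrite bP.
exists b; rewrite ?xb// => z; rewrite in_cons => /predU1P[->|//]; last exact: bP.
by rewrite ltNge yx.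
Qed.

Lemma infinite_itv (a b : X) : a < b -> infinite_set [set x | a < x < b].
Proof.
move=> ab fab.
have /finite_seqP[s sE] := fab.
have [c /andP[ac cb]] := chain_dense ab.
have [e /andP[ce eb] eP] := chain_gap_left s cb.
have [f /andP[ef fb]] := chain_dense eb.
have fs : f \in s.
  have : [set x | a < x < b] f by rewrite /= fb (lt_trans ac (le_lt_trans ce ef)).
  by rewrite sE.
by have := eP f fs fb; rewrite leNgt ef.
Qed.

Lemma chain_move (s : seq X) (x y : X) : x \notin s ->
  (forall z, z \in s -> (z < x) = (z < y)) -> y \notin s ->
  exists2 g, order_automorphism g & g x = y /\ {in s, g =1 id}.
Proof.
move=> xs xy ys; have xNz z : z \in s -> z == x = false by move=> zs; apply: contraNF xs => /eqP <-.
have yNz z : z \in s -> z == y = false by move=> zs; apply: contraNF ys => /eqP <-.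
have [|g gA gE] := @chain_extension (x :: s) (fun z => if z == x then y else z).
  move=> u v; rewrite !in_cons => /predU1P[->|us] /predU1P[->|vs]; rewrite ?ltxx ?eqxx ?(xNz _ us) ?(xNz _ vs)//.
    by move=> xv; rewrite lt_neqAle eq_sym yNz//= leNgt -xy// -leNgt ltW.
  by rewrite xy.
exists g => //; split; first by rewrite gE ?mem_head ?eqxx.
by move=> z zs; rewrite gE ?in_cons ?zs ?orbT// xNz.
Qed.

(** Some interval ending at x is free of s, and x can be moved to each of its points with s
    fixed. *)
Lemma chain_orbit_infinite (s : seq X) (x : X) : x \notin s ->
  infinite_set [set g x | g in [set g | order_automorphism g /\ {in s, g =1 id}]].
Proof.
move=> xs; have [_ [c cx]] := chain_unbounded x.
have [a /andP[_ ax] aP] := chain_gap_left s cx.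
apply: sub_infinite_set (infinite_itv ax) => y /andP[ay yx].
have [||g gA [gx gs]] := @chain_move s x y xs; last by exists g.
  move=> z zs; have [zx|xz] := ltP z x.
    by rewrite (le_lt_trans (aP _ zs zx) ay).
  by apply/esym/negbTE; rewrite -leNgt (le_trans (ltW yx)).
by apply/negP => /aP/(_ yx); rewrite leNgt ay.
Qed.

End chains.

(** * The order topology *)

Section chain_topology.
Variables (d : Order.disp_t) (X : orderType d).
Local Open Scope order_scope.
Local Open Scope classical_set_scope.
Hypothesis uhX : ultrahomogeneous_chain X.
Notation oX := (order_topology X).

Lemma chain_nbhsP (x : oX) (N : set oX) : nbhs x N <->
  exists a b : X, a < x < b /\ forall z, a < z < b -> N z.
Proof.
split; last first.
  move=> [a [b [/andP[ax xb] abN]]]; rewrite itv_nbhsE.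
  exists `]a, b[%O; first by split => //; rewrite in_itv /= ax xb.
  by move=> z /=; rewrite in_itv /=; exact: abN.
rewrite itv_nbhsE => -[[l r] [+ xlr] lrN].
have [[u xu] [v vx]] := chain_unbounded uhX x.
move: l r xlr lrN => [[] l|[]] [[] r|[]]; rewrite in_itv //= ?andbT ?andbF//.
- move=> /andP[lx xr] lrN _; exists l, r; rewrite lx xr; split => //; exact: lrN.
- move=> lx lrN _; exists l, u; rewrite lx xu; split => // z /andP[lz _].
  by apply: lrN; rewrite /= in_itv /= lz.
- move=> xr lrN _; exists v, r; rewrite xr vx; split => // z /andP[_ zr].
  by apply: lrN; rewrite /= in_itv.
- by move=> _ lrN _; exists v, u; rewrite vx xu; split => // z _; apply: lrN; rewrite /= in_itv.
Qed.

End chain_topology.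

(** * A uniformity showing that the order topology is completely regular *)

Section chain_uniformity.
Variables (d : Order.disp_t) (X : orderType d).
Local Open Scope order_scope.
Local Open Scope classical_set_scope.

Definition order_between (s t c : X) := (s <= c <= t) || (t <= c <= s).

(* The entourage of F relates s and t when the closed interval they span contains
   at most one point of F; inserting a point between any two points of F gives an
   entourage whose square is contained in this one. *)
Definition chain_entourage (F : seq X) : set (X * X) := [set p |
  {in F &, forall c e, order_between p.1 p.2 c -> order_between p.1 p.2 e -> c = e}].

Lemma order_between_split (s u t c : X) :
  order_between s t c -> order_between s u c || order_between u t c.
Proof.
rewrite /order_between => /orP[]/andP[h1 h2].
  by have [cu|/ltW uc] := leP c u; rewrite ?h1 ?h2 ?cu ?uc ?orbT.
by have [cu|/ltW uc] := leP c u; rewrite ?h1 ?h2 ?cu ?uc ?orbT.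
Qed.


Lemma order_between_refl s c : order_between s s c -> c = s.
Proof. by rewrite /order_between orbb => h; apply/eqP; rewrite eq_le andbC. Qed.

Lemma order_between_sym s t c : order_between s t c = order_between t s c.
Proof. by rewrite /order_between orbC. Qed.

Lemma order_between_convex s t c m e :
  order_between s t c -> order_between s t e -> c <= m <= e -> order_between s t m.
Proof.
rewrite /order_between => /orP[]/andP[h1 h2] /orP[]/andP[h3 h4] /andP[cm me].
- by rewrite (le_trans h1 cm) (le_trans me h4).
- have -> : m = s; last by rewrite lexx (le_trans h1 h2).
  by apply/eqP; rewrite eq_le (le_trans me h4) (le_trans h1 cm).
- have -> : m = t; last by rewrite lexx (le_trans h1 h2) orbT.
  by apply/eqP; rewrite eq_le (le_trans me h4) (le_trans h1 cm).
- by rewrite (le_trans h1 cm) (le_trans me h4) orbT.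
Qed.

Hypothesis denseX : forall a b : X, a < b -> exists c, a < c < b.

(** The alias carries the density hypothesis, on which the uniform structure declared below
    depends. *)
Definition chain_uniform : Type := let _ := denseX in X.

HB.instance Definition _ := Choice.on chain_uniform.

Let ent : set_system (chain_uniform * chain_uniform) :=
  filter_from [set: seq X] chain_entourage.

Let ent_filter : Filter ent.
Proof.
apply: filter_from_filter; first by exists [::].
move=> F F' _ _; exists (F ++ F') => // p FP; split => c e cF eF.
  by apply: FP; rewrite mem_cat ?cF ?eF.
by apply: FP; rewrite mem_cat ?cF ?eF orbT.
Qed.

Let ent_diagonal A : ent A -> diagonal `<=` A.
Proof.
move=> [F _ FA] [s t] /diagonalP <-; apply: FA => c e _ _ /=.
by move=> /order_between_refl -> /order_between_refl ->.
Qed.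

Let ent_inv A : ent A -> ent (A^-1)%relation.
Proof.
move=> [F _ FA]; exists F => // -[s t] FP; apply: FA => c e cF eF /=.
by rewrite order_between_sym => h1; rewrite order_between_sym => h2; exact: FP.
Qed.

Let ent_split A : ent A -> exists2 B, ent B & (B \; B)%relation `<=` A.
Proof.
move=> [F _ FA].
have /choice[mid midP] (p : X * X) : exists c, p.1 < p.2 -> p.1 < c < p.2.
  by have [/denseX[c]|_] := ltP p.1 p.2; [exists c|exists p.1].
pose F' := F ++ [seq mid (c, e) | c <- F, e <- F].
exists (chain_entourage F'); first by exists F'.
move=> [s t] [u /= su ut]; apply: FA => c e cF eF /= bc be.
wlog ce : c e cF eF bc be / c < e.
  move=> wl; have [ce|ec|//] := ltgtP c e; first exact: wl.
  by apply/esym; exact: wl.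
have /andP[cm me] := midP (c, e) ce.
have bm : order_between s t (mid (c, e)).
  by apply: order_between_convex bc be _; rewrite !ltW.
have cF' : c \in F' by rewrite mem_cat cF.
have eF' : e \in F' by rewrite mem_cat eF.
have mF' : mid (c, e) \in F' by rewrite mem_cat; apply/orP; right; apply/allpairsP; exists (c, e).
have ne (z w : X) : z < w -> z = w -> c = e by move=> zw zw'; rewrite zw' ltxx in zw.
(* Each of c, the inserted point and e lies between s and u or between u and t, so two of the three
   share a half. *)
have [] := (order_between_split u bc, order_between_split u bm).
have := order_between_split u be.
move=> /orP[]he /orP[]hc /orP[]hm.
- by apply: ne cm _; apply: su.
- by apply: ne ce _; apply: su.
- by apply: ne me _; apply: su.
- by apply: ne cm _; apply: ut.
- by apply: ne cm _; apply: su.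
- by apply: ne me _; apply: ut.
- by apply: ne ce _; apply: ut.
- by apply: ne cm _; apply: ut.
Qed.

HB.instance Definition _ := @isUniform.Build chain_uniform ent ent_filter
  ent_diagonal ent_inv ent_split.

Lemma chain_uniform_nbhs_ex (x : chain_uniform) (N : set chain_uniform) : nbhs x N ->
  exists F : seq X, forall t, chain_entourage F (x, t) -> N t.
Proof.
rewrite -nbhs_entourageE => -[E [F _ FE] EN]; exists F => t Ft.
by apply: EN; apply/xsectionP; exact: FE.
Qed.

End chain_uniformity.

Section chain_completely_regular.
Variables (R : realType) (d : Order.disp_t) (X : orderType d).
Local Open Scope order_scope.
Local Open Scope classical_set_scope.
Hypothesis uhX : ultrahomogeneous_chain X.

Lemma chain_completely_regular : completely_regular_space (order_topology X).
Proof.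
move=> x B clB nBx.
have : nbhs x (~` B) by apply: open_nbhs_nbhs; split => //; rewrite openC.
move=> /(chain_nbhsP uhX)[a [b [/andP[ax xb] abB]]].
pose T : uniformType := chain_uniform (chain_dense uhX).
(* If t is outside the interval from a to b, then x and one of a, b both lie between x and t, which
   the entourage of a, x, b forbids. This uniformity is coarser than the order topology, as the
   third goal requires. *)
exists (Uniform.class T), (chain_entourage [:: a; x; b]); split.
- by exists [:: a; x; b].
- apply/seteqP; split => // -[_ t] [[/= -> Bt] ent].
  apply: (abB t) => //; apply/andP; split.
    rewrite ltNge; apply/negP => ta; have : a = x; last by move=> axE; rewrite axE ltxx in ax.
    by apply: ent; rewrite ?inE ?eqxx ?orbT// /order_between /= ?lexx ?(ltW ax) ?ta ?(le_trans ta (ltW ax)) ?orbT.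
  rewrite ltNge; apply/negP => bt; have : b = x; last by move=> bxE; rewrite bxE ltxx in xb.
  by apply: ent; rewrite ?inE ?eqxx ?orbT// /order_between /= ?lexx ?(ltW xb) ?bt ?(le_trans (ltW xb) bt) ?orbT.
- move=> z N zN; have [F FN] := @chain_uniform_nbhs_ex _ _ (chain_dense uhX) z N zN; apply/(chain_nbhsP uhX).
  have [[u zu] [v vz]] := chain_unbounded uhX z.
  have [l /andP[_ lz] lP] := chain_gap_left F vz.
  have [r /andP[zr _] rP] := chain_gap_right F zu.
  exists l, r; rewrite lz zr; split => // t /andP[lt tr]; apply: FN => c e cF eF /=.
  have only w : w \in F -> order_between z t w -> w = z.
    move=> wF; have [wz|zw|//] := ltgtP w z.
      have wl := lP w wF wz; rewrite /order_between (leNgt z) wz /= => /andP[tw _].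
      by have := lt_le_trans lt (le_trans tw wl); rewrite ltxx.
    have rw := rP w wF zw; rewrite /order_between (leNgt w z) zw andbF orbF => /andP[_ wt].
    by have := lt_le_trans tr (le_trans rw wt); rewrite ltxx.
  by move=> /(only _ cF) -> /(only _ eF) ->.
Qed.

Lemma Aut_pointwise_compactification :
  exists (bG : topologicalType) (i : Aut_pointwise X -> bG), compactification i.
Proof.
have crX := chain_completely_regular.
exact: (@sub_ptws_compactification (order_topology X) (order_topology X) _ R crX order_hausdorff).
Qed.

End chain_completely_regular.

(** * Finite systems of interval constraints on automorphisms *)

Section Aut_pointwise_topology.
Variables (d : Order.disp_t) (X : orderType d).
Local Open Scope order_scope.
Local Open Scope classical_set_scope.
Hypothesis uhX : ultrahomogeneous_chain X.
Notation oX := (order_topology X).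
Notation G := (set_type (@order_automorphism d X : set {ptws oX -> oX})).

(* A triple (x, a, b) stands for the constraint [a < h x < b]. *)
Definition in_cell (p : seq (X * X * X)) (h : X -> X) : bool :=
  all (fun q => q.1.2 < h q.1.1 < q.2) p.

Lemma in_cellP p h : reflect (forall x a b, (x, a, b) \in p -> a < h x < b) (in_cell p h).
Proof.
apply: (iffP allP) => [hp x a b /hp//|hp [[x a] b] /hp//].
Qed.

Lemma in_cell_cat p q h : in_cell (p ++ q) h = in_cell p h && in_cell q h.
Proof. exact: all_cat. Qed.

Lemma itv_open_chain (x : oX) (a b : X) : open [set h : G | a < set_val h x < b].
Proof.
apply: (@open_comp _ _ (fun h : G => set_val h x) [set y | a < y < b]).
  by move=> h _; exact: sub_ptws_eval_continuous.
rewrite openE => y /= yab; apply/(chain_nbhsP uhX); by exists a, b.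
Qed.

Lemma cell_open p : open [set h : G | in_cell p (set_val h)].
Proof.
elim: p => [|[[x a] b] p ih]; first by rewrite (_ : [set _ | _] = setT); [exact: openT|apply/seteqP].
rewrite (_ : [set _ | _] = [set h : G | a < set_val h x < b] `&` [set h : G | in_cell p (set_val h)]).
  by apply: openI => //; exact: itv_open_chain.
by apply/seteqP; split => h; [move=> /andP[]|move=> [h1 h2]; apply/andP].
Qed.

Lemma cell_base (g : G) (U : set G) : open U -> U g ->
  exists p, in_cell p (set_val g) /\ forall h : G, in_cell p (set_val h) -> U h.
Proof.
move=> oU Ug; have [s [N [Ng NU]]] := sub_ptws_base oU Ug.
have /choice[ab abP] (x : X) : exists ab : X * X, ab.1 < set_val g x < ab.2 /\
    forall z, ab.1 < z < ab.2 -> N x z.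
  by have /(chain_nbhsP uhX)[a [b abN]] := Ng x; exists (a, b).
exists [seq (x, (ab x).1, (ab x).2) | x <- s]; split.
  by apply/allP => _ /mapP[x _ ->] /=; have [] := abP x.
move=> h /allP hs; apply: NU => x xs; have [_] := abP x; apply.
by apply: (hs (x, (ab x).1, (ab x).2)); apply/mapP; exists x.
Qed.

Lemma Aut_lt (g : G) : {mono (set_val g : X -> X) : x y / x < y}.
Proof. exact: (order_automorphism_lt (set_valP g)). Qed.

Lemma Aut_le (g : G) : {mono (set_val g : X -> X) : x y / x <= y}.
Proof. by have [_ +] := set_valP g. Qed.

Lemma Aut_surj (g : G) y : exists x, set_val g x = y.
Proof. by have [[k _ gk] _] := set_valP g; exists (k y); exact: gk. Qed.

Lemma Aut_extension (s : seq X) (phi : X -> X) :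
  {in s &, {homo phi : x y / x < y}} ->
  exists g : G, {in s, (set_val g : X -> X) =1 phi}.
Proof.
move=> /(chain_extension uhX)[g gA gs].
by exists (exist _ (g : {ptws oX -> oX}) (mem_set gA)).
Qed.

(* The constraints defining the sets U n involve a countable set C only. If the
   interval ]a, b[ misses C and a < x < y < b, then over U n the pair (h x, h y)
   takes all values c' < c in an interval, while compactness of H forces h x and
   h y to be separated by one of finitely many points. *)
Lemma Aut_pointwise_not_shrinks : ~ separable oX -> ~ shrinks_to_compact G.
Proof.
move=> nsX [H [U [cH UP HU]]].
have /choice[p pP] n : exists p : G * seq (X * X * X), in_cell p.2 (set_val p.1) /\
    forall h : G, in_cell p.2 (set_val h) -> U n h.
  have [oU [g Ug]] := UP n; have [q [qg qU]] := cell_base oU Ug.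
  by exists (g, q).
pose C : set oX := \bigcup_n [set` [seq q.1.1 | q <- (p n).2]].
have cC : countable C.
  by apply: bigcup_countable => // n _; exact: finite_set_countable.
(* Otherwise the countable set C would be dense. *)
have [x [a [b [/andP[ax xb] abC]]]] : exists x a b : X, a < x < b /\ forall z, a < z < b -> ~ C z.
  apply: contrapT => h; apply: nsX; exists C => // O [x Ox] oO.
  apply: contrapT => OC; apply: h.
  have /(chain_nbhsP uhX)[a [b [axb abO]]] : nbhs x O by apply: open_nbhs_nbhs.
  by exists x, a, b; split => // z zab Cz; apply: OC; exists z; split => //; exact: abO.
have [y /andP[xy yb]] := chain_dense uhX xb.
pose P (B : set G) := exists ms : seq X, forall h, B h ->
  exists2 m, m \in ms & set_val h x < m < set_val h y.
have [V [oV HV [ms msV]]] : exists V : set G, [/\ open V, H `<=` V & P V].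
  pose Q (B : set G) := exists V : set G, [/\ open V, B `<=` V & P V].
  apply: (@compact_property _ _ Q) => //.
  - by exists set0; split => //; [exact: open0|exists [::]].
  - move=> B B' [V [oV BV [s sV]]] [V' [oV' BV' [s' sV']]].
    exists (V `|` V'); split; [exact: openU|exact: setUSS|].
    exists (s ++ s') => h [/sV|/sV'] [m ms hm]; exists m => //; rewrite mem_cat ms ?orbT//.
  - by move=> B B' BB' [V [oV BV VP]]; exists V; split => //; exact: subset_trans BV.
  - move=> g Hg; have /(chain_dense uhX)[m /andP[gm mg]] : set_val g x < set_val g y by rewrite Aut_lt.
    have [[u _] [v vx]] := chain_unbounded uhX (set_val g x).
    have [[u' yu'] _] := chain_unbounded uhX (set_val g y).
    pose W := [set h : G | in_cell [:: (x, v, m); (y, m, u')] (set_val h)].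
    have oW : open W by exact: cell_open.
    have Wg : W g by rewrite /W /= vx gm mg yu'.
    exists W; first by apply: open_nbhs_nbhs.
    exists W; split => //; exists [:: m] => h /and3P[/andP[_ /= hm] /andP[/= mh _] _].
    by exists m; rewrite ?inE ?hm.
have [n UV] := HU V oV HV.
have [pn pU] := pP n; set g := (p n).1 in pn *; set q := (p n).2 in pn pU *.
have [c /andP[gxc cgy]] : exists c, set_val g x < c < set_val g y.
  by apply: (chain_dense uhX); rewrite Aut_lt.
(* No point of [ms] lies strictly between l and c, so an h with h x = l' and h y = c is separated by
   none of them. *)
have [l /andP[xl lc] lP] := chain_gap_left ms gxc.
have [l' /andP[ll' l'c]] := chain_dense uhX lc.
pose F := [seq t.1.1 | t <- q].
have FP z : z \in F -> ~ (a < z < b) by move=> zF zab; apply: (abC z zab); exists n.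
pose phi z := if z == x then l' else if z == y then c else set_val g z.
have gl'  : set_val g a < l' by rewrite (lt_trans _ (le_lt_trans xl ll'))// Aut_lt.
have cgb : c < set_val g b by rewrite (lt_trans cgy)// Aut_lt.
have xF : x \notin F by apply/negP => /FP; apply; rewrite ax xb.
have yF : y \notin F by apply/negP => /FP; apply; rewrite yb (lt_trans ax xy).
have Fne z : z \in F -> (z == x = false) * (z == y = false).
  by move=> zF; split; apply/negP => /eqP zz; [move: xF|move: yF]; rewrite -zz zF.
have Fout z : z \in F -> z <= a \/ b <= z.
  move=> /FP zab; have [az|] := ltP a z; [right|by left].
  by rewrite leNgt; apply/negP => zb; apply: zab; rewrite az zb.
have yx : y == x = false by rewrite gt_eqF.
have [|h hF] := @Aut_extension (x :: y :: F) phi.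
  have lo z : z \in F -> z < b -> set_val g z < l'.
    move=> /Fout[za _|bz]; last by rewrite ltNge bz.
    by rewrite (le_lt_trans _ gl')// Aut_le.
  have hi z : z \in F -> a < z -> c < set_val g z.
    move=> /Fout[za|bz _]; first by rewrite ltNge za.
    by rewrite (lt_le_trans cgb)// Aut_le.
  move=> u v; rewrite !in_cons /phi => /or3P[/eqP->|/eqP->|uF] /or3P[/eqP->|/eqP->|vF];
    rewrite ?ltxx ?eqxx ?yx ?(Fne _ uF) ?(Fne _ vF)// ?Aut_lt//.
  - by move=> xv; rewrite (lt_trans l'c)// hi// (lt_trans ax).
  - by move=> yx'; have := lt_trans xy yx'; rewrite ltxx.
  - by move=> yv; rewrite hi// (lt_trans (lt_trans ax xy)).
  - by move=> ux; rewrite lo// (lt_trans ux).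
  - by move=> uy; rewrite (lt_trans (lo _ uF _))// (lt_trans uy).
have [|m mms /andP[hm mh]] := msV h.
  apply: UV; apply: pU; apply/in_cellP => z a' b' zq.
  have zF : z \in F by apply/mapP; exists (z, a', b').
  rewrite hF ?in_cons ?zF ?orbT// /phi !Fne//.
  exact: (in_cellP _ _ pn).
move: hm mh; rewrite !hF ?inE ?eqxx ?orbT// /phi eqxx yx eqxx => l'm mc.
by have := lP m mms mc; rewrite leNgt (lt_trans ll' l'm).
Qed.


Lemma chain_separable_enum : separable oX ->
  exists e : nat -> X, forall a b : X, a < b -> exists n, a < e n < b.
Proof.
move=> [D cD dD]; have [p [_ [_ _]]] := chain_three uhX.
have [e De _] := @countable_range X p D cD.
exists e => a b ab; have [c acb] := chain_dense uhX ab.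
have [||z [/= zab /De[n _ nz]]] := dD [set z | a < z < b]; last by exists n; rewrite nz.
- by exists c.
- rewrite openE => y /= yab; apply/(chain_nbhsP uhX); by exists a, b.
Qed.

(** By monotonicity a constraint at x follows from constraints at two points of e on either side of
    x, and the bounds can be taken in e as well. *)
Lemma Aut_pointwise_second_countable : separable oX ->
  exists2 B : nat -> set G, (forall n, open (B n)) &
    forall U g, open U -> U g -> exists2 n, B n g & B n `<=` U.
Proof.
move=> /chain_separable_enum[e eP].
pose f (q : nat * nat * nat) := (e q.1.1, e q.1.2, e q.2).
pose B n := if @choice.unpickle (seq (nat * nat * nat)) n is Some p
  then [set h : G | in_cell (map f p) (set_val h)] else set0.
exists B => [n|U g oU Ug]; first by rewrite /B; case: choice.unpickle => [p|]; [exact: cell_open|exact: open0].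
have [p [pg pU]] := cell_base oU Ug.
suff [p' [p'g p'p]] : exists p', in_cell (map f p') (set_val g) /\
    forall h : G, in_cell (map f p') (set_val h) -> in_cell p (set_val h).
  exists (choice.pickle p'); first by rewrite /B choice.pickleK.
  by rewrite /B choice.pickleK => h /p'p /pU.
elim: p pg {pU} => [_|[[x a] b] p ih /= /andP[/andP[agx gxb] /ih[p' [p'g p'p]]]]; first by exists [::].
have [k gk] := Aut_surj g a; have [l gl] := Aut_surj g b.
have kx : k < x by rewrite -(Aut_lt g) gk.
have xl : x < l by rewrite -(Aut_lt g) gl.
have [n1 /andP[kn1 n1x]] := eP _ _ kx; have [n2 /andP[xn2 n2l]] := eP _ _ xl.
have [m1 /andP[am1 m1g]] : exists m, a < e m < set_val g (e n1) by apply: eP; rewrite -gk Aut_lt.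
have [m2 /andP[gm2 m2b]] : exists m, set_val g (e n2) < e m < b by apply: eP; rewrite -gl Aut_lt.
have g12 : set_val g (e n1) < set_val g (e n2) by rewrite Aut_lt (lt_trans n1x).
exists [:: (n1, m1, m2), (n2, m1, m2) & p']; split.
  by rewrite /= p'g m1g gm2 (lt_trans m1g g12) (lt_trans g12 gm2).
move=> h /= /and3P[/andP[h1 h2] /andP[h3 h4] /p'p ->].
rewrite andbT (lt_trans (lt_trans am1 h1)) ?Aut_lt//=.
by rewrite (lt_trans _ (lt_trans h4 m2b))// Aut_lt.
Qed.

(** The downward closure L of A and its complement form a cut; an end point of either class at the
    cut is the supremum. *)
Lemma chain_sup : continuously_dense X -> forall A : set X, A !=set0 ->
  (exists b, ubound A b) -> exists s, ubound A s /\ forall b, ubound A b -> s <= b.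
Proof.
move=> cdX A [a0 Aa0] [b0 Ab0].
pose L := [set x | exists2 a, A a & x <= a].
have [[m [a Aa ma] mL]|nL] := pselect (has_greatest L).
  exists m; split => [x Ax|b Ab]; first by apply: mL; exists x.
  exact: le_trans ma (Ab _ Aa).
have NL b : (~` L) b <-> forall a, A a -> a < b.
  split => [nb a Aa|h [a Aa ba]]; first by rewrite ltNge; apply/negP => ba; apply: nb; exists a.
  by have := h a Aa; rewrite ltNge ba.
have ubN b : ubound A b -> (~` L) b.
  move=> Ab [a Aa ba]; apply: nL; exists b; first by exists a.
  by move=> x [a' Aa' xa']; exact: le_trans xa' (Ab _ Aa').
have [[m Lm mL]|nG] := pselect (has_least (~` L)).
  exists m; split => [x Ax|b /ubN]; last exact: mL.
  by apply: ltW; apply: (NL m).1.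
have [_ []] := cdX L (~` L); split => //; split.
- by exists a0, a0.
- by exists b0; exact: ubN.
- by rewrite setUv.
- move=> x y [a Aa xa] /NL/(_ a Aa); exact: le_lt_trans.
Qed.

End Aut_pointwise_topology.

Section Aut_pointwise_complete.
Variables (d : Order.disp_t) (X : orderType d).
Local Open Scope order_scope.
Local Open Scope classical_set_scope.
Hypothesis uhX : ultrahomogeneous_chain X.
Notation oX := (order_topology X).
Notation G := (set_type (@order_automorphism d X : set {ptws oX -> oX})).

(* The first kind of covers makes the limit of a filter strictly increasing, the
   second kind makes its range dense. *)
Lemma Aut_pointwise_complete_cover : continuously_dense X -> separable oX ->
  complete_cover_family G.
Proof.
move=> cdX /(chain_separable_enum uhX)[e eP].
have dX := chain_dense uhX.
pose C (k : bool * nat * nat) : set (set G) := [set V | open V /\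
  (e k.1.2 < e k.2 -> if k.1.1
     then exists m m', m < m' /\ forall h : G, V h -> set_val h (e k.1.2) < m /\ m' < set_val h (e k.2)
     else exists x, forall h : G, V h -> e k.1.2 < set_val h x < e k.2)].
exists (bool * nat * nat)%type, C; split.
- by move=> k V [].
- move=> [[b i] j] g; rewrite /C /=; have [ij|ji] := ltP (e i) (e j); last first.
    by exists setT => //; split => //; exact: openT.
  case: b.
    have /dX[m /andP[im mj]] : set_val g (e i) < set_val g (e j) by rewrite Aut_lt.
    have [m' /andP[mm' m'j]] := dX _ _ mj.
    have [[u ju] _] := chain_unbounded uhX (set_val g (e j)).
    have [_ [v vi]] := chain_unbounded uhX (set_val g (e i)).
    exists [set h : G | in_cell [:: (e i, v, m); (e j, m', u)] (set_val h)]; last first.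
      by rewrite /= vi im m'j ju.
    split; first exact: cell_open.
    move=> _; exists m, m'; split => // h /=.
    by move=> /and3P[/andP[_ ->] /andP[-> _] _].
  have [x gx] : exists x, e i < set_val g x < e j.
    by have [c ijc] := dX _ _ ij; have [x gx] := Aut_surj g c; exists x; rewrite gx.
  exists [set h : G | e i < set_val h x < e j]; last exact: gx.
  by split; [exact: itv_open_chain|exists x].
move=> F FF FC.
have FS u v : u < v -> exists m m', m < m' /\ F [set h : G | set_val h u < m /\ m' < set_val h v].
  move=> uv; have [i /andP[ui iv]] := eP _ _ uv; have [j /andP[ij jv]] := eP _ _ iv.
  have [V [_ /(_ ij)[m [m' [mm' VP]]]] FV] := FC (true, i, j).
  exists m, m'; split => //; apply: filterS (FV) => h /VP[hi hj].
  by split; [apply: lt_trans hi; rewrite Aut_lt|apply: (lt_trans hj); rewrite Aut_lt].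
have FT u v : u < v -> exists x, F [set h : G | u < set_val h x < v].
  move=> uv; have [i /andP[ui iv]] := eP _ _ uv; have [j /andP[ij jv]] := eP _ _ iv.
  have [V [_ /(_ ij)[x VP]] FV] := FC (false, i, j).
  exists x; apply: filterS (FV) => h /VP/andP[hi hj] /=.
  by rewrite (lt_trans ui hi) (lt_trans hj jv).
have bound x m y : F [set h : G | set_val h x < m] -> F [set h : G | y < set_val h x] -> y < m.
  move=> F1 F2; have [h [/= h1 h2]] := filter_ex (filterI F1 F2).
  exact: lt_trans h1.
(* The limit at x is the supremum of the points that lie below h x along F. *)
have /choice[g gP] (x : X) : exists s, ubound [set y | F [set h : G | y < set_val h x]] s /\
    forall b, ubound [set y | F [set h : G | y < set_val h x]] b -> s <= b.
  have [[u xu] [v vx]] := chain_unbounded uhX x.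
  apply: (chain_sup cdX).
    by have [m [m' [_ Fm]]] := FS _ _ vx; exists m'; apply: filterS Fm => h [].
  have [m [m' [_ Fm]]] := FS _ _ xu; exists m => y Fy; apply/ltW; apply: bound Fy.
  by apply: filterS Fm => h [].
have g_lt x y : y < g x -> F [set h : G | y < set_val h x].
  move=> yg; apply: contrapT => nF; have := (gP x).2 y _; rewrite leNgt yg => /(_ _)/negP; apply => //.
  move=> z Fz; rewrite leNgt; apply/negP => yz; apply: nF.
  by apply: filterS Fz => h /=; exact: lt_trans.
have g_ge x y : F [set h : G | y < set_val h x] -> y <= g x by move=> Fy; exact: (gP x).1.
have g_le x m : F [set h : G | set_val h x < m] -> g x <= m.
  by move=> Fm; apply: (gP x).2 => y Fy; apply/ltW; exact: bound Fm Fy.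
have g_gt x y : g x < y -> F [set h : G | set_val h x < y].
  move=> gy; have [c /andP[gc cy]] := dX _ _ gy; have [z Fz] := FT _ _ cy.
  have [xz|zx] := leP x z.
    by apply: filterS Fz => h /andP[_]; apply: le_lt_trans; rewrite Aut_le.
  have /g_ge : F [set h : G | c < set_val h x].
    by apply: filterS Fz => h /andP[ch _]; apply: (lt_trans ch); rewrite Aut_lt.
  by rewrite leNgt gc.
have g_homo : {homo g : u v / u < v}.
  move=> u v /FS[m [m' [mm' Fm]]].
  apply: (le_lt_trans (g_le u m _)); first by apply: filterS Fm => h [].
  apply: (lt_le_trans mm'); apply: g_ge; by apply: filterS Fm => h [].
have g_mono := le_mono g_homo.
have g_mid u v : u < v -> exists x, u <= g x <= v.
  move=> /FT[x Fx]; exists x; apply/andP; split.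
    by apply: g_ge; apply: filterS Fx => h /andP[].
  by apply: g_le; apply: filterS Fx => h /andP[].
have g_surj y : exists x, g x = y.
  have [[u yu] [v vy]] := chain_unbounded uhX y.
  (* If g s differed from y, [g_mid] would give a point whose value lies between them and differs
     from g s, against the choice of s. *)
  have [s [sub slub]] : exists s, ubound [set x | g x <= y] s /\
      forall b, ubound [set x | g x <= y] b -> s <= b.
    apply: (chain_sup cdX).
      by have [x /andP[_ gx]] := g_mid _ _ vy; exists x.
    have [c /andP[yc cu]] := dX _ _ yu; have [x /andP[cg _]] := g_mid _ _ cu.
    by exists x => z gz; rewrite -g_mono (le_trans gz)// (le_trans (ltW yc)).
  exists s; apply/eqP; rewrite eq_le; apply/andP; split; rewrite leNgt; apply/negP.
    move=> yg; have [c /andP[yc cg]] := dX _ _ yg; have [z /andP[yz zc]] := g_mid _ _ yc.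
    have : s <= z by apply: slub => x gx; rewrite -g_mono (le_trans gx yz).
    by rewrite -g_mono leNgt (le_lt_trans zc cg).
  move=> gy; have [c /andP[gc cy]] := dX _ _ gy; have [z /andP[cz zy]] := g_mid _ _ cy.
  by have := sub z zy; rewrite -g_mono leNgt (lt_le_trans gc cz).
have gA : order_automorphism g.
  split => //; have /choice[k kP] := g_surj; exists k => // x.
  by apply: (inc_inj g_mono); rewrite kP.
exists (exist _ (g : {ptws oX -> oX}) (mem_set gA)); apply: sub_ptws_cvg => x N.
move=> /(chain_nbhsP uhX)[a [b [/andP[agx gxb] abN]]].
apply: filterS2 (g_lt _ _ agx) (g_gt _ _ gxb) => h /= h1 h2.
by apply: abN; rewrite h1 h2.
Qed.

End Aut_pointwise_complete.

(** * Chains with a gap *)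

Section gap_isomorphism.
Variables (d : Order.disp_t) (X : orderType d).
Local Open Scope order_scope.
Local Open Scope classical_set_scope.
Hypothesis uhX : ultrahomogeneous_chain X.

(** The relation r is < or >, which serves both sides of x0 and both sides of the gap. Each term
    passes the previous one and also the current [e n] when that lies in L. *)
Lemma cofinal_sequence (r : X -> X -> Prop) (L : set X) (e : nat -> X) :
  L !=set0 -> (forall x y, L x -> L y -> exists z, [/\ L z, r x z & r y z]) ->
  (forall x, L x -> exists n, L (e n) /\ r x (e n)) ->
  (forall x y z, r x y -> r y z -> r x z) ->
  exists s : nat -> X, [/\ forall k, L (s k), forall k, r (s k) (s k.+1) &
    forall x, L x -> exists k, r x (s k)].
Proof.
move=> [x0 Lx0] dirL eL trr.
have /choice[f fP] (p : nat * X) : exists z, L p.2 ->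
    [/\ L z, r p.2 z & L (e p.1) -> r (e p.1) z].
  have [Lp|] := pselect (L p.2); last by exists x0.
  have [Le|nLe] := pselect (L (e p.1)).
    by have [z [Lz h1 h2]] := dirL _ _ Lp Le; exists z.
  by have [z [Lz h1 h2]] := dirL _ _ Lp Lp; exists z.
pose s := fix s n := if n is m.+1 then f (m, s m) else x0.
have Ls k : L (s k) by elim: k => //= k /(fP (k, s k))[].
exists s; split => // [k|x Lx]; first by have [] := fP (k, s k) (Ls k).
have [n [Len xn]] := eL x Lx; exists n.+1.
by have [_ _ /(_ Len)] := fP (n, s n) (Ls n); exact: trr.
Qed.

(* Removing a point and removing nothing give isomorphic chains: x0 is matched
   with the gap (A, B), and phi agrees with an automorphism on each of the
   intervals between consecutive terms of sequences converging to x0 and to the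
   gap. *)
Lemma gap_iso (x0 : X) (A B : set X) : separable (order_topology X) -> proper_gap A B ->
  exists phi : X -> X,
    (forall x y, x != x0 -> y != x0 -> x < y -> phi x < phi y) /\
    (forall y, exists2 x, x != x0 & phi x = y).
Proof.
move=> /(chain_separable_enum uhX)[e eP] [[A0 B0 AB ltAB] nA nB].
have dX := chain_dense uhX.
have [[v0 x0v] [u0 ux0]] := chain_unbounded uhX x0.
have [x [xx0 xS xcof]] : exists s : nat -> X, [/\ forall k, s k < x0,
    forall k, s k < s k.+1 & forall y, y < x0 -> exists k, y < s k].
  apply: (@cofinal_sequence (fun a b => a < b) [set y | y < x0] e).
  - by exists u0.
  - move=> a b /= a0 b0; have /dX[c /andP[mc c0]] : Order.max a b < x0 by rewrite gt_max a0 b0.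
    by move: mc; rewrite gt_max => /andP[ac bc]; exists c.
  - by move=> a /= /eP[n /andP[an n0]]; exists n.
  - by move=> a b c; exact: lt_trans.
have [x' [xx'0 xS' xcof']] : exists s : nat -> X, [/\ forall k, x0 < s k,
    forall k, s k > s k.+1 & forall y, x0 < y -> exists k, y > s k].
  apply: (@cofinal_sequence (fun a b => a > b) [set y | y > x0] e).
  - by exists v0.
  - move=> a b /= a0 b0; have /dX[c /andP[c0 cm]] : x0 < Order.min a b by rewrite lt_min a0 b0.
    by move: cm; rewrite lt_min => /andP[ac bc]; exists c.
  - by move=> a /= /eP[n /andP[an n0]]; exists n.
  - by move=> a b c ab bc; exact: lt_trans bc ab.
have Alow a b : A b -> a < b -> A a.
  move=> Ab ab; have : [set: X] a by []; rewrite -AB => -[//|Ba].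
  by have := ltAB _ _ Ab Ba; rewrite ltNge (ltW ab).
have Bup a b : B a -> a < b -> B b.
  move=> Ba ab; have : [set: X] b by []; rewrite -AB => -[Ab|//].
  by have := ltAB _ _ Ab Ba; rewrite ltNge (ltW ab).
have Aup a : A a -> exists2 b, A b & a < b.
  move=> Aa; apply: contrapT => h; apply: nA; exists a => // b Ab.
  by rewrite leNgt; apply/negP => ab; apply: h; exists b.
have Blow a : B a -> exists2 b, B b & b < a.
  move=> Ba; apply: contrapT => h; apply: nB; exists a => // b Bb.
  by rewrite leNgt; apply/negP => ab; apply: h; exists b.
have [p [Ap pS pcof]] : exists s : nat -> X, [/\ forall k, A (s k),
    forall k, s k < s k.+1 & forall y, A y -> exists k, y < s k].
  apply: (@cofinal_sequence (fun a b => a < b) A e) => //.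
  - move=> a b Aa Ab; have /Aup[c Ac] : A (Order.max a b) by have [] := leP a b.
    by rewrite gt_max => /andP[ac bc]; exists c.
  - move=> a /Aup[b Ab] /eP[n /andP[an nb]]; exists n; split => //; exact: Alow nb.
  - by move=> a b c; exact: lt_trans.
have [q [Bq qS qcof]] : exists s : nat -> X, [/\ forall k, B (s k),
    forall k, s k > s k.+1 & forall y, B y -> exists k, y > s k].
  apply: (@cofinal_sequence (fun a b => a > b) B e) => //.
  - move=> a b Ba Bb; have /Blow[c Bc] : B (Order.min a b) by have [] := leP a b.
    by rewrite lt_min => /andP[ac bc]; exists c.
  - move=> a /Blow[b Bb] /eP[n /andP[bn na]]; exists n; split => //; exact: Bup bn.
  - by move=> a b c ab bc; exact: lt_trans bc ab.
have inc (s : nat -> X) : (forall k, s k < s k.+1) -> forall k l, (k <= l)%N -> s k <= s l.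
  by move=> sS k l /subnK <-; elim: (l - k)%N => // j ih; rewrite addSn (le_trans ih)// ltW.
have dec (s : nat -> X) : (forall k, s k > s k.+1) -> forall k l, (k <= l)%N -> s k >= s l.
  by move=> sS k l /subnK <-; elim: (l - k)%N => // j ih; rewrite addSn (le_trans _ ih)// ltW.
have pq k l : p k < q l by exact: ltAB.
have xx' k l : x k < x' l by exact: lt_trans (xx0 k) (xx'0 l).
(* One automorphism serves the k-th interval on both sides. For k = 0 the predecessor is 0 again,
   and the automorphism is used on the two outer rays. *)
have /choice[sg sgP] (k : nat) : exists g, [/\ order_automorphism g,
    g (x k.-1) = p k.-1, g (x k) = p k, g (x' k) = q k & g (x' k.-1) = q k.-1].
  pose f z := if z == x k.-1 then p k.-1 else if z == x k then p k else
    if z == x' k then q k else q k.-1.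
  have fx1 : f (x k.-1) = p k.-1 by rewrite /f eqxx.
  have fx : f (x k) = p k by rewrite /f eqxx; case: k {f fx1} => [|k] /=; rewrite ?eqxx// gt_eqF.
  have ex'x i j : (x' i == x j) = false by rewrite gt_eqF.
  have fx' : f (x' k) = q k by rewrite /f !ex'x eqxx.
  have fx'1 : f (x' k.-1) = q k.-1.
    by rewrite /f !ex'x; case: k {f fx1 fx fx'} => [|k] /=; rewrite ?eqxx// gt_eqF.
  have k1 := leq_pred k.
  have [|g gA gf] := @chain_extension _ _ uhX [:: x k.-1; x k; x' k; x' k.-1] f.
    have px : x k.-1 < x k -> p k.-1 < p k by case: (k) => [|j] /=; rewrite ?ltxx.
    have px' : x' k < x' k.-1 -> q k < q k.-1 by case: (k) => [|j] /=; rewrite ?ltxx.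
    have nx : (x k < x k.-1) = false by apply/negbTE; rewrite -leNgt; exact: inc.
    have nx' : (x' k.-1 < x' k) = false by apply/negbTE; rewrite -leNgt; exact: dec.
    have nxx' i j : (x' i < x j) = false by apply/negbTE; rewrite -leNgt ltW.
    move=> u v; rewrite !inE => /or4P[]/eqP-> /or4P[]/eqP->;
      by rewrite ?ltxx ?nx ?nx' ?nxx' ?fx1 ?fx ?fx' ?fx'1.
  by exists g; split; rewrite // gf ?fx1 ?fx ?fx' ?fx'1// !inE eqxx ?orbT.
have sg_lt k := order_automorphism_lt (let: And5 h _ _ _ _ := sgP k in h).
have sg_le k : {mono sg k : y z / y <= z} by have [[]] := sgP k.
have sg_surj k y : exists z, sg k z = y.
  by have [[[h _ kh] _] _ _ _ _] := sgP k; exists (h y); exact: kh.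
have /choice[N NP] y : exists k, y != x0 ->
    [/\ y < x0 -> y <= x k /\ (k != 0%N -> x k.-1 < y) &
        x0 < y -> x' k <= y /\ (k != 0%N -> y < x' k.-1)].
  have [->|yx0] := eqVneq y x0; first by exists 0%N.
  have [yx|xy|yE] := ltgtP y x0; last by rewrite yE eqxx in yx0.
    have ex : exists k, y <= x k by have [k yk] := xcof _ yx; exists k; exact: ltW.
    exists (ex_minn ex); case: ex_minnP => k yk kmin _; split => // _; split => // k0.
    by rewrite ltNge; apply/negP => /kmin; rewrite leqNgt ltn_predL lt0n k0.
  have ex : exists k, x' k <= y by have [k yk] := xcof' _ xy; exists k; exact: ltW.
  exists (ex_minn ex); case: ex_minnP => k yk kmin _; split => // _; split => // k0.
  by rewrite ltNge; apply/negP => /kmin; rewrite leqNgt ltn_predL lt0n k0.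
have NleL y z k l : y <= z -> (k != 0%N -> x k.-1 < y) -> z <= x l -> (k <= l)%N.
  move=> yz xy zx; rewrite leqNgt; apply/negP => lk.
  have lk1 : (l <= k.-1)%N by case: (k) lk.
  have := lt_le_trans (xy (lt0n_neq0 (leq_ltn_trans (leq0n _) lk))) (le_trans yz zx).
  by rewrite ltNge inc.
have NleR y z k l : z <= y -> (k != 0%N -> y < x' k.-1) -> x' l <= z -> (k <= l)%N.
  move=> yz xy zx; rewrite leqNgt; apply/negP => lk.
  have lk1 : (l <= k.-1)%N by case: (k) lk.
  have := le_lt_trans (le_trans zx yz) (xy (lt0n_neq0 (leq_ltn_trans (leq0n _) lk))).
  by rewrite ltNge dec.
have NL y : y < x0 -> y <= x (N y) /\ (N y != 0%N -> x (N y).-1 < y).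
  by move=> yx; have [h _] := NP y (negbT (lt_eqF yx)); exact: h.
have NR y : x0 < y -> x' (N y) <= y /\ (N y != 0%N -> y < x' (N y).-1).
  by move=> yx; have [_ h] := NP y (negbT (gt_eqF yx)); exact: h.
exists (fun y => sg (N y) y).
have low y : y < x0 -> sg (N y) y <= p (N y) /\ (N y != 0%N -> p (N y).-1 < sg (N y) y).
  move=> /NL[yN Ny].
  have [_ s1 s2 _ _] := sgP (N y); split; first by rewrite -s2 sg_le.
  by move=> /Ny; rewrite -s1 sg_lt.
have upp y : x0 < y -> q (N y) <= sg (N y) y /\ (N y != 0%N -> sg (N y) y < q (N y).-1).
  move=> /NR[yN Ny].
  have [_ _ _ s2 s1] := sgP (N y); split; first by rewrite -s2 sg_le.
  by move=> /Ny; rewrite -s1 sg_lt.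
split.
- move=> u v un vn uv; have [ux|xu|uE] := ltgtP u x0; last by rewrite uE eqxx in un.
    have [up _] := low _ ux.
    have [vx|xv|vE] := ltgtP v x0; last by rewrite vE eqxx in vn.
      have [uN Nu] := NL _ ux; have [vN _] := NL _ vx; have [_ vp] := low _ vx.
      have := NleL _ _ _ _ (ltW uv) Nu vN; rewrite leq_eqVlt => /predU1P[->|kl]; first by rewrite sg_lt.
      apply: le_lt_trans (vp (lt0n_neq0 (leq_ltn_trans (leq0n _) kl))); apply: le_trans up _.
      by apply: inc => //; case: (N v) kl.
    by have [vq _] := upp _ xv; exact: le_lt_trans up (lt_le_trans (pq _ _) vq).
  have xv := lt_trans xu uv; have [vq _] := upp _ xv; have [_ uq] := upp _ xu.
  have [vN Nv] := NR _ xv; have [uN _] := NR _ xu.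
  have := NleR _ _ _ _ (ltW uv) Nv uN; rewrite leq_eqVlt => /predU1P[<-|kl]; first by rewrite sg_lt.
  apply: lt_le_trans (uq (lt0n_neq0 (leq_ltn_trans (leq0n _) kl))) _; apply: le_trans vq.
  by apply: dec => //; case: (N u) kl.
- move=> y; have : [set: X] y by []; rewrite -AB => -[Ay|By].
    (* The preimage of y under the automorphism of its own piece lies in the piece of the same
       index, so [N u = k]. *)
    have ex : exists k, y <= p k by have [k yk] := pcof _ Ay; exists k; exact: ltW.
    have [k yk kmin] := ex_minnP ex; have [u uy] := sg_surj k y; have [_ s1 s2 _ _] := sgP k.
    have uk : u <= x k by rewrite -(sg_le k) uy s2.
    have ku : k != 0%N -> x k.-1 < u.
      move=> k0; rewrite -(sg_lt k) uy s1 ltNge; apply/negP => /kmin.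
      by rewrite leqNgt ltn_predL lt0n k0.
    have ux : u < x0 := le_lt_trans uk (xx0 k).
    exists u; first by rewrite lt_eqF.
    have [uN Nu] := NL _ ux.
    by have -> : N u = k by apply/eqP; rewrite eqn_leq (NleL _ _ _ _ (lexx _) Nu uk) (NleL _ _ _ _ (lexx _) ku uN).
  have ex : exists k, q k <= y by have [k yk] := qcof _ By; exists k; exact: ltW.
  have [k yk kmin] := ex_minnP ex; have [u uy] := sg_surj k y; have [_ _ _ s2 s1] := sgP k.
  have uk : x' k <= u by rewrite -(sg_le k) uy s2.
  have ku : k != 0%N -> u < x' k.-1.
    move=> k0; rewrite -(sg_lt k) uy s1 ltNge; apply/negP => /kmin.
    by rewrite leqNgt ltn_predL lt0n k0.
  have xu : x0 < u := lt_le_trans (xx'0 k) uk.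
  exists u; first by rewrite gt_eqF.
  have [uN Nu] := NR _ xu.
  by have -> : N u = k by apply/eqP; rewrite eqn_leq (NleR _ _ _ _ (lexx _) Nu uk) (NleR _ _ _ _ (lexx _) ku uN).
Qed.

End gap_isomorphism.

(** * Transporting and refining constraints *)

Section gap_residual.
Variables (d : Order.disp_t) (X : orderType d).
Local Open Scope order_scope.
Local Open Scope classical_set_scope.
Hypothesis uhX : ultrahomogeneous_chain X.
Notation oX := (order_topology X).
Notation G := (set_type (@order_automorphism d X : set {ptws oX -> oX})).

(** These are the constraints satisfied by f o h when h satisfies p, so only the bounds are
    mapped. *)
Definition map_cell (f : X -> X) (p : seq (X * X * X)) :=
  [seq (q.1.1, f q.1.2, f q.2) | q <- p].

Lemma map_cell_cat f p q : map_cell f (p ++ q) = map_cell f p ++ map_cell f q.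
Proof. exact: map_cat. Qed.

Lemma map_cellK (f k : X -> X) p :
  (forall x a b, (x, a, b) \in p -> k (f a) = a /\ k (f b) = b) ->
  map_cell k (map_cell f p) = p.
Proof.
move=> fK; rewrite /map_cell -map_comp -[RHS]map_id; apply/eq_in_map => -[[x a] b] /fK[ka kb].
by rewrite /= ka kb.
Qed.

(** f o h need not be an automorphism, but only its finitely many values at the constrained
    arguments matter, and ultrahomogeneity extends those. *)
Lemma cell_transfer (S : {pred X}) (f : X -> X) p (h : G) :
  {in S &, {homo f : x y / x < y}} -> in_cell p (set_val h) ->
  (forall x a b, (x, a, b) \in p -> [&& set_val h x \in S, a \in S & b \in S]) ->
  exists h' : G, in_cell (map_cell f p) (set_val h').
Proof.
move=> f_lt ph pS; have pSx x : x \in [seq q.1.1 | q <- p] -> set_val h x \in S.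
  by move=> /mapP[[[z a] b] /pS/and3P[zS _ _] ->].
have [|h' h'E] := @Aut_extension _ _ uhX [seq q.1.1 | q <- p] (fun x => f (set_val h x)).
  by move=> x y /pSx xS /pSx yS xy; apply: f_lt; rewrite ?Aut_lt.
exists h'; apply/in_cellP => x a b /mapP[[[z a'] b'] zp [-> -> ->]] /=.
have /and3P[zS aS bS] := pS _ _ _ zp.
have /andP[az zb] := in_cellP _ _ ph _ _ _ zp.
by rewrite h'E ?f_lt//; apply/mapP; exists (z, a', b').
Qed.

(** Compose h with an automorphism that moves x0 and fixes every other bound and value in sight. *)
Lemma cell_avoid (x0 : X) p (h : G) (Z : seq X) : in_cell p (set_val h) ->
  exists h' : G, in_cell p (set_val h') /\ forall z, z \in Z -> set_val h' z != x0.
Proof.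
move=> ph.
pose S := [seq z <- [seq q.1.2 | q <- p] ++ [seq q.2 | q <- p] ++
  [seq (set_val h z : X) | z <- Z ++ [seq q.1.1 | q <- p]] | z != x0].
have xS : x0 \notin S by rewrite mem_filter eqxx.
have inS z : z != x0 -> z \in [seq q.1.2 | q <- p] ++ [seq q.2 | q <- p] ++
  [seq (set_val h z : X) | z <- Z ++ [seq q.1.1 | q <- p]] -> z \in S.
  by move=> z0 zS; rewrite mem_filter z0.
have [k [kA kS] kx] : exists2 k : X -> X, order_automorphism k /\ {in S, k =1 id} & k x0 != x0.
  apply: contrapT => nk; apply: (chain_orbit_infinite uhX xS).
  apply: (@sub_finite_set _ _ [set x0]); last exact: finite_set1.
  by move=> _ [k kP <-]; apply: contrapT => /eqP kx; apply: nk; exists k.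
have hA : order_automorphism (set_val h : X -> X) := set_valP h.
have khA : order_automorphism (k \o (set_val h : X -> X)).
  by split; [apply: bij_comp; [case: kA|case: hA]|move=> x y; rewrite /= kA.2 hA.2].
exists (exist _ (k \o (set_val h : X -> X) : {ptws oX -> oX}) (mem_set khA)); split.
  apply/in_cellP => z a b zp; change (is_true (a < k (set_val h z) < b)).
  have /andP[az zb] := in_cellP _ _ ph _ _ _ zp.
  have zE : set_val h z \in [seq q.1.2 | q <- p] ++ [seq q.2 | q <- p] ++
      [seq (set_val h z : X) | z <- Z ++ [seq q.1.1 | q <- p]].
    rewrite !mem_cat; apply/orP; right; apply/orP; right; apply: map_f.
    by rewrite mem_cat; apply/orP; right; apply/mapP; exists (z, a, b).
  (* If h z = x0, the strict bounds a and b differ from x0, hence are fixed by k, and k x0 stays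
     between them. *)
  have [z0|z0] := eqVneq (set_val h z) x0; last first.
    have kz : k (set_val h z) = set_val h z := kS _ (inS _ z0 zE).
    by rewrite kz az.
  have ka : k a = a.
    apply/kS/inS; first by rewrite -z0 lt_eqF.
    by rewrite mem_cat; apply/orP; left; apply/mapP; exists (z, a, b).
  have kb : k b = b.
    apply/kS/inS; first by rewrite -z0 gt_eqF.
    by rewrite !mem_cat; apply/orP; right; apply/orP; left; apply/mapP; exists (z, a, b).
  by rewrite -{1}ka -{1}kb !(order_automorphism_lt kA) az.
move=> z zZ; change (is_true (k (set_val h z) != x0)).
have [->//|z0] := eqVneq (set_val h z) x0.
rewrite kS//; apply: inS => //; rewrite !mem_cat; apply/orP; right; apply/orP; right.
by apply: map_f; rewrite mem_cat zZ.
Qed.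

(** With S an initial part of a dense sequence, repeated refinement leaves no room for a
    nondegenerate interval in the limit; bounds outside S also keep away from x0. *)
Lemma cell_refine (S Z : seq X) p (h : G) : in_cell p (set_val h) ->
  exists q, [/\ in_cell q (set_val h),
    forall h' : X -> X, in_cell q h' -> in_cell p h',
    forall z, z \in Z -> exists a b, (z, a, b) \in q &
    forall z a b, (z, a, b) \in q -> [/\ z \in Z ++ [seq t.1.1 | t <- p],
       a \notin S, b \notin S & forall s, s \in S -> a < s < b -> s = set_val h z]].
Proof.
move=> ph; pose T := S ++ [seq t.1.2 | t <- p] ++ [seq t.2 | t <- p].
have /choice[f fP] z : exists ab : X * X, [/\ ab.1 < set_val h z < ab.2,
    ab.1 \notin T, ab.2 \notin T,
    forall s, s \in T -> s < set_val h z -> s <= ab.1 &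
    forall s, s \in T -> set_val h z < s -> ab.2 <= s].
  have [[u zu] [v vz]] := chain_unbounded uhX (set_val h z).
  have [a /andP[_ az] aP] := chain_gap_left T vz.
  have [b /andP[zb _] bP] := chain_gap_right T zu.
  have [a' /andP[aa' a'z]] := chain_dense uhX az.
  have [b' /andP[zb' b'b]] := chain_dense uhX zb.
  exists (a', b'); split => /=.
  - by rewrite a'z zb'.
  - by apply/negP => /aP/(_ a'z); rewrite leNgt aa'.
  - by apply/negP => /bP/(_ zb'); rewrite leNgt b'b.
  - by move=> s sT sz; rewrite (le_trans (aP s sT sz))// ltW.
  - by move=> s sT sz; rewrite (le_trans _ (bP s sT sz))// ltW.
exists [seq (z, (f z).1, (f z).2) | z <- Z ++ [seq t.1.1 | t <- p]]; split.
- by apply/in_cellP => x a b /mapP[z _ [-> -> ->]]; have [] := fP z.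
- move=> h' qh'; apply/in_cellP => x a b xp.
  have [_ _ _ aP bP] := fP x.
  have /andP[ax xb] := in_cellP _ _ ph _ _ _ xp.
  have /andP[h1 h2] : (f x).1 < h' x < (f x).2.
    apply: (in_cellP _ _ qh'); apply/mapP; exists x => //.
    by rewrite mem_cat; apply/orP; right; apply/mapP; exists (x, a, b).
  have aT : a \in T by rewrite !mem_cat; apply/orP; right; apply/orP; left; apply/mapP; exists (x, a, b).
  have bT : b \in T by rewrite !mem_cat; apply/orP; right; apply/orP; right; apply/mapP; exists (x, a, b).
  by rewrite (le_lt_trans (aP _ aT ax) h1) (lt_le_trans h2 (bP _ bT xb)).
- move=> z zZ; exists (f z).1, (f z).2; apply/mapP; exists z => //.
  by rewrite mem_cat zZ.
- move=> x a b /mapP[z zZ [-> -> ->]]; have [_ aT bT aP bP] := fP z.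
  have ST s : s \in S -> s \in T by move=> sS; rewrite mem_cat sS.
  split => //; [by apply: contra aT; exact: ST|by apply: contra bT; exact: ST|].
  move=> s /ST sT /andP[s1 s2]; have [sz|zs|//] := ltgtP s (set_val h z).
    by have := aP s sT sz; rewrite leNgt s1.
  by have := bP s sT zs; rewrite leNgt s2.
Qed.

End gap_residual.

Section gap_no_residual.
Variables (d : Order.disp_t) (X : orderType d).
Local Open Scope order_scope.
Local Open Scope classical_set_scope.
Hypothesis uhX : ultrahomogeneous_chain X.
Notation oX := (order_topology X).
Notation G := (set_type (@order_automorphism d X : set {ptws oX -> oX})).
Variables (bG : topologicalType) (i : G -> bG).
Hypothesis iG : compactification i.
Notation cell p := [set h : G | in_cell p (set_val h)].

(** Compactness gives a point in all closures; it lies in W and every [V n], hence comes from some g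
    in G, and the sets E bring g back into each [c n]. *)
Lemma nested_preimage_limit (W : set bG) (V O : nat -> set bG) (c : nat -> set G) :
  W `&` \bigcap_n V n `<=` range i ->
  (forall n, closure (O n) `<=` W `&` V n) ->
  (forall n, exists2 E, open E /\ i @^-1` E `<=` c n & closure (O n) `<=` E) ->
  (forall n, c n.+1 `<=` i @^-1` (O n)) -> (forall n, c n !=set0) ->
  exists g, forall n, c n g.
Proof.
move=> WV OWV OE cO c0; have [cbG _ _ _] := iG.
have [|||x Ox] := @compact_bigcap_neq0 bG (fun n => closure (O n)) cbG.
- by move=> n; exact: closed_closure.
- move=> n; have [E [oE Ec] OnE] := OE n.+1; apply: (subset_trans OnE) => x Ex N.
  rewrite nbhsE => -[N' [oN' N'x] N'N].
  have [||h [Eh Nh]] := @compactification_meets _ _ _ iG (E `&` N').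
  + exact: openI.
  + by exists x.
  + by exists (i h); split; [apply: cO; exact: Ec|exact: N'N].
- by move=> n; have [h ch] := c0 n.+1; exists (i h); apply: subset_closure; exact: cO.
have [|g _ gx] := WV x.
  by split=> [|n _]; [have [] := OWV 0%N x (Ox 0%N I)|have [] := OWV n x (Ox n I)].
exists g => n; have [E [_ Ec] OnE] := OE n; apply: Ec; rewrite /= gx.
exact: OnE (Ox n I).
Qed.

(* A residual piece of G would contain two automorphisms g and g' such that
   g' = phi \o g away from g^-1 x0, where phi is as in gap_iso, and then g' has no
   possible value at g^-1 x0. They are obtained as limits of cells p and
   map_cell phi p that enter the open sets V n in turn. *)
Lemma separable_gap_no_residual (A B : set X) : separable oX -> proper_gap A B ->
  no_residual_piece i.
Proof.
move=> sX gapAB W V oW W0 VP WV.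
have [e eP] := chain_separable_enum uhX sX.
have [cbG hbG [injG ctsG _] denseG] := iG.
have [g0 Wg0] := compactification_meets iG oW W0.
have [p0 [p0g0 p0W]] := cell_base uhX (compactification_preimage_open iG oW) Wg0.
pose E0 := [seq q.1.2 | q <- p0] ++ [seq q.2 | q <- p0].
have [x0 x0E] : exists x0, x0 \notin E0.
  apply: contrapT => /forallNP h; apply: (uhX.1); apply: sub_finite_set (finite_seq E0) => x _.
  by have /negP := h x; rewrite negbK.
have [phi0 [phi0_lt phi0_surj]] := gap_iso uhX x0 sX gapAB.
have E0x x : x \in E0 -> x != x0 by move=> xE; apply: contraNneq x0E => <-.
(* Correcting [phi0] by the inverse of tau makes phi fix the bounds of [p0], so that both sequences
   of cells start inside W. *)
have [|tau tauE] := @Aut_extension _ _ uhX E0 phi0.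
  by move=> x y /E0x xx /E0x yx; exact: phi0_lt.
have [[t tK' Kt'] _] := set_valP tau.
have tK x : t (set_val tau x) = x := tK' x.
have Kt x : set_val tau (t x) = x := Kt' x.
pose phi x := t (phi0 x).
have t_lt : {mono t : x y / x < y} by move=> x y; rewrite -(Aut_lt tau) !Kt.
have phi_lt x y : x != x0 -> y != x0 -> x < y -> phi x < phi y.
  by move=> xx yx xy; rewrite /phi t_lt phi0_lt.
have phiE x : x \in E0 -> phi x = x by move=> xE; rewrite /phi -tauE// tK.
have /choice[psi psiP] y : exists x, x != x0 /\ phi x = y.
  by have [x xx xy] := phi0_surj (set_val tau y); exists x; rewrite /phi xy tK.
have psi0 y : psi y != x0 by have [] := psiP y.
have psiK y : phi (psi y) = y by have [] := psiP y.
have phi_le x y : x != x0 -> y != x0 -> phi x < phi y -> x < y.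
  move=> xx yx; apply: contraTT; rewrite -!leNgt le_eqVlt => /predU1P[->//|yx'].
  by apply: ltW; exact: phi_lt.
have phiK x : x != x0 -> psi (phi x) = x.
  move=> xx; have [lt|lt|//] := ltgtP (psi (phi x)) x.
    by have := phi_lt _ _ (psi0 _) xx lt; rewrite psiK ltxx.
  by have := phi_lt _ _ xx (psi0 _) lt; rewrite psiK ltxx.
have psi_lt x y : x < y -> psi x < psi y by move=> xy; apply: phi_le; rewrite ?psiK.
pose avoids (p : seq (X * X * X)) := forall x a b : X, (x, a, b) \in p -> a != x0 /\ b != x0.
pose inv (p : seq (X * X * X)) := [/\ cell p !=set0, cell (map_cell phi p) !=set0, avoids p,
  cell p `<=` cell p0 & cell (map_cell phi p) `<=` cell p0].
have p0E : map_cell phi p0 = p0.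
  rewrite -[RHS]map_id; apply/eq_in_map => -[[x a] b] xp /=.
  by rewrite !phiE// mem_cat; apply/orP; [right|left]; apply/mapP; exists (x, a, b).
have inv0 : inv p0.
  split; rewrite ?p0E//; [by exists g0|by exists g0|].
  by move=> x a b xp; split; apply: E0x; rewrite mem_cat; apply/orP; [left|right]; apply/mapP; exists (x, a, b).
(* By density of [V n], the open set of bG with trace [cell p] meets W and [V n] in a common point;
   O is chosen with closure inside all three, and r is a cell inside O. *)
have shrink n (p : seq (X * X * X)) : cell p !=set0 -> cell p `<=` cell p0 -> exists (O E : set bG) (r : seq (X * X * X)),
    [/\ closure O `<=` W `&` V n, open E /\ i @^-1` E = cell p, closure O `<=` E,
        cell r !=set0 & cell r `<=` i @^-1` O].
  move=> [h ph] pp0; have [E oE Ep] := compactification_openP iG (cell_open uhX p).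
  have [oV dV] := VP n.
  have [||x [[Ex Wx] Vx]] := dV (E `&` W).
  - exists (i h); split; first by rewrite -[E _]/((i @^-1` E) h) Ep.
    by apply: p0W; exact: pp0.
  - exact: openI.
  have [||h1 [[Eh Wh] Vh]] := @compactification_meets _ _ _ iG (E `&` W `&` V n).
  - by apply: openI => //; exact: openI.
  - by exists x.
  have [||O [oO Oh clO]] := @compact_hausdorff_shrink _ (i h1) (E `&` W `&` V n) cbG hbG.
  - by apply: openI => //; exact: openI.
  - by [].
  have [r [rh rO]] := cell_base uhX (compactification_preimage_open iG oO) Oh.
  exists O, E, r; split => //.
  - by move=> y /clO[[]].
  - by move=> y /clO[[]].
  - by exists h1.
(* The last clause makes the limit tight: after stage n the interval allowed at [e m] contains at
   most one value among e 0, ..., e n. *)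
pose step n (p : seq (X * X * X)) (T : seq (X * X * X) * (set bG * set bG)) := [/\ inv T.1,
  closure T.2.1 `<=` W `&` V n /\ (exists2 E, open E /\ i @^-1` E `<=` cell p & closure T.2.1 `<=` E),
  closure T.2.2 `<=` W `&` V n /\ (exists2 E, open E /\ i @^-1` E `<=` cell (map_cell phi p) & closure T.2.2 `<=` E),
  cell T.1 `<=` i @^-1` T.2.1 /\ cell (map_cell phi T.1) `<=` i @^-1` T.2.2 &
  forall m, (m <= n)%N -> exists a b, [/\ a != x0, b != x0,
    forall h : G, in_cell T.1 (set_val h) -> a < set_val h (e m) < b,
    forall h : G, in_cell (map_cell phi T.1) (set_val h) -> phi a < set_val h (e m) < phi b &
    forall j k, (j <= n)%N -> (k <= n)%N -> a < e j < b -> a < e k < b -> e j = e k]].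
have stepP n (p : seq (X * X * X)) : inv p -> exists T, step n p T.
  move=> [pne phine pav pp0 phip0].
  have [Q [E [r [OWV [oE Ep] OE [h1 rh1] rO]]]] := shrink n p pne pp0.
  pose Z := [seq e j | j <- iota 0 n.+1].
  have Ze j : (j <= n)%N -> e j \in Z by move=> jn; apply: map_f; rewrite mem_iota.
  (* Since phi is increasing only away from x0, h must not take the value x0 at a constrained
     argument before transfer. *)
  have [h [rh hx0]] := cell_avoid uhX x0 (Z ++ [seq q.1.1 | q <- r] ++ [seq q.1.1 | q <- p]) rh1.
  have rp h' : cell r h' -> cell p h' by move=> /rO Oh'; rewrite -Ep; apply: OE; exact: subset_closure.
  have [q2 [q2h q2r q2Z q2S]] := cell_refine uhX (x0 :: Z) Z rh.
  pose q := q2 ++ p.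
  have qav : avoids q.
    move=> x a b; rewrite mem_cat => /orP[/q2S[_ aS bS _]|/pav//].
    by split; [move: aS|move: bS]; rewrite in_cons negb_or => /andP[].
  have qh : in_cell q (set_val h) by rewrite in_cell_cat q2h; exact: rp.
  have [|x a b xq|h' h'q] := @cell_transfer _ _ uhX (predC1 x0) phi q h _ qh.
  - by move=> x y; exact: phi_lt.
  - have [a0 b0] := qav _ _ _ xq; apply/and3P; split => //.
    apply: hx0; move: xq; rewrite mem_cat => /orP[/q2S[+ _ _ _]|xp]; rewrite !mem_cat.
      by move=> /orP[]->; rewrite ?orbT.
    by apply/orP; right; apply/orP; right; apply/mapP; exists (x, a, b).
  have phiqp h'' : cell (map_cell phi q) h'' -> cell (map_cell phi p) h''.
    by rewrite /= map_cell_cat in_cell_cat => /andP[].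
  have [||Q' [E' [r' [OWV' [oE' Ep'] OE' [h2 rh2] rO']]]] := shrink n (map_cell phi q).
  - by exists h'.
  - by move=> h'' /phiqp; exact: phip0.
  have rq h'' : cell r' h'' -> cell (map_cell phi q) h''.
    by move=> /rO' Oh''; rewrite -Ep'; apply: OE'; exact: subset_closure.
  pose r1 := r' ++ map_cell phi q.
  (* Pulling back by psi gives [map_cell phi p' = r1], so one list governs both sequences; its
     bounds avoid x0 because the values of psi do. *)
  pose p' := map_cell psi r1.
  have p'E : p' = map_cell psi r' ++ q.
    rewrite /p' map_cell_cat [map_cell psi (map_cell _ _)]map_cellK// => x a b /qav[a0 b0].
    by rewrite !phiK.
  have phip' : map_cell phi p' = r1.
    by rewrite /p' map_cellK// => x a b _; rewrite !psiK.
  have p'q h'' : cell p' h'' -> cell q h'' by rewrite /= p'E in_cell_cat => /andP[].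
  have p'q2 h'' : cell p' h'' -> cell q2 h'' by move=> /p'q; rewrite /= in_cell_cat => /andP[].
  have r1q h'' : cell r1 h'' -> cell (map_cell phi q) h'' by rewrite /= in_cell_cat => /andP[].
  have r1h2 : in_cell r1 (set_val h2) by rewrite in_cell_cat rh2; exact: rq.
  exists (p', (Q, Q')); split => /=.
  - split.
    + have [//|//|h3 h3P] := @cell_transfer _ _ uhX predT psi r1 h2 _ r1h2; last by exists h3.
      by move=> x y _ _; exact: psi_lt.
    + by exists h2; rewrite /= phip'.
    + by move=> x a b /mapP[[[z a'] b'] _ [_ -> ->]].
    + by move=> h'' /p'q; rewrite /= in_cell_cat => /andP[_]; exact: pp0.
    + by rewrite phip' => h'' /r1q/phiqp; exact: phip0.
  - by split => //; exists E => //; split => //; rewrite Ep.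
  - by split => //; exists E' => //; split => // h''; rewrite Ep'; exact: phiqp.
  - split; first by move=> h'' /p'q2/q2r; exact: rO.
    by rewrite phip' => h''; rewrite /= in_cell_cat => /andP[+ _]; exact: rO'.
  - move=> m mn; have [a [b mq]] := q2Z _ (Ze m mn).
    have mq' : (e m, a, b) \in q by rewrite mem_cat mq.
    have [a0 b0] := qav _ _ _ mq'; exists a, b; split => //.
    + by move=> h'' /p'q2 /in_cellP; apply.
    + rewrite phip' => h'' /r1q /in_cellP; apply.
      by apply/mapP; exists (e m, a, b).
    + move=> j k jn kn; have [_ _ _ small] := q2S _ _ _ mq.
      have Se l : (l <= n)%N -> e l \in x0 :: Z by move=> ln; rewrite in_cons Ze ?orbT.
      by move=> /(small _ (Se _ jn)) -> /(small _ (Se _ kn)) ->.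
have /choice[f fP] (np : nat * seq (X * X * X)) : exists T, inv np.2 -> step np.1 np.2 T.
  have [ip|nip] := pselect (inv np.2); last by exists ([::], (set0, set0)).
  by have [T TP] := stepP np.1 np.2 ip; exists T.
pose P := fix P n := if n is m.+1 then (f (m, P m)).1 else p0.
have invP n : inv (P n) by elim: n => // n /(fP (n, P n))[].
have PS n : step n (P n) (f (n, P n)) := fP (n, P n) (invP n).
have [||||g gP] := @nested_preimage_limit W V (fun n => (f (n, P n)).2.1) (fun n => cell (P n)) WV.
- by move=> n; have [_ [] ] := PS n.
- by move=> n; have [_ []] := PS n.
- by move=> n; have [_ _ _ []] := PS n.
- by move=> n; have [] := invP n.
have [||||g' g'P] := @nested_preimage_limit W V (fun n => (f (n, P n)).2.2) (fun n => cell (map_cell phi (P n))) WV.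
- by move=> n; have [_ _ []] := PS n.
- by move=> n; have [_ _ []] := PS n.
- by move=> n; have [_ _ _ []] := PS n.
- by move=> n; have [] := invP n.
have [w gw] := Aut_surj g x0.
(* If g' were phi o g at w too, g w would be u; but g w = x0, which phi does not match with any
   value. *)
pose u := psi (set_val g' w).
have ux0 : u != x0 := psi0 _.
have phiu : phi u = set_val g' w by rewrite psiK.
have [v gv] := Aut_surj g u.
(* The interval from c1 to c2 contains two points of e, which the interval allowed at [e m]
   eventually cannot both contain. *)
have no_two m c1 c2 : c1 < c2 ->
    (forall a b, a != x0 -> b != x0 -> a < set_val g (e m) < b ->
       phi a < set_val g' (e m) < phi b -> a < c1 /\ c2 < b) -> False.
  move=> c12 h; have [j /andP[c1j jc2]] := eP _ _ c12; have [k /andP[jk kc2]] := eP _ _ jc2.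
  pose n := maxn m (maxn j k).
  have mn : (m <= n)%N by exact: leq_maxl.
  have jn : (j <= n)%N by rewrite /n !leq_max leqnn orbT.
  have kn : (k <= n)%N by rewrite /n !leq_max leqnn !orbT.
  have [_ _ _ _ /(_ m mn)[a [b [a0 b0 ga ga' small]]]] := PS n.
  have [ac1 c2b] := h a b a0 b0 (ga _ (gP n.+1)) (ga' _ (g'P n.+1)).
  have := small j k jn kn; rewrite (lt_trans ac1 c1j) (lt_trans jc2 c2b).
  rewrite (lt_trans (lt_trans ac1 c1j) jk) (lt_trans kc2 c2b) => /(_ isT isT) jkE.
  by move: jk; rewrite jkE ltxx.
(* For [e m] between v and w, monotonicity of g' puts g' (e m) below phi u, which forces the lower
   bound below u, while the upper bound exceeds g (e m). The allowed interval then always contains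
   the one from u to g (e m). The case x0 < u is symmetric. *)
have [ux|xu|uE] := ltgtP u x0; last by rewrite uE eqxx in ux0.
  have [m /andP[vm mw]] : exists m, v < e m < w by apply: eP; rewrite -(Aut_lt g) gv gw.
  have gm : set_val g (e m) < x0 by rewrite -gw Aut_lt.
  have ugm : u < set_val g (e m) by rewrite -gv Aut_lt.
  apply: (no_two m u (set_val g (e m)) ugm) => a b a0 b0 /andP[_ gb] /andP[pa _]; split => //.
  by apply: phi_le => //; rewrite phiu (lt_trans pa)// Aut_lt.
have [m /andP[wm mv]] : exists m, w < e m < v by apply: eP; rewrite -(Aut_lt g) gv gw.
have gmu : set_val g (e m) < u by rewrite -gv Aut_lt.
apply: (no_two m (set_val g (e m)) u gmu) => a b a0 b0 /andP[ga _] /andP[_ pb]; split => //.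
by apply: phi_le => //; rewrite phiu (lt_trans _ pb)// Aut_lt.
Qed.

End gap_no_residual.

(** * Groups over a discrete set *)

Section remainder_dichotomy.
Variable (R : realType) (G : topologicalType).

Lemma complete_cover_family_cech :
  (exists (bG : topologicalType) (i : G -> bG), compactification i) ->
  complete_cover_family G ->
  every_remainder G (fun Y => lindelof Y /\ sigma_compact Y) /\ cech_complete G.
Proof.
move=> [bG [i iG]] cG; split; last first.
  by exists bG, i; split => //; exact: complete_cover_family_Gdelta.
move=> bG' i' iG'.
have sY := Gdelta_remainder_sigma_compact iG' (complete_cover_family_Gdelta iG' cG).
by split => //; exact: sigma_compact_lindelof.
Qed.

Lemma not_shrinks_not_cech (g : G) : ~ shrinks_to_compact G ->
  every_remainder G (fun Y => pseudocompact Y R /\ baire Y) /\ ~ cech_complete G.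
Proof.
move=> nG; split=> [bG i iG|[bG [i [iG]]]].
  split; first exact: not_shrinking_pseudocompact.
  exact: (no_residual_piece_baire (no_residual_pieceP iG nG)).
exact: (no_residual_piece_NGdelta iG g (no_residual_pieceP iG nG)).
Qed.

End remainder_dichotomy.

Lemma infinite_image (T U : Type) (f : T -> U) (A : set T) :
  injective f -> infinite_set A -> infinite_set (f @` A).
Proof.
by move=> injf; rewrite (eq_finite_set (inj_card_eq (in2W injf))).
Qed.

Section discrete_groups.
Variables (R : realType).

Lemma discrete_sub_ptws_compactification (X : choiceType)
    (A : set {ptws discrete_topology X -> discrete_topology X}) :
  exists (bG : topologicalType) (i : set_type A -> bG), compactification i.
Proof.
apply: (@sub_ptws_compactification _ _ A R); first exact: discrete_completely_regular.
exact: discrete_hausdorff.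
Qed.

Lemma symmetric_group_not_shrinks (X : choiceType) :
  ~ countable [set: X] -> ~ shrinks_to_compact (symmetric_group X).
Proof.
move=> ncX; apply: discrete_not_shrinks => // g s x xs.
have injg : injective (set_val g : X -> X) by apply: bij_inj; exact: (set_valP g).
have inf : infinite_set [set y | y \notin s].
  move=> fs; apply: ncX; apply: finite_set_countable.
  apply: (@sub_finite_set _ _ ([set y | y \notin s] `|` [set` s])).
    by move=> y _; have [ys|ys] := boolP (y \in s); [right|left].
  by rewrite finite_setU; split => //; exact: finite_seq.
apply: sub_infinite_set (infinite_image injg inf) => _ [y /= ys <-].
pose t z := if z == x then y else if z == y then x else z.
have tK : involutive t.
  rewrite /t => z; case: (eqVneq z x) => [->|zx].
    by case: (eqVneq y x) => [->//|yx]; rewrite eqxx.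
  by case: (eqVneq z y) => [->|zy]; rewrite ?eqxx// (negPf zx) (negPf zy).
have bij : bijective ((set_val g : X -> X) \o t).
  by apply: bij_comp; [exact: (set_valP g)|exact: inv_bij].
exists (exist _ ((set_val g : X -> X) \o t : {ptws discrete_topology X -> discrete_topology X}) (mem_set bij)).
  move=> z zs; change (set_val g (t z) = set_val g z); rewrite /t.
  have [zx|_] := eqVneq z x; first by rewrite zx in zs; rewrite zs in xs.
  by have [zy|//] := eqVneq z y; rewrite zy in zs; rewrite zs in ys.
by change (set_val g (t x) = set_val g y); rewrite /t eqxx.
Qed.

Lemma Aut_permutation_not_shrinks (d : Order.disp_t) (X : orderType d) :
  ultrahomogeneous_chain X -> ~ countable [set: X] ->
  ~ shrinks_to_compact (Aut_permutation X).
Proof.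
move=> uhX ncX; apply: discrete_not_shrinks => // g s x xs.
have gA : order_automorphism (set_val g : X -> X) := set_valP g.
have injg : injective (set_val g : X -> X) by apply: bij_inj; case: gA.
apply: sub_infinite_set (infinite_image injg (chain_orbit_infinite uhX xs)).
move=> _ [_ [k [kA ks] <-] <-].
have gkA : order_automorphism ((set_val g : X -> X) \o k).
  by split; [apply: bij_comp; [case: gA|case: kA]|move=> y z; rewrite /= gA.2 kA.2].
exists (exist _ ((set_val g : X -> X) \o k : {ptws discrete_topology X -> discrete_topology X}) (mem_set gkA)) => //.
by move=> z zs; change (set_val g (k z) = set_val g z); rewrite ks.
Qed.

Lemma group_over_discrete_cases (X : choiceType) (G : topologicalType) :
  infinite_set [set: X] -> group_over_discrete R X G ->
  [/\ exists (bG : topologicalType) (i : G -> bG), compactification i,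
      countable [set: X] -> complete_cover_family G,
      ~ countable [set: X] -> ~ shrinks_to_compact G & exists g : G, True].
Proof.
move=> iX GX; move: iX; case: GX => {X G} [X|X|d X uhX] iX.
- have [x0 _] : [set: X] !=set0 by apply/set0P/eqP => X0; apply: iX; rewrite X0.
  split.
  + exact: (@sub_ptws_compactification (l2 R X) (l2 R X) _ R (@l2_completely_regular R X) (@l2_hausdorff R X)).
  + exact: unitary_complete_cover.
  + exact: unitary_not_shrinks.
  + have uid : unitary (@idfun (l2 R X)) by split => //; exists idfun.
    by exists (exist _ (idfun : {ptws l2 R X -> l2 R X}) (mem_set uid)).
- split.
  + exact: (@discrete_sub_ptws_compactification X (@bijective X X)).
  + by apply: discrete_complete_cover.
  + exact: symmetric_group_not_shrinks.
  + have bid : bijective (@idfun X) by exists idfun.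
    by exists (exist _ (idfun : {ptws discrete_topology X -> discrete_topology X}) (mem_set bid)).
- split.
  + exact: (@discrete_sub_ptws_compactification X (@order_automorphism d X)).
  + apply: discrete_complete_cover; first by move=> g [].
    move=> g bg gP; split => // x y.
    by have [h [_ hle] [<- <-]] := gP x y; exact: hle.
  + exact: Aut_permutation_not_shrinks.
  + have oid : order_automorphism (@idfun X) by split => //; exists idfun.
    by exists (exist _ (idfun : {ptws discrete_topology X -> discrete_topology X}) (mem_set oid)).
Qed.

End discrete_groups.

(** * The equivalences *)

Lemma not_continuously_dense_gap (d : Order.disp_t) (X : orderType d) :
  ultrahomogeneous_chain X -> ~ continuously_dense X -> exists A B : set X, proper_gap A B.
Proof.
move=> uhX ncd; apply: contrapT => /forallNP ng; apply: ncd => A B; split; last first.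
  by move=> gap; apply: (ng A); exists B.
move=> [[_ _ AB ltAB] [a Aa aA] [b Bb bB]].
have [c /andP[ac cb]] := chain_dense uhX (ltAB _ _ Aa Bb).
have : [set: X] c by []; rewrite -AB => -[/aA|/bB]; first by rewrite leNgt ac.
by rewrite leNgt cb.
Qed.

Theorem theorem6p2 (R : realType) :
  (forall (X : choiceType) (G : topologicalType),
    infinite_set [set: X] -> group_over_discrete R X G ->
    ((every_remainder G (fun Y => lindelof Y /\ sigma_compact Y) /\
      cech_complete G) <-> countable [set: X]) /\
    ((every_remainder G (fun Y => pseudocompact Y R /\ baire Y) /\
      ~ cech_complete G) <-> ~ countable [set: X])) /\
  (forall (d : Order.disp_t) (X : orderType d),
    ultrahomogeneous_chain X ->
    ((every_remainder (Aut_pointwise X)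
        (fun Y => lindelof Y /\ sigma_compact Y) /\
      cech_complete (Aut_pointwise X)) <->
     continuously_dense X /\ separable (order_topology X)) /\
    ((every_remainder (Aut_pointwise X) (fun Y => lindelof Y /\ baire Y) /\
      ~ cech_complete (Aut_pointwise X)) <->
     separable (order_topology X) /\ ~ continuously_dense X) /\
    ((every_remainder (Aut_pointwise X)
        (fun Y => pseudocompact Y R /\ baire Y) /\
      ~ cech_complete (Aut_pointwise X)) <->
     ~ separable (order_topology X))).
Proof.
split=> [X G iX GX|d X uhX].
  have [compG cov shr [g _]] := group_over_discrete_cases iX GX.
  split; split.
  - move=> [_ cG]; apply: contrapT => /shr nG.
    by have [_] := not_shrinks_not_cech R g nG.
  - by move=> cX; apply: complete_cover_family_cech => //; exact: cov.
  - by move=> [_ ncG] cX; have [_] := complete_cover_family_cech compG (cov cX).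
  - by move=> /shr; exact: not_shrinks_not_cech.
have idA : order_automorphism (@idfun X) by split => //; exists idfun.
pose g : Aut_pointwise X := exist _ (idfun : {ptws order_topology X -> order_topology X}) (mem_set idA).
(* Two incompatible conclusions are compared on one compactification; without any, claims about
   every remainder would hold vacuously. *)
have [bG0 [i0 iG0]] := Aut_pointwise_compactification R uhX.
have not_both : ~ cech_complete (Aut_pointwise X) ->
    lindelof (remainder i0) -> pseudocompact (remainder i0) R -> False.
  move=> ncG lY pY; apply: ncG; exists bG0, i0; split => //; apply: open_Gdelta.
  exact: (lindelof_pseudocompact_remainder iG0 lY pY).
have caseA : continuously_dense X -> separable (order_topology X) ->
    every_remainder (Aut_pointwise X) (fun Y => lindelof Y /\ sigma_compact Y) /\
    cech_complete (Aut_pointwise X).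
  move=> cdX sX; apply: complete_cover_family_cech; first by exists bG0, i0.
  exact: Aut_pointwise_complete_cover.
have caseB : ~ continuously_dense X -> separable (order_topology X) ->
    every_remainder (Aut_pointwise X) (fun Y => lindelof Y /\ baire Y) /\
    ~ cech_complete (Aut_pointwise X).
  move=> /(not_continuously_dense_gap uhX)[A [B gapAB]] sX; split.
    move=> bG i iG; have [C oC baseC] := Aut_pointwise_second_countable uhX sX.
    split; first exact: (second_countable_remainder_lindelof iG oC baseC).
    exact: (no_residual_piece_baire (separable_gap_no_residual uhX iG sX gapAB)).
  move=> [bG [i [iG]]].
  exact: (no_residual_piece_NGdelta iG g (separable_gap_no_residual uhX iG sX gapAB)).
have caseC : ~ separable (order_topology X) ->
    every_remainder (Aut_pointwise X) (fun Y => pseudocompact Y R /\ baire Y) /\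
    ~ cech_complete (Aut_pointwise X).
  by move=> nsX; apply: (not_shrinks_not_cech R g); exact: Aut_pointwise_not_shrinks.
have [sX|nsX] := pselect (separable (order_topology X)); last first.
  have [rC ncG] := caseC nsX.
  split; first by split => [[_ /ncG]|[_ /nsX]].
  split; last by split.
  split => [[rL _]|[/nsX]//]; exfalso; apply: not_both => //.
    by have [] := rL _ _ iG0.
  by have [] := rC _ _ iG0.
have [cdX|ncdX] := pselect (continuously_dense X).
  have [rA cG] := caseA cdX sX.
  split; first by split.
  split; first by split => [[_ /(_ cG)]|[_ /(_ cdX)]].
  by split => [[_ /(_ cG)]|/(_ sX)].
have [rB ncG] := caseB ncdX sX.
split; first by split => [[_ /ncG]|[/ncdX]].
split; first by split.
split => [[rP _]|/(_ sX)//]; exfalso; apply: not_both => //.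
  by have [] := rB _ _ iG0.
by have [] := rP _ _ iG0.
Qed.
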